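(* Let $d\ge 3$, $\mathbf{x}\in\mathbb{S}^d$, $r>0$, and let $f\in C(\mathbb{S}^d)$ and $\delta>0$ be such that $$\|f\|_{d;r,\mathbf{x}}:=\|f\|_\infty+\min_{P\in\Pi_r^d}\max_{\mathbf{y}\in\mathbb{B}(\mathbf{x},\delta)}\frac{|f(\mathbf{y})-P(\mathbf{y})|}{|\mathbf{x}-\mathbf{y}|_{d+1}^r}<\infty.$$ Let $n$ (with $dn$ an integer) satisfy $nd\ge(d+r+1)^2$, and let $\nu\in\mathsf{MZQ}(d;2(d+2)n)$. If $n$ is large enough that $$\delta_n:=\sqrt{\frac{16r\log n}{n}}\le \delta,$$ then $$|f(\mathbf{x})-\sigma_{d;n,r}(\nu,f)(\mathbf{x})|\lesssim \frac{d^{1/6}}{\mathsf{dim}(\Pi_{2(d+2)n}^d)^{r/d}}\|f\|_{d;r,\mathbf{x}}|\!|\!|\nu|\!|\!|_{d;2(d+2)n},$$ and $$\left|f(\mathbf{x})-\int_{\mathbb{B}(\mathbf{x},\delta_n)}\Phi_{d;n,r}(\mathbf{x}\cdot\mathbf{y})f(\mathbf{y})d\nu(\mathbf{y})\right|\lesssim \frac{d^{1/6}}{\mathsf{dim}(\Pi_{2(d+2)n}^d)^{r/d}}\|f\|_{d;r,\mathbf{x}}|\!|\!|\nu|\!|\!|_{d;2(d+2)n}.$$ All constants implicit in $\lesssim$ depend only on $r$ and are otherwise independent of $f$, $\mathbf{x}$, $n$, $d$.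
   Context: $\mathbb{S}^d=\{\mathbf{x}\in\mathbb{R}^{d+1}:|\mathbf{x}|_{d+1}=1\}$, $|\cdot|_{d+1}$ the Euclidean norm; $\mathbb{B}(\mathbf{x},\delta)=\{\mathbf{y}\in\mathbb{S}^d:|\mathbf{x}-\mathbf{y}|_{d+1}\le\delta\}$; $\mu_d^*$ is the rotation-invariant surface measure on $\mathbb{S}^d$ with $\mu_d^*(\mathbb{S}^d)=1$. For real $m>0$, $\Pi_m^d$ is the space of restrictions to $\mathbb{S}^d$ of algebraic polynomials in $d+1$ variables of total degree $<m$ ($r$ need not be an integer). $\|g\|_\infty=\sup_{\mathbb{S}^d}|g|$. For $\alpha,\beta>-1$, $p_\ell^{(\alpha,\beta)}$ is the Jacobi polynomial of degree $\ell$ with positive leading coefficient, orthonormal with respect to $(1-x)^\alpha(1+x)^\beta dx$ on $[-1,1]$. Let $\omega_d=2\pi^{(d+1)/2}/\Gamma((d+1)/2)$, $K_{d;m}(t)=\frac{\omega_d}{\omega_{d-1}}\sum_{0\le\ell<m}p_\ell^{(d/2-1,d/2-1)}(1)p_\ell^{(d/2-1,d/2-1)}(t)$, and $$\Phi_{d;n,r}(t)=K_{d;(d+2)n}(t)\frac{p_{dn}^{(d/2+r,d/2-2)}(t)}{p_{dn}^{(d/2+r,d/2-2)}(1)}\left(\frac{1+t}{2}\right)^n.$$ For a signed Borel measure $\nu$ of bounded total variation, $\sigma_{d;n,r}(\nu,f)(\mathbf{x})=\int f(\mathbf{y})\Phi_{d;n,r}(\mathbf{x}\cdot\mathbf{y})d\nu(\mathbf{y})$.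 $\nu\in\mathsf{MZQ}(d;m)$ means: $\int P\,d\nu=\int P\,d\mu_d^*$ for all $P\in\Pi_m^d$, and there is $c>0$ with $\int|P|^2d|\nu|\le c\int|P|^2d\mu_d^*$ for all $P\in\Pi_{m/2}^d$; $|\!|\!|\nu|\!|\!|_{d;m}$ is the infimum of such $c$. Convention: $A\lesssim B$ means $A\le cB$ for a positive constant $c$ (here depending only on $r$). *)

(* Defs.v *)
From HB Require Import structures.
From mathcomp Require Import all_boot all_order all_algebra.
From mathcomp Require Import all_classical all_reals all_analysis.
From mathcomp Require mpoly.
Unset Implicit Arguments.
Unset Strict Implicit.
Unset Printing Implicit Defensive.
Import Order.TTheory GRing.Theory Num.Theory.
Local Open Scope classical_set_scope.
Local Open Scope ring_scope.

Section Defs.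
Context {R : realType}.

(* points of R^{d+1}, with the product (= Borel) sigma-algebra *)
Definition pt (d : nat) := (d.+1).-tuple R.

Definition dot {d : nat} (x y : pt d) : R :=
  \sum_(i < d.+1) tnth x i * tnth y i.

Definition dist {d : nat} (x y : pt d) : R :=
  Num.sqrt (\sum_(i < d.+1) (tnth x i - tnth y i) ^+ 2).

Definition sphere (d : nat) : set (pt d) := [set x | dot x x = 1].

Definition capS {d : nat} (x : pt d) (delta : R) : set (pt d) :=
  [set y | sphere d y /\ dist x y <= delta].

Definition rotate {d : nat} (Q : 'M[R]_(d.+1)) (x : pt d) : pt d :=
  [tuple \sum_(j < d.+1) Q i j * tnth x j | i < d.+1].

(* mu_d^* : the rotation-invariant (Borel) measure carried by S^d with
   total mass 1 (unique such measure) *)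
Definition is_sphere_measure {d : nat} (mu : {measure set pt d -> \bar R}) :=
  [/\ mu (sphere d) = 1%E, mu (~` sphere d) = 0%E &
      forall Q : 'M[R]_(d.+1), Q^T *m Q = 1%:M ->
        forall A, measurable A -> mu (rotate Q @^-1` A) = mu A].

Definition poly_fun {d : nat} (p : mpoly.mpoly d.+1 R) : pt d -> R :=
  fun x => mpoly.meval (fun i => tnth x i) p.

Definition Pi (d : nat) (m : R) : set (pt d -> R) :=
  [set P | exists p : mpoly.mpoly d.+1 R,
     all (fun mon => (mpoly.mdeg mon)%:R < m) (mpoly.msupp p) /\
     P = poly_fun p].

Definition is_dimPi (d : nat) (m : R) (D : nat) :=
  exists b : 'I_D -> pt d -> R,
    [/\ forall i, Pi d m (b i),
        (forall c : 'I_D -> R,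
           (forall x, sphere d x -> \sum_(i < D) c i * b i x = 0) ->
           forall i, c i = 0) &
        (forall P, Pi d m P -> exists c : 'I_D -> R,
           forall x, sphere d x -> P x = \sum_(i < D) c i * b i x)].

Definition Gamma (s : R) : R :=
  fine (\int[lebesgue_measure]_(t in [set t : R | 0 < t])
          (powR t (s - 1) * expR (- t))%:E).

Definition omega (d : nat) : R :=
  2 * powR pi ((d%:R + 1) / 2) / Gamma ((d%:R + 1) / 2).

Definition is_jacobi (a b : R) (p : nat -> {poly R}) :=
  (forall l, size (p l) = l.+1 /\ 0 < lead_coef (p l)) /\
  (forall k l,
     (\int[lebesgue_measure]_(t in [set t : R | (-1 <= t <= 1)%R])
        ((p k).[t] * (p l).[t] * powR (1 - t) a * powR (1 + t) b)%R%:E)%E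
     = ((k == l)%:R)%:E).

(* K_{d;m}(t), J = (p_l^{(d/2-1,d/2-1)})_l *)
Definition Kker (d : nat) (J : nat -> {poly R}) (m t : R) : R :=
  omega d / omega d.-1 *
  \sum_(l < (Num.truncn m).+1 | l%:R < m) (J l).[1] * (J l).[t].

(* Phi_{d;n,r}(t), with k = d n, J1 = (p_l^{(d/2-1,d/2-1)})_l and
   J2 = (p_l^{(d/2+r,d/2-2)})_l *)
Definition Phi (d : nat) (n : R) (k : nat) (J1 J2 : nat -> {poly R}) (t : R) : R :=
  Kker d J1 ((d%:R + 2) * n) t * ((J2 k).[t] / (J2 k).[1]) *
  powR ((1 + t) / 2) n.

Definition sint {d : nat} {nu : {charge set pt d -> \bar R}} {P N : set (pt d)}
  (nuPN : hahn_decomposition nu P N) (D : set (pt d)) (g : pt d -> R) : \bar R :=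
  (\int[jordan_pos nuPN]_(y in D) (g y)%:E -
   \int[jordan_neg nuPN]_(y in D) (g y)%:E)%E.

Definition sigma {d : nat} (n : R) (k : nat) (J1 J2 : nat -> {poly R})
  {nu : {charge set pt d -> \bar R}} {P N : set (pt d)}
  (nuPN : hahn_decomposition nu P N) (f : pt d -> R) (x : pt d) : \bar R :=
  sint nuPN (sphere d) (fun y => f y * Phi d n k J1 J2 (dot x y)).

Definition mzq_bound {d : nat} (m : R) {nu : {charge set pt d -> \bar R}}
  {P N : set (pt d)} (nuPN : hahn_decomposition nu P N)
  (mu : {measure set pt d -> \bar R}) (c : R) :=
  forall Q, Pi d (m / 2) Q ->
    (\int[charge_variation nuPN]_(y in sphere d) (`|Q y| ^+ 2)%:E
     <= c%:E * \int[mu]_(y in sphere d) (`|Q y| ^+ 2)%:E)%E.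

Definition MZQ (d : nat) (m : R) {nu : {charge set pt d -> \bar R}}
  {P N : set (pt d)} (nuPN : hahn_decomposition nu P N)
  (mu : {measure set pt d -> \bar R}) :=
  (forall Q, Pi d m Q ->
     (sint nuPN (sphere d) Q = \int[mu]_(y in sphere d) (Q y)%:E)%E) /\
  exists c : R, 0 < c /\ mzq_bound m nuPN mu c.

Definition mzq_norm {d : nat} (m : R) {nu : {charge set pt d -> \bar R}}
  {P N : set (pt d)} (nuPN : hahn_decomposition nu P N)
  (mu : {measure set pt d -> \bar R}) : \bar R :=
  ereal_inf [set c%:E | c in [set c : R | 0 < c /\ mzq_bound m nuPN mu c]].

Definition cont_on_sphere {d : nat} (f : pt d -> R) :=
  forall x, sphere d x -> forall e : R, 0 < e ->
    exists2 eta : R, 0 < eta &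
      forall y, sphere d y -> dist x y < eta -> `|f x - f y| < e.

Definition supnorm {d : nat} (f : pt d -> R) : \bar R :=
  ereal_sup [set (`|f y|)%:E | y in sphere d].

Definition locdev {d : nat} (r : R) (x : pt d) (delta : R) (f P : pt d -> R) : \bar R :=
  ereal_sup [set (`|f y - P y| / powR (dist x y) r)%:E
            | y in [set y | capS x delta y /\ y <> x]].

Definition locnorm {d : nat} (r : R) (x : pt d) (delta : R) (f : pt d -> R) : \bar R :=
  (supnorm f + ereal_inf [set locdev r x delta f P | P in Pi d r])%E.

End Defs.

(* Main.v *)
(* Write K for the kernel of degree < (d+2)n, Pt for the Jacobi factor normalized at 1, v = (1+t)/2,
   u = 1-t, and let Psi be Phi with v^n replaced by a polynomial G of degree < n that agrees with v^n
   to high order at t = 1 (n need not be an integer). If P has degree < r and approximates f at x, then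
   f(x) = P(x), and K reproduces P(x . y) Pt G, so exactness of nu gives
     f(x) - int f Phi dnu = int (P Psi - f Phi) dnu.
   The integrand is pointwise at most C (|f| + L) |K Pt| u^(r/2): near x because P - f = O(u^(r/2))
   and v^n - G = O(u^(r/2)); far from x because v^n is at most n^(-2r) there, while P grows at most
   like n^r (interpolation along great circles through x).

   It remains to bound int |K Pt| u^(r/2) d|nu| by C n^(-r) times the Marcinkiewicz-Zygmund constant.
   By AM-GM this splits into int K^2 d|nu| and int Pt^2 u^r d|nu|. The weight u^r is comparable to a
   dyadic sum of squares of polynomials (built from Fejer-type kernels) down to the scale n^(-2), so the
   Marcinkiewicz-Zygmund inequality transfers both integrals to the sphere measure. There int K^2 = K(1),
   and Pt minimizes int Q^2 w/u over Q(1) = 1, where w is its Jacobi weight; comparison with a damped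
   reproducing kernel Q gives int Pt^2 u^r <= C n^(-2r) / K(1). The bottom scale of the dyadic sum needs
   int Pt^2 <= C n^(2r) int Pt^2 u^r, a Remez-type estimate from the Nikolskii inequality.

   Integrals over the sphere are computed from rotation invariance alone: infinitesimal rotations
   reduce the integral of a zonal function times a polynomial to a Gegenbauer integral on [-1, 1].
   K(1) is explicit by the three-term recursion; it dominates the dimension of the polynomial space
   and is at most 2(4(m+d)/d)^d, where m is the degree. *)
Require Import Defs.
From HB Require Import structures.
From mathcomp Require Import all_boot all_order all_algebra.
From mathcomp Require Import all_classical all_reals all_analysis measurable_realfun.
From mathcomp Require mpoly.
From mathcomp Require Import ring lra zify.
Import Order.TTheory GRing.Theory Num.Theory.
Import numFieldNormedType.Exports.
Local Open Scope classical_set_scope.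
Local Open Scope ring_scope.
Set Implicit Arguments.
Unset Strict Implicit.
Unset Printing Implicit Defensive.

(** * Gegenbauer weight *)

(** The difficulty is uniformity in d: the mass [Lam d 1], the kernel value K(1) and the dimension
    can be exponentially small or large in d, while the constant may depend on r only. Such factors
    are kept inside quotients. The values K(1) at degrees about (d-1)n and (d+2)n differ by a factor
    at most (1+6/d)^d <= e^6; the power r/d turns (40n)^d into (40n)^r; in the Remez step the cap
    has height (32n)^(-2), small enough to beat every d-th power. The other constraint is degree.
    The inequality for |nu| sees only squares of polynomials of degree < (d+2)n, and u^r is in
    general no polynomial. The Jacobi factor has degree dn, so a margin of 2n remains; the
    Fejer-type factors of a dyadic term have total degree at most n and fit into it, which fixes the
    bottom scale n^(-2). The same margin lets the kernel reproduce P Pt G. The hypothesis nd >=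
    (d+r+1)^2 yields n >= d and, by AM-GM, n >= 4(r+1). The integer i0 just above r/2 is both the
    order of contact of G with v^n and half the power of 1 - Fejer in the dyadic sum. *)

Section PowRContinuity.
Context {R : realType}.
Implicit Types (a t : R) (Q : {poly R}).

Lemma continuous_norm_powR a : 0 <= a -> continuous (fun x : R => `|x| `^ a).
Proof.
rewrite le_eqVlt => /orP[/eqP<-|a0] x.
  have -> : (fun x : R => `|x| `^ 0) = cst 1 by apply/funext => y; rewrite powRr0.
  exact: cst_continuous.
have [->|x0] := eqVneq x 0.
  apply/cvgrPdist_lt => e e0; rewrite normr0 powR0 ?gt_eqF//.
  near=> y.
  rewrite sub0r normrN ger0_norm ?powR_ge0//.
  have -> : e = (e `^ a^-1) `^ a by rewrite -powRrM mulVf ?gt_eqF// powRr1// ltW.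
  apply: gt0_ltr_powR => //; rewrite ?nnegrE ?powR_ge0//.
  near: y.
  apply/nbhs_normP; exists (e `^ a^-1); first by rewrite /= powR_gt0.
  by move=> y /=; rewrite sub0r normrN.
apply: (@continuous_comp _ _ _ (fun x : R => `|x|) (fun y => y `^ a)).
  exact: norm_continuous.
apply: differentiable_continuous.
apply/derivable1_diffP.
by have [] := is_derive1_powR a (_ : 0 < `|x|); rewrite ?normr_gt0.
Unshelve. all: by end_near. Qed.

(* The absolute value makes the weight continuous on the whole line. *)
Definition gweight a t : R := `|1 - t ^+ 2| `^ a.

Lemma continuous_gweight a : 0 <= a -> continuous (gweight a).
Proof.
move=> a0 t.
apply: (@continuous_comp _ _ _ (fun t : R => 1 - t ^+ 2) (fun y => `|y| `^ a)); last first.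
  exact: continuous_norm_powR.
apply: continuousB; first exact: cst_continuous.
exact: exprn_continuous.
Qed.

Lemma gweightE a t : -1 <= t <= 1 -> gweight a t = (1 - t) `^ a * (1 + t) `^ a.
Proof.
move=> /andP[t1 t2]; rewrite /gweight -powRM; [|lra|lra].
have -> : (1 - t) * (1 + t) = 1 - t ^+ 2 by ring.
by rewrite ger0_norm//; nra.
Qed.

Lemma gweight_ge0 a t : 0 <= gweight a t.
Proof. exact: powR_ge0. Qed.

Lemma is_derive_gweight a t : -1 < t < 1 ->
  is_derive t 1 (gweight (a + 1)) (- (2 * (a + 1)) * t * gweight a t).
Proof.
move=> /andP[t1 t2].
have h : 0 < 1 - t ^+ 2 by nra.
have E : is_derive t 1 ((fun x => x `^ (a + 1)) \o (fun s => 1 - s ^+ 2))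
   (((a + 1) * (1 - t ^+ 2) `^ (a + 1 - 1)) * (- (2 * t))).
  apply: is_derive1_comp; first exact: is_derive1_powR.
  apply: is_derive_eq; rewrite !scaler1 /= /GRing.scale /=.
  by ring.
apply: (near_eq_is_derive (f := (fun x => x `^ (a + 1)) \o (fun s => 1 - s ^+ 2))).
  near=> s; rewrite /gweight /= ger0_norm//.
  have : s \in `]-1, 1[ by near: s; apply: near_in_itvoo; rewrite in_itv/= t1.
  by rewrite in_itv/= => /andP[s1 s2]; nra.
apply: is_derive_eq E _.
by rewrite addrK /gweight (ger0_norm (ltW h)); ring.
Unshelve. all: by end_near. Qed.

Definition I11 : set R := `[-1, 1].

Lemma measurable_I11 : measurable I11.
Proof. exact: measurable_itv. Qed.

Lemma continuous_I11_integrable (f : R -> R) : continuous f ->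
  (@lebesgue_measure R).-integrable I11 (EFin \o f).
Proof.
move=> cf; apply: continuous_compact_integrable; first exact: segment_compact.
exact: continuous_subspaceT.
Qed.

(** The weight (1-t^2)^(d/2-1) is, up to its total mass [Lam d 1], the density of the latitude x . y
    on the sphere. *)
Definition Lam (d : nat) Q : R :=
  \int[lebesgue_measure]_(t in I11) (Q.[t] * gweight (d%:R / 2 - 1) t).

Lemma exponent_ge0 (d : nat) : (2 <= d)%N -> 0 <= d%:R / 2 - 1 :> R.
Proof. by rewrite -(ler_nat R) => h; lra. Qed.

Lemma continuous_poly_gweight a Q : 0 <= a -> continuous (fun t => Q.[t] * gweight a t).
Proof.
move=> a0 t; apply: continuousM; first exact: continuous_horner.
exact: continuous_gweight.
Qed.

Lemma integrable_Lam d Q : (2 <= d)%N ->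
  (@lebesgue_measure R).-integrable I11
    (fun t => (Q.[t] * gweight (d%:R / 2 - 1) t)%:E).
Proof.
move=> d2; apply: continuous_I11_integrable.
by apply: continuous_poly_gweight; exact: exponent_ge0.
Qed.

Lemma LamD d Q1 Q2 : (2 <= d)%N -> Lam d (Q1 + Q2) = Lam d Q1 + Lam d Q2.
Proof.
move=> d2; rewrite /Lam -RintegralD//; try exact: integrable_Lam.
  by apply: eq_Rintegral => t _; rewrite hornerD mulrDl.
exact: measurable_I11.
Qed.

Lemma LamZ d c Q : (2 <= d)%N -> Lam d (c *: Q) = c * Lam d Q.
Proof.
move=> d2; rewrite /Lam -RintegralZl//; try exact: integrable_Lam.
  by apply: eq_Rintegral => t _; rewrite hornerZ mulrA.
exact: measurable_I11.
Qed.

Lemma Lam_ge0 d Q : (forall t, -1 <= t <= 1 -> 0 <= Q.[t]) -> 0 <= Lam d Q.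
Proof.
move=> Q0; apply: Rintegral_ge0 => t; rewrite /I11 /= in_itv /= => ht.
by rewrite mulr_ge0 ?gweight_ge0 ?Q0.
Qed.

(* The total derivative integrated is [Q * (1 - t^2)^(d/2)], which vanishes at both ends. *)
Lemma Lam_deriv d Q : (2 <= d)%N ->
  Lam d ((1 - 'X^2) * Q^`()) = d%:R * Lam d ('X * Q).
Proof.
move=> d2.
suff : Lam d ((1 - 'X^2) * Q^`() + (- d%:R) *: ('X * Q)) = 0.
  by rewrite LamD// LamZ// mulNr => /eqP; rewrite subr_eq0 => /eqP.
set P := (_ + _); set a : R := d%:R / 2 - 1.
have a0 : 0 <= a by exact: exponent_ge0.
pose F (t : R) := Q.[t] * gweight (a + 1) t.
have cF : continuous F by apply: continuous_poly_gweight; rewrite addr_ge0.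
rewrite /Lam /Rintegral (@continuous_FTC2 _ _ F)//.
- have an0 : a + 1 != 0 by rewrite gt_eqF// ltr_wpDl.
  by rewrite /F /gweight sqrrN expr1n subrr normr0 powR0//= !mulr0 subrr.
- by apply: continuous_subspaceT; exact: continuous_poly_gweight.
- split; last 2 first.
  + by apply: cvg_at_right_filter; exact: cF.
  + by apply: cvg_at_left_filter; exact: cF.
  + move=> t; rewrite in_itv/= => ht.
    have D2 := is_derive_gweight a ht.
    by apply: ex_derive.
- move=> t; rewrite in_itv/= => /[dup] /andP[t1 t2] ht.
  have D2 := is_derive_gweight a ht.
  rewrite derive1E /F derive_val /P !hornerE /=.
  rewrite /GRing.scale/=.
  have -> : gweight (a + 1) t = (1 - t ^+ 2) * gweight a t.
    rewrite /gweight powRD ?powRr1// ?ger0_norm// 1?mulrC//; try nra.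
  by rewrite /a; field.
Qed.

Lemma Lam_opp d Q : (2 <= d)%N -> Lam d (Q \Po (- 'X)) = Lam d Q.
Proof.
move=> d2; rewrite /Lam /Rintegral /I11; congr fine.
have := @integration_by_substitution_oppr R
  (fun t => Q.[t] * gweight (d%:R / 2 - 1) t) (-1) 1.
rewrite opprK => ->; last 2 first.
- by lra.
- apply: continuous_subspaceT.
  by apply: continuous_poly_gweight; exact: exponent_ge0.
apply: eq_integral => t _ /=; congr EFin.
by rewrite /gweight sqrrN horner_comp !hornerE.
Qed.

End PowRContinuity.

(** * Normalization of the Gegenbauer weight *)

Section GammaHalfIntegers.
Context {R : realType}.
Implicit Types (a l t : R) (n : nat).
Let leb := @lebesgue_measure R.

Definition gamma_fun a t : R := `|t| `^ a * expR (- t).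

Lemma continuous_gamma_fun a : 0 <= a -> continuous (gamma_fun a).
Proof.
move=> a0 t; rewrite /gamma_fun; apply: cvgM; first exact: continuous_norm_powR.
apply: (@continuous_comp _ _ _ (fun t : R => - t) expR).
  exact: continuousN.
exact: continuous_expR.
Qed.

Lemma gamma_fun_ge0 a t : 0 <= gamma_fun a t.
Proof. by rewrite mulr_ge0 ?powR_ge0 ?expR_ge0. Qed.

(* The cutoff [n^2] is adapted to the substitution [t = x^2]. *)
Definition gamma_int a n : R := \int[leb]_(t in `[0, n%:R ^+ 2]) gamma_fun a t.

(** Gamma values are carried as limits of proper integrals, to which the fundamental theorem of
    calculus applies; [gamma_valueE] passes to the improper integral by monotone convergence. The
    condition 0 <= a keeps the integrand continuous at 0. *)
Definition gamma_value a l := 0 <= a /\ gamma_int a n @[n --> \oo] --> l.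

Lemma gamma_valueE a l : gamma_value a l -> Gamma (a + 1) = l.
Proof.
move=> [a0 al].
pose S n : set (measurableTypeR R) := [set` `[0, n%:R ^+ 2]].
have mg (D : set (measurableTypeR R)) : measurable_fun D (EFin \o gamma_fun a).
  apply/measurable_EFinP; apply: (@measurable_funTS _ _ (measurableTypeR R)).
  by apply: continuous_measurable_fun; exact: continuous_gamma_fun.
have : (\int[leb]_(x in S i) (EFin \o gamma_fun a) x)%E @[i --> \oo] -->
       (\int[leb]_(x in \bigcup_i S i) (EFin \o gamma_fun a) x)%E.
  apply: ge0_nondecreasing_set_cvg_integral => //.
  - move=> n m nm; rewrite subsetEset => x; rewrite /S /= !in_itv/=.
    move=> /andP[-> /=] /le_trans; apply.
    by rewrite ler_sqr ?nnegrE ?ler_nat.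
  - by move=> n; exact: measurable_itv.
  - by move=> i x _; rewrite lee_fin gamma_fun_ge0.
have -> : \bigcup_i S i = `[0, +oo[%classic.
  apply/seteqP; split => x; rewrite /S /=; first by case=> n _; rewrite /= !in_itv/= andbT => /andP[].
  rewrite in_itv/= andbT => x0; exists (Num.truncn x).+1 => //=.
  rewrite in_itv/= x0/=; have := truncnS_gt x => h.
  have h1 : 1 <= ((Num.truncn x).+1)%:R :> R by rewrite ler1n.
  nra.
rewrite -integral_itv_obnd_cbnd; last exact: mg.
have E n : (\int[leb]_(x in S n) (EFin \o gamma_fun a) x)%E = (gamma_int a n)%:E.
  rewrite /gamma_int /Rintegral fineK//; apply: integrable_fin_num => //.
  apply: continuous_compact_integrable; first exact: segment_compact.
  by apply: continuous_subspaceT; exact: continuous_gamma_fun.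
rewrite (_ : (fun i => _) = EFin \o gamma_int a); last by apply/funext => n; rewrite /= E.
move=> h.
have al' : (EFin \o gamma_int a) x @[x --> \oo] --> l%:E.
  by apply/fine_cvgP; split; [exact: nearW|exact: al].
have {h al'} := cvg_unique _ h al'.
rewrite /Gamma addrK => h'.
have -> : [set t : R | 0 < t] = `]0, +oo[%classic.
  by apply/seteqP; split => x; rewrite /= in_itv/= andbT.
transitivity (fine (\int[leb]_(x in `]0%R, +oo[) (EFin \o gamma_fun a) x)); last first.
  by rewrite h'.
congr fine; apply: eq_integral => t; rewrite inE /= in_itv/= andbT => t0.
by rewrite /gamma_fun gtr0_norm.
Qed.


Lemma powR_expRN_cvg0 b : (n%:R ^+ 2 : R) `^ b * expR (- n%:R ^+ 2) @[n --> \oo] --> (0 : R).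
Proof.
(* With t = n^2 >= 1: t^b <= t^m, e^t >= t^(m+1)/(m+1)! and n+1 <= 2t, so t^b e^(-t) <= c/(n+1). *)
pose m := (Num.truncn b).+1; pose c : R := (m.+1)`!%:R * 2.
apply: (@squeeze_cvgr _ _ _ _ (cst 0) (fun n => c * (n.+1%:R)^-1)); last 2 first.
- exact: cvg_cst.
- by rewrite -[X in _ --> X](mulr0 c); apply: cvgMr; exact: cvg_harmonic.
exists 1%N => // n /= n1; rewrite mulr_ge0 ?powR_ge0 ?expR_ge0//=.
have n1' : 1 <= n%:R :> R by rewrite ler1n.
set t : R := n%:R ^+ 2; have t1 : 1 <= t by rewrite /t; nra.
have t0 : 0 < t by lra.
have tb : t `^ b <= t ^+ m.
  by rewrite -(powR_mulrn m (ltW t0)) ler_powR// ltW// truncnS_gt.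
have et := @expR_ge1Dxn R t m (ltW t0).
have f0 : 0 < (m.+1)`!%:R :> R by rewrite ltr0n fact_gt0.
rewrite expRN ler_pdivrMr ?expR_gt0// (le_trans tb)//.
have h : t ^+ m.+1 <= (m.+1)`!%:R * expR t.
  by rewrite mulrC -ler_pdivrMr//; lra.
have h2 : n%:R <= t by rewrite /t; nra.
have h3 : n.+1%:R <= 2 * t by rewrite -natr1; lra.
have tm0 : 0 < t ^+ m by rewrite exprn_gt0.
rewrite mulrAC ler_pdivlMr// /c.
have h4 : t ^+ m * n.+1%:R <= t ^+ m * (2 * t) by rewrite ler_pM2l.
rewrite exprSr in h; lra.
Qed.

Lemma gamma_value_recursion a l : gamma_value a l -> gamma_value (a + 1) ((a + 1) * l).
Proof.
move=> [a0 al]; split; first by rewrite addr_ge0.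
suff E : \forall n \near \oo, gamma_int (a + 1) n =
    (a + 1) * gamma_int a n - (n%:R ^+ 2) `^ (a + 1) * expR (- n%:R ^+ 2).
  rewrite -[X in _ --> X]subr0.
  have : (a + 1) * gamma_int a n - (n%:R ^+ 2) `^ (a + 1) * expR (- n%:R ^+ 2)
      @[n --> \oo] --> (a + 1) * l - 0.
    by apply: cvgB; [apply: cvgM => //; exact: cvg_cst|exact: powR_expRN_cvg0].
  apply: cvg_trans; apply: near_eq_cvg.
  by apply: filterS E => n ->.
exists 1%N => // n /= n1.
have n1' : 1 <= n%:R :> R by rewrite ler1n.
set b : R := n%:R ^+ 2; have b1 : 0 < b by rewrite /b; nra.
pose F (t : R) := - gamma_fun (a + 1) t.
have a10 : 0 <= a + 1 by rewrite addr_ge0.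
have cg c : 0 <= c -> leb.-integrable `[0, b] (EFin \o gamma_fun c).
  move=> c0; apply: continuous_compact_integrable; first exact: segment_compact.
  by apply: continuous_subspaceT; exact: continuous_gamma_fun.
have cF : continuous F.
  by move=> t; apply: continuousN; exact: continuous_gamma_fun.
have dF t : t \in `]0, b[ -> is_derive t 1 F (gamma_fun (a + 1) t - (a + 1) * gamma_fun a t).
  rewrite in_itv/= => /andP[t0 _].
  have D1 : is_derive t 1 (fun t => t `^ (a + 1)) ((a + 1) * t `^ (a + 1 - 1)).
    exact: is_derive1_powR.
  apply: (near_eq_is_derive (f := fun t => - (t `^ (a + 1) * expR (- t)))).
    near=> s; rewrite /F /gamma_fun gtr0_norm//.
    by near: s; exact: lt_nbhsr.
  apply: is_derive_eq; rewrite /GRing.scale /= addrK /gamma_fun (gtr0_norm t0).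
  by ring.
have : \int[leb]_(t in `[0, b]) (gamma_fun (a + 1) t - (a + 1) * gamma_fun a t) = F b - F 0.
  rewrite {1}/Rintegral (@continuous_FTC2 _ _ F)//.
  - apply: continuous_subspaceT => t; apply: continuousB.
      exact: continuous_gamma_fun.
    by apply: continuousM; [exact: cst_continuous|exact: continuous_gamma_fun].
  - split; last 2 first.
    + by apply: cvg_at_right_filter; exact: cF.
    + by apply: cvg_at_left_filter; exact: cF.
    + by move=> t /dF D; apply: ex_derive.
  - by move=> t /dF D; rewrite derive1E derive_val.
rewrite RintegralB//; last 2 first.
- exact: cg.
- apply: continuous_compact_integrable; first exact: segment_compact.
  have cc : continuous (fun t => (a + 1) * gamma_fun a t).
    by move=> t; apply: cvgM; [exact: cvg_cst|exact: continuous_gamma_fun].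
  exact: continuous_subspaceT.
rewrite RintegralZl//; last exact: cg.
have a1n0 : a + 1 != 0 by rewrite gt_eqF// ltr_wpDl.
have -> : F b = - (b `^ (a + 1) * expR (- b)) by rewrite /F /gamma_fun gtr0_norm.
have -> : F 0 = 0 by rewrite /F /gamma_fun normr0 powR0// mul0r oppr0.
rewrite -/(gamma_int (a + 1) n) -/(gamma_int a n) => h; lra.
Unshelve. all: by end_near. Qed.

Lemma gamma_value1 : gamma_value 0 1.
Proof.
split=> //.
have -> : gamma_int 0 = (fun n => 1 - expR (- n%:R ^+ 2)).
  apply/funext => n.
  have [->|n0] := eqVneq n 0%N.
    by rewrite /gamma_int expr0n/= set_itv1 Rintegral_set1 oppr0 expR0 subrr.
  have b0 : (0 : R) < n%:R ^+ 2 by rewrite exprn_gt0// ltr0n lt0n.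
  rewrite /gamma_int /Rintegral (@continuous_FTC2 _ _ (fun t => - expR (- t)))//.
  - by rewrite /= oppr0 expR0; lra.
  - by apply: continuous_subspaceT; exact: continuous_gamma_fun.
  - have cF : continuous (fun t : R => - expR (- t)).
      by move=> t; apply/differentiable_continuous/derivable1_diffP; apply: ex_derive.
    split; last 2 first.
    + by apply: cvg_at_right_filter; exact: cF.
    + by apply: cvg_at_left_filter; exact: cF.
    + by move=> t _; apply: ex_derive.
  - move=> t; rewrite in_itv/= => /andP[t0 _].
    rewrite derive1E derive_val /gamma_fun powRr0 /GRing.scale/=; ring.
rewrite -[X in _ --> X]subr0; apply: cvgB; first exact: cvg_cst.
have := @powR_expRN_cvg0 0.
by under eq_fun do rewrite powRr0 mul1r.
Qed.

Lemma gamma_value_sqrt_pi : gamma_value (1 / 2) (Num.sqrt pi / 2).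
Proof.
split; first lra.
pose g n := \int[leb]_(t in `[0, n%:R]) gauss_fun t.
have cint b : leb.-integrable `[0, b] (EFin \o gauss_fun).
  apply: continuous_compact_integrable; first exact: segment_compact.
  by apply: continuous_subspaceT; exact: continuous_gauss_fun.
have cg : g n @[n --> \oo] --> Num.sqrt pi / 2.
  have := @ge0_cvgn_integral R leb gauss_fun (@gauss_fun_ge0 R) (@measurable_gauss_fun R).
  rewrite integral0y_gauss => h.
  have : (EFin \o g) n @[n --> \oo] --> (Num.sqrt pi / 2)%:E.
    apply: cvg_trans h; apply: near_eq_cvg; apply: nearW => n /=.
    by rewrite /g /Rintegral fineK//; apply: integrable_fin_num.
  by move/fine_cvgP => [_].
have E n : gamma_int (1 / 2) n = g n - n%:R * expR (- n%:R ^+ 2).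
  have [->|n0] := eqVneq n 0%N.
    by rewrite /gamma_int /g expr0n/= set_itv1 !Rintegral_set1 mul0r subrr.
  have b0 : (0 : R) < n%:R by rewrite ltr0n lt0n.
  have dq t : is_derive t 1 (fun t : R => t ^+ 2) (2 * t).
    by apply: is_derive_eq; rewrite /GRing.scale /=; ring.
  have dqE : (fun t : R => t ^+ 2)^`()%classic = (fun t => 2 * t).
    by apply/funext => t; rewrite derive1E derive_val.
  have cl : continuous (fun t : R => 2 * t).
    by move=> t; apply: cvgM; [exact: cvg_cst|exact: cvg_id].
  have cq : continuous (fun t : R => t ^+ 2) by exact: exprn_continuous.
  have S : (\int[leb]_(t in `[0%R, (n%:R ^+ 2)%R]) (gamma_fun (1 / 2) t)%:E =
      \int[leb]_(t in `[0%R, n%:R]) (gamma_fun (1 / 2) (t ^+ 2) * (2 * t))%:E)%E.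
    have := @integration_by_substitution_increasing R (fun t => t ^+ 2) (gamma_fun (1 / 2)) 0 n%:R.
    rewrite expr0n /= dqE => ->//; rewrite ?ltW//.
    - by move=> x y; rewrite !in_itv/= => /andP[x0 _] /andP[y0 _] xy; nra.
    - by apply/cvg_ex; exists (2 * 0); apply: cvg_at_right_filter; exact: cl.
    - by apply/cvg_ex; exists (2 * n%:R); apply: cvg_at_left_filter; exact: cl.
    - split; last 2 first.
      + by apply: cvg_at_right_filter; exact: cq.
      + by apply: cvg_at_left_filter; exact: cq.
      + by move=> t _; apply: ex_derive.
    - by apply: continuous_subspaceT; apply: continuous_gamma_fun; lra.
  rewrite /gamma_int /Rintegral S.
  (* After t = x^2 the integrand is 2 x^2 e^(-x^2), which differs from the Gauss function by the
     derivative of -x e^(-x^2). *)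
  pose G (t : R) := - (t * expR (- t ^+ 2)).
  have dG t : is_derive t 1 G (2 * t ^+ 2 * gauss_fun t - gauss_fun t).
    apply: is_derive_eq; rewrite /GRing.scale /= /gauss_fun.
    by ring.
  have cG : continuous G.
    by move=> t; apply/differentiable_continuous/derivable1_diffP; apply: ex_derive.
  have cm : continuous (fun t : R => 2 * t ^+ 2 * gauss_fun t).
    move=> t; apply: cvgM; last exact: continuous_gauss_fun.
    by apply: cvgM; [exact: cvg_cst|exact: cq].
  have : \int[leb]_(t in `[0, n%:R]) (2 * t ^+ 2 * gauss_fun t - gauss_fun t) = G n%:R - G 0.
    rewrite {1}/Rintegral (@continuous_FTC2 _ _ G)//.
    - apply: continuous_subspaceT => t; apply: cvgB; first exact: cm.
      exact: continuous_gauss_fun.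
    - split; last 2 first.
      + by apply: cvg_at_right_filter; exact: cG.
      + by apply: cvg_at_left_filter; exact: cG.
      + by move=> t _; apply: ex_derive.
    - by move=> t _; rewrite derive1E derive_val.
  rewrite RintegralB//; last first.
    apply: continuous_compact_integrable; first exact: segment_compact.
    exact: continuous_subspaceT.
  rewrite /G mul0r oppr0 subr0 -/(g n) => h.
  transitivity (\int[leb]_(t in `[0, n%:R]) (2 * t ^+ 2 * gauss_fun t)); last by lra.
  rewrite /Rintegral; congr fine; apply: eq_integral => t; rewrite inE/= in_itv/= => /andP[t0 _].
  rewrite /gamma_fun ger0_norm ?sqr_ge0// -powR_mulrn// -powRrM mulrC div1r.
  by rewrite divff// powRr1// powR_mulrn// /gauss_fun; congr EFin; ring.
rewrite (_ : gamma_int (1 / 2) = fun n => g n - n%:R * expR (- n%:R ^+ 2)); last first.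
  by apply/funext.
rewrite -[X in _ --> X]subr0; apply: cvgB => //.
have := @powR_expRN_cvg0 (1 / 2).
rewrite (_ : (fun n : nat => _) = (fun n : nat => n%:R * expR (- n%:R ^+ 2)))//.
apply/funext => n; rewrite -powR_mulrn// -powRrM div1r divff// powRr1//.
Qed.


Lemma Lam2_1 : Lam 2 (1 : {poly R}) = 2.
Proof.
rewrite /Lam; under eq_Rintegral do rewrite /gweight divff// subrr powRr0 hornerC mul1r.
rewrite /I11 Rintegral_cst//.
have := @lebesgue_measure_itv R `[(-1), 1].
have lt11 : (-1 : R) < 1 by lra.
rewrite /= lte_fin lt11 => E.
rewrite [X in fine X]E -EFinB /=; lra.
Qed.

Lemma Lam3_1 : Lam 3 (1 : {poly R}) = pi / 2.
Proof.
rewrite /Lam /Rintegral.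
pose g (t : R) := gweight (3 / 2 - 1) t.
have cg : continuous g by apply: continuous_gweight; lra.
have dsE : (@sin R)^`()%classic = cos by apply/funext => t; rewrite derive1E derive_val.
have pi0 := @pi_gt0 R.
have := @integration_by_substitution_increasing R sin g (- (pi / 2)) (pi / 2).
rewrite dsE sinN sin_pihalf => S.
rewrite /I11; under eq_integral do rewrite hornerC mul1r -/(g _).
rewrite S; last 7 first.
- lra.
- move=> x y; rewrite !in_itv/= => hx hy xy.
  by rewrite ltr_sin// in_itv/=.
- by move=> x _; exact: continuous_cos.
- by apply/cvg_ex; exists (cos (- (pi / 2))); apply: cvg_at_right_filter; exact: continuous_cos.
- by apply/cvg_ex; exists (cos (pi / 2)); apply: cvg_at_left_filter; exact: continuous_cos.
- split; last 2 first.
  + by apply: cvg_at_right_filter; exact: continuous_sin.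
  + by apply: cvg_at_left_filter; exact: continuous_sin.
  + by move=> t _; apply: ex_derive.
- exact: continuous_subspaceT.
pose G (x : R) := (x + sin x * cos x) / 2.
have dG (x : R) : is_derive x 1 G (cos x ^+ 2).
  rewrite /G; apply: is_derive_eq; rewrite /GRing.scale /=.
  have := cos2Dsin2 x; lra.
have cG : continuous G.
  by move=> t; apply/differentiable_continuous/derivable1_diffP; apply: ex_derive.
transitivity (fine (\int[leb]_(x in `[(- (pi / 2))%R, (pi / 2)%R]) (cos x ^+ 2)%:E)).
  congr fine; apply: eq_integral => x; rewrite inE/= in_itv/= => hx.
  have c0 := cos_ge0_pihalf hx.
  suff -> : ((g \o sin) * cos) x = cos x ^+ 2 by [].
  rewrite [LHS]/(g (sin x) * cos x) /g /gweight -cos2sin2 normrX ger0_norm// -powR_mulrn// -powRrM.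
  have -> : 2%:R * (3 / 2 - 1) = 1 :> R by lra.
  by rewrite powRr1// powR_mulrn// expr2.
rewrite (@continuous_FTC2 _ _ G)//.
- by rewrite /G /= cosN cos_pihalf; lra.
- lra.
- have cc : continuous (fun x : R => cos x ^+ 2).
    by move=> t; apply/differentiable_continuous/derivable1_diffP; apply: ex_derive.
  exact: continuous_subspaceT.
- split; last 2 first.
  + by apply: cvg_at_right_filter; exact: cG.
  + by apply: cvg_at_left_filter; exact: cG.
  + by move=> t _; apply: ex_derive.
- by move=> t _; rewrite derive1E derive_val.
Qed.

(** [Lam_deriv] applied to X gives Lam(1-X^2) = d Lam(X^2), and a factor 1-t^2 in the weight raises
    the dimension by two. *)
Lemma Lam1_recursion d : (2 <= d)%N ->
  Lam d.+2 (1 : {poly R}) = d%:R / d.+1%:R * Lam d 1.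
Proof.
move=> d2.
have E : Lam d.+2 (1 : {poly R}) = Lam d (1 - 'X^2).
  rewrite /Lam; apply: eq_Rintegral => t; rewrite inE /I11/= in_itv/= => /andP[t1 t2].
  rewrite !hornerE /gweight.
  have -> : d.+2%:R / 2 - 1 = d%:R / 2 - 1 + 1 :> R by rewrite -[d.+2]addn2 natrD; lra.
  have h : 0 <= 1 - t ^+ 2 by nra.
  rewrite powRD; first by rewrite (ger0_norm h) powRr1// mulrC.
  have a0 : 0 <= d%:R / 2 - 1 :> R by exact: exponent_ge0.
  by apply/implyP => /eqP; lra.
have := @Lam_deriv R d 'X d2; rewrite derivX mulr1 -E.
have := LamD (1 - 'X^2) ('X^2 : {poly R}) d2; rewrite subrK -E -expr2 => -> ->.
by rewrite -natr1; field; rewrite natr1 pnatr_eq0.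
Qed.

Lemma Lam1_gamma_value d : (2 <= d)%N -> exists l l',
  [/\ gamma_value (d%:R / 2 - 1) l, gamma_value ((d%:R - 1) / 2) l', 0 < l, 0 < l' &
      Lam d (1 : {poly R}) = Num.sqrt pi * l / l'].
Proof.
have pi0 := @pi_gt0 R.
have sp0 : 0 < Num.sqrt (pi : R) by rewrite sqrtr_gt0.
elim/ltn_ind: d => [[|[|[|[|d]]]]] // IH _.
- exists 1, (Num.sqrt pi / 2); split => //.
  + by rewrite divff// subrr; exact: gamma_value1.
  + by rewrite (_ : (2 - 1) / 2 = 1 / 2); [exact: gamma_value_sqrt_pi|lra].
  + by rewrite divr_gt0.
  + by rewrite Lam2_1; field; rewrite gt_eqF.
- exists (Num.sqrt pi / 2), 1; split => //.
  + by rewrite (_ : 3 / 2 - 1 = 1 / 2); [exact: gamma_value_sqrt_pi|lra].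
  + rewrite (_ : (3 - 1) / 2 = 0 + 1); last by lra.
    by rewrite -[X in gamma_value _ X](mul1r 1) -{2}(add0r 1); apply: gamma_value_recursion; exact: gamma_value1.
  + by rewrite divr_gt0.
  + by rewrite Lam3_1 mulrA -expr2 sqr_sqrtr ?ltW// divr1.
- have [//|//|l [l' [h1 h2 l0 l'0 h]]] := IH d.+2.
  exists ((d.+2%:R / 2 - 1 + 1) * l), (((d.+2%:R - 1) / 2 + 1) * l'); split.
  + rewrite (_ : d.+4%:R / 2 - 1 = d.+2%:R / 2 - 1 + 1); first exact: gamma_value_recursion.
    by rewrite -[d.+4]addn2 natrD; lra.
  + rewrite (_ : (d.+4%:R - 1) / 2 = (d.+2%:R - 1) / 2 + 1); first exact: gamma_value_recursion.
    by rewrite -[d.+4]addn2 natrD; lra.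
  + by rewrite subrK mulr_gt0.
  + by rewrite mulr_gt0.
  + rewrite Lam1_recursion// h -[d.+3%:R]natr1; field.
    have d0 : 0 <= d%:R :> R by [].
    by apply/andP; split; rewrite gt_eqF//; lra.
Qed.

(** The factor in front of [Kker] is thus the total mass of the weight, which makes the kernel
    reproducing for the normalized sphere measure. *)
Lemma Lam1_omega d : (2 <= d)%N -> Lam d (1 : {poly R}) = omega d / omega d.-1.
Proof.
move=> d2; have [l [l' [h1 h2 l0 l'0 ->]]] := Lam1_gamma_value d2.
have G2 := gamma_valueE h2; have G1 := gamma_valueE h1.
have pi0 := @pi_gt0 R.
have sp0 : 0 < Num.sqrt (pi : R) by rewrite sqrtr_gt0.
rewrite /omega.
have -> : d.-1%:R + 1 = d%:R :> R by rewrite natr1 prednK// (leq_trans _ d2).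
have -> : Gamma ((d%:R + 1) / 2) = l' by rewrite -G2; congr Gamma; lra.
have -> : Gamma (d%:R / 2) = l by rewrite -G1; congr Gamma; lra.
have -> : (d%:R + 1) / 2 = d%:R / 2 + 1 / 2 :> R by rewrite mulrDl.
rewrite powRD; last by apply/implyP => _; rewrite gt_eqF.
rewrite -[X in _ = 2 * (_ * X) / _ / _]/(pi `^ (1 / 2)) div1r powR12_sqrt ?ltW//.
have p0 : 0 < (pi : R) `^ (d%:R / 2) by rewrite powR_gt0.
by field; rewrite !gt_eqF.
Qed.

Lemma Lam1_gt0 d : (2 <= d)%N -> 0 < Lam d (1 : {poly R}).
Proof.
move=> d2; have [l [l' [_ _ l0 l'0 ->]]] := Lam1_gamma_value d2.
by rewrite divr_gt0// mulr_gt0// sqrtr_gt0 pi_gt0.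
Qed.

End GammaHalfIntegers.

(** * Orthonormal Gegenbauer polynomials at 1 *)

Section LamLinear.
Context {R : realType} (d : nat) (d2 : (2 <= d)%N).
Implicit Types (Q : {poly R}).

Lemma Lam0 : Lam d (0 : {poly R}) = 0.
Proof. by rewrite -(scale0r (0 : {poly R})) LamZ// mul0r. Qed.

Lemma Lam_sum (I : Type) (s : seq I) (P : pred I) (F : I -> {poly R}) :
  Lam d (\sum_(i <- s | P i) F i) = \sum_(i <- s | P i) Lam d (F i).
Proof. by apply: (big_morph (Lam d)); [move=> x y; exact: LamD|exact: Lam0]. Qed.

Lemma LamN Q : Lam d (- Q) = - Lam d Q.
Proof. by rewrite -scaleN1r LamZ// mulN1r. Qed.

Lemma LamB Q1 Q2 : Lam d (Q1 - Q2) = Lam d Q1 - Lam d Q2.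
Proof. by rewrite LamD// LamN. Qed.

End LamLinear.

Section Gegenbauer.
Context {R : realType} (d : nat) (d2 : (2 <= d)%N) (p : nat -> {poly R}).
Hypothesis size_p : forall l, size (p l) = l.+1.
Hypothesis lead_p : forall l, 0 < lead_coef (p l).
Hypothesis orth_p : forall k l, Lam d (p k * p l) = (k == l)%:R.
Implicit Types (Q : {poly R}) (l m : nat).
Local Notation L := (@Lam R d).

Lemma coef_p_gt0 l : 0 < (p l)`_l.
Proof. by have := lead_p l; rewrite /lead_coef size_p. Qed.

Lemma orth_span l Q : (size Q <= l)%N -> exists c : nat -> R, Q = \sum_(j < l) c j *: p j.
Proof.
elim: l Q => [|l IH] Q sQ.
  exists (fun=> 0); rewrite big_ord0; apply/eqP; by rewrite -size_poly_leq0.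
have cl := coef_p_gt0 l.
pose a := Q`_l / (p l)`_l.
have [|c Ec] := IH (Q - a *: p l).
  apply/leq_sizeP => j lj; rewrite coefB coefZ.
  move: lj; rewrite leq_eqVlt => /predU1P[<-|lj].
    by rewrite /a divfK ?subrr// gt_eqF.
  by rewrite !nth_default ?mulr0 ?subrr ?size_p ?(leq_trans sQ).
exists (fun j => if j == l then a else c j).
rewrite big_ord_recr /= eqxx; apply/eqP; rewrite -subr_eq; apply/eqP.
rewrite Ec; apply: eq_bigr => i _; by rewrite ltn_eqF.
Qed.

Lemma orth_expand l Q : (size Q <= l)%N -> Q = \sum_(j < l) L (Q * p j) *: p j.
Proof.
move=> /[dup] sQ /orth_span[c Ec]; rewrite {1}Ec; apply: eq_bigr => i _; congr (_ *: _).
rewrite Ec mulr_suml Lam_sum// (bigD1 i)//= -scalerAl LamZ// orth_p eqxx mulr1.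
rewrite big1 ?addr0// => j ji; rewrite -scalerAl LamZ// orth_p.
by rewrite (_ : (j == i :> nat) = false) ?mulr0//; apply: negbTE.
Qed.

Lemma orth_lower l Q : (size Q <= l)%N -> L (p l * Q) = 0.
Proof.
move=> /orth_span[c ->]; rewrite mulr_sumr Lam_sum// big1// => j _.
by rewrite -scalerAr LamZ// orth_p gtn_eqF// mulr0.
Qed.

Lemma orth_top l Q : (size Q <= l.+1)%N -> L (p l * Q) = Q`_l / (p l)`_l.
Proof.
move=> sQ; have cl := coef_p_gt0 l; set a := (X in _ = X).
have : L (p l * (Q - a *: p l)) = 0.
  apply: orth_lower; apply/leq_sizeP => j lj; rewrite coefB coefZ.
  move: lj; rewrite leq_eqVlt => /predU1P[<-|lj].
    by rewrite /a divfK ?subrr// gt_eqF.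
  by rewrite !nth_default ?mulr0 ?subrr ?size_p ?(leq_trans sQ).
by rewrite mulrBr LamB// -scalerAr LamZ// orth_p eqxx mulr1 => /eqP; rewrite subr_eq0 => /eqP.
Qed.

Lemma size_XM_p l : (size ('X * p l)%R <= l.+2)%N.
Proof. by rewrite mulrC (leq_trans (size_polyMleq _ _))// size_p size_polyX addn2. Qed.

Lemma size_deriv_p l : (size (p l)^`() <= l)%N.
Proof. by rewrite -ltnS -(size_p l) lt_size_deriv// -size_poly_gt0 size_p. Qed.

Lemma size_1X2_deriv_p l : (size ((1 - 'X^2) * (p l)^`())%R <= l.+2)%N.
Proof.
apply: leq_trans (size_polyMleq _ _) _.
have : (size (1 - 'X^2 : {poly R})%R <= 3)%N.
  by rewrite (leq_trans (size_polyD _ _))// size_polyN size_polyXn size_poly1.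
by move=> h; rewrite -subn1 leq_subLR (leq_trans (leq_add h (size_deriv_p l))).
Qed.

(* The weight is even, so [p l (-X)] is a multiple of [p l]. *)
Lemma orth_parity l : L (p l * ('X * p l)) = 0.
Proof.
pose q := p l \Po (- 'X).
have sq : (size q <= l.+1)%N.
  by rewrite (leq_trans (size_comp_poly_leq _ _))// size_polyN size_polyX size_p muln1.
have Eq : q = L (q * p l) *: p l.
  rewrite {1}(orth_expand sq) big_ord_recr /= big1 ?add0r// => j _.
  rewrite -Lam_opp// comp_polyM /q -comp_polyA.
  rewrite (_ : - 'X \Po - 'X = 'X); last by rewrite raddfN /= comp_polyX opprK.
  rewrite comp_polyXr orth_lower ?scale0r//.
  apply: leq_trans (size_comp_poly_leq _ _) _.
  by rewrite size_polyN size_polyX size_p /= muln1.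
set X := L _; set s := L _ in Eq.
have : X = - (s ^+ 2 * X).
  rewrite {1}/X -Lam_opp// !comp_polyM comp_polyX -/q Eq.
  rewrite mulNr mulrN LamN//; congr (- _).
  rewrite (_ : s *: p l * _ = (s ^+ 2) *: (p l * ('X * p l))) ?LamZ//.
  by rewrite -!mul_polyC rmorphXn /=; ring.
by have := sqr_ge0 s; nra.
Qed.

(** Multiplication by X acts on the orthonormal basis as a symmetric tridiagonal matrix; this is its
    off-diagonal entry, and the diagonal vanishes by parity. *)
Definition three_term l : R := (p l)`_l / (p l.+1)`_l.+1.
Local Notation b := three_term.

Lemma orth_XS l : L (p l.+1 * ('X * p l)) = b l.
Proof. by rewrite orth_top ?size_XM_p// coefXM. Qed.

Lemma three_term0 : 'X * p 0 = b 0 *: p 1.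
Proof.
rewrite {1}(orth_expand (size_XM_p 0)) !big_ord_recr big_ord0 /= add0r.
rewrite mulrC orth_parity scale0r add0r; congr (_ *: _).
by rewrite mulrC orth_XS.
Qed.

Lemma three_termS l : 'X * p l.+1 = b l.+1 *: p l.+2 + b l *: p l.
Proof.
rewrite {1}(orth_expand (size_XM_p l.+1)) !big_ord_recr /=.
rewrite big1 => [|j _]; last first.
  by rewrite -mulrA mulrCA orth_lower ?scale0r// (leq_trans (size_XM_p _))// !ltnS.
rewrite add0r ['X * p l.+1 * p l.+1]mulrC orth_parity scale0r addr0.
rewrite addrC; congr (_ *: _ + _ *: _); last by rewrite -mulrA mulrCA orth_XS.
by rewrite mulrC orth_XS.
Qed.

Lemma Lam_derivM Q1 Q2 :
  L ((1 - 'X^2) * Q1^`() * Q2) = d%:R * L ('X * (Q1 * Q2)) - L (Q1 * ((1 - 'X^2) * Q2^`())).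
Proof.
apply/eqP; rewrite eq_sym subr_eq -LamD// -Lam_deriv// derivM; apply/eqP.
by congr L; ring.
Qed.

(** Expand the left side in the basis. Coefficients below l vanish by integration by parts, the one
    at l+2 because the leading coefficients cancel, the one at l+1 by parity. *)
Lemma lowering l : (1 - 'X^2) * (p l.+1)^`() + l.+1%:R *: ('X * p l.+1) =
  ((d + 2 * l).+1%:R * b l) *: p l.
Proof.
set Q := LHS.
have sQ : (size Q <= l.+3)%N.
  apply: leq_trans (size_polyD _ _) _; rewrite geq_max size_1X2_deriv_p/=.
  by rewrite (leq_trans (size_scale_leq _ _))// size_XM_p.
rewrite {1}(orth_expand sQ) !big_ord_recr /= big1 => [|j _]; last first.
  rewrite mulrDl LamD// Lam_derivM -!scalerAl LamZ//.
  have -> : 'X * p l.+1 * p j = p l.+1 * ('X * p j) by ring.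
  have -> : 'X * (p l.+1 * p j) = p l.+1 * ('X * p j) by ring.
  rewrite !orth_lower ?(leq_trans (size_XM_p j)) ?(leq_trans (size_1X2_deriv_p j)) ?ltnS//.
  by rewrite !mulr0 subr0 add0r scale0r.
rewrite add0r.
have -> : L (Q * p l.+2) = 0.
  rewrite mulrC orth_top// /Q coefD coefZ coefXM /= mulrBl mul1r coefB coefXnM /=.
  rewrite nth_default ?(leq_trans (size_deriv_p _))// subSS subn1 /= coef_deriv.
  by rewrite mulr_natl sub0r addNr mul0r.
have -> : L (Q * p l.+1) = 0.
  rewrite /Q mulrDl LamD// -scalerAl LamZ// ['X * _ * _]mulrC orth_parity mulr0 addr0.
  have := Lam_derivM (p l.+1) (p l.+1).
  rewrite -['X * (_ * _)]mulrCA orth_parity mulr0 sub0r.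
  rewrite [p l.+1 * _]mulrC; lra.
rewrite !scale0r !addr0; congr (_ *: _).
rewrite /Q mulrDl LamD// Lam_derivM -!scalerAl LamZ//.
have -> : 'X * p l.+1 * p l = p l.+1 * ('X * p l) by ring.
have -> : 'X * (p l.+1 * p l) = p l.+1 * ('X * p l) by ring.
rewrite orth_XS orth_top ?size_1X2_deriv_p//.
have -> : ((1 - 'X^2) * (p l)^`())`_l.+1 = - (l%:R * (p l)`_l).
  rewrite mulrBl mul1r coefB coefXnM.
  rewrite [_`_l.+1]nth_default ?(leq_trans (size_deriv_p _))//.
  case: (l) => [|l']; first by rewrite /= mul0r subr0 oppr0.
  by rewrite /= !subSS subn0 coef_deriv mulr_natl sub0r.
rewrite mulNr -mulrA -/(b l).
by rewrite -[in RHS]natr1 natrD natrM -[l.+1%:R]natr1; ring.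
Qed.

Local Notation e l := ((p l).[1]).

Lemma value_lowering l : l.+1%:R * e l.+1 = (d + 2 * l).+1%:R * b l * e l.
Proof.
have := congr1 (fun q : {poly R} => q.[1]) (lowering l).
by rewrite !(hornerD, hornerN, hornerM, hornerZ, hornerXn, hornerX, hornerC) => <-; ring.
Qed.

Lemma value_three_term l : b l * e l.+1 * (2 * l%:R + d%:R - 1) = (l%:R + d%:R - 1) * e l.
Proof.
have d1 : 2 <= d%:R :> R by rewrite (ler_nat R 2).
case: l => [|l].
  have := congr1 (fun q : {poly R} => q.[1]) three_term0.
  by rewrite hornerM hornerX hornerZ mul1r mulr0 add0r => <-; ring.
have := congr1 (fun q : {poly R} => q.[1]) (three_termS l).
rewrite hornerM hornerX hornerD !hornerZ mul1r => E.
have := value_lowering l; rewrite -[(d + 2 * l).+1%:R]natr1 natrD natrM -natr1 => F.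
have -> : b l.+1 * e l.+2 = e l.+1 - b l * e l by rewrite {1}E; lra.
lra.
Qed.

(** Combining [value_lowering] and [value_three_term] eliminates the unknown [b l], so the squares
    of the values at 1 are determined without any explicit form of the polynomials. *)
Lemma value_recursion l : l.+1%:R * e l.+1 ^+ 2 * (2 * l%:R + d%:R - 1) =
  (2 * l%:R + d%:R + 1) * (l%:R + d%:R - 1) * e l ^+ 2.
Proof.
have := value_lowering l; rewrite -[(d + 2 * l).+1%:R]natr1 natrD natrM => F.
transitivity ((l.+1%:R * e l.+1) * e l.+1 * (2 * l%:R + d%:R - 1)); first by ring.
rewrite F; have V := value_three_term l.
transitivity ((d%:R + 2 * l%:R + 1) * e l * (b l * e l.+1 * (2 * l%:R + d%:R - 1))); first by ring.
by rewrite V; ring.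
Qed.

Definition rising m n : R := \prod_(i < n) (m + i.+1)%:R.

Lemma risingS m n : rising m n.+1 = rising m n * (m + n.+1)%:R.
Proof. by rewrite /rising big_ord_recr. Qed.

Lemma risingSl m n : rising m n.+1 = m.+1%:R * rising m.+1 n.
Proof.
rewrite /rising big_ord_recl addn1; congr (_ * _); apply: eq_bigr => i _.
by rewrite lift0 addSnnS.
Qed.

Lemma rising0 n : rising 0 n = n`!%:R.
Proof.
elim: n => [|n IH]; first by rewrite /rising big_ord0.
by rewrite risingS IH factS natrM mulrC.
Qed.

Lemma rising_gt0 m n : 0 < rising m n.
Proof. by apply: prodr_gt0 => i _; rewrite ltr0n addnS. Qed.

Lemma value_sq0 : L 1 * e 0 ^+ 2 = 1.
Proof.
have := orth_p 0 0; rewrite eqxx.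
have [c ->] : exists c, p 0 = c%:P by exists (p 0)`_0; apply: size1_polyC; rewrite size_p.
have -> : c%:P * c%:P = (c ^+ 2) *: 1 :> {poly R} by rewrite -mul_polyC mulr1 rmorphXn expr2.
by rewrite hornerC LamZ// mulrC.
Qed.

(** After division by (d-1)!, the right side is the dimension of the space of spherical harmonics of
    degree l. *)
Lemma value_sq l : L 1 * e l ^+ 2 * (d.-1)`!%:R = (2 * l%:R + d%:R - 1) * rising l d.-2.
Proof.
have [n dE] : exists n, d = n.+2 by exists d.-2; move: d2; case: (d) => [|[]].
have dR : d%:R = n%:R + 2 :> R by rewrite dE -addn2 natrD.
rewrite (_ : d.-1 = n.+1) ?(_ : d.-2 = n) ?dE//.
rewrite -dE; elim: l => [|l IH].
  by rewrite value_sq0 rising0 factS natrM -natr1 dR; ring.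
have := risingS l n; rewrite risingSl => RS.
have V := value_recursion l.
have n0 : 0 <= n%:R :> R by [].
have l0 : 0 <= l%:R :> R by [].
have nz : l.+1%:R * (2 * l%:R + d%:R - 1) != 0 :> R.
  by rewrite mulf_neq0// gt_eqF//; lra.
apply: (mulfI nz).
transitivity (L 1 * n.+1`!%:R * (l.+1%:R * e l.+1 ^+ 2 * (2 * l%:R + d%:R - 1))); first by ring.
rewrite V.
transitivity ((2 * l%:R + d%:R + 1) * (l%:R + d%:R - 1) * (L 1 * e l ^+ 2 * n.+1`!%:R)).
  by ring.
rewrite IH.
transitivity ((2 * l%:R + d%:R - 1) * (2 * l.+1%:R + d%:R - 1) * (l.+1%:R * rising l.+1 n)).
  by rewrite RS natrD -!natr1 dR; ring.
by ring.
Qed.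

(* The value at [1] of the reproducing kernel of polynomials of degree [< m]. *)
Definition Kone m : R := \sum_(l < m) L 1 * e l ^+ 2.

(** Summation of [value_sq]: K(1) is the dimension of the polynomials of degree at most m on the
    sphere, a product of d linear factors in m divided by d!. *)
Lemma KoneE m : Kone m.+1 * d`!%:R = (2 * m%:R + d%:R) * rising m d.-1.
Proof.
have [n dE] : exists n, d = n.+2 by exists d.-2; move: d2; case: (d) => [|[]].
have dR : d%:R = n%:R + 2 :> R by rewrite dE -addn2 natrD.
have d1 : d.-1 = n.+1 by rewrite dE.
have fE : d`!%:R = d%:R * (d.-1)`!%:R :> R by rewrite d1 dE factS natrM.
elim: m => [|m IH].
  by rewrite /Kone big_ord1 value_sq0 rising0 fE; ring.
rewrite /Kone big_ord_recr /= mulrDl IH.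
have := value_sq m.+1; rewrite (_ : d.-2 = n) ?dE// -dE => V.
rewrite fE.
transitivity ((2 * m%:R + d%:R) * rising m d.-1 + d%:R * (L 1 * e m.+1 ^+ 2 * (d.-1)`!%:R)).
  by ring.
by rewrite V d1 risingSl [rising m.+1 n.+1]risingS natrD -!natr1 dR; ring.
Qed.

End Gegenbauer.

Section KoneBounds.
Context {R : realType}.
Implicit Types (n m d : nat).

Lemma expR1_le4 : expR 1 <= 4 :> R.
Proof.
have h := expR_ge1Dx (- (1 / 2) : R); have p := expR_gt0 (- (1 / 2) : R).
have E : expR 1 * (expR (- (1 / 2)) * expR (- (1 / 2))) = 1 :> R.
  by rewrite -!expRD -[RHS]expR0; congr expR; lra.
have e0 := expR_gt0 (1 : R).
have x4 : 1 / 4 <= expR (- (1 / 2)) * expR (- (1 / 2)) :> R by nra.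
nra.
Qed.

(** The exponential series at n contains n^n/n!, and e <= 4. *)
Lemma fact_lower n : (n%:R / 4) ^+ n <= n`!%:R :> R.
Proof.
case: n => [|n]; first by rewrite expr0 fact0.
have := @expR_ge1Dxn R n.+1%:R n (ler0n _ _).
rewrite -[X in expR X]mulr1 expRM_natl => h.
have f0 : 0 < (n.+1)`!%:R :> R by rewrite ltr0n fact_gt0.
have : n.+1%:R ^+ n.+1 / (n.+1)`!%:R <= 4 ^+ n.+1 :> R.
  apply: le_trans (_ : expR 1 ^+ n.+1 <= _); first by lra.
  by rewrite lerXn2r ?nnegrE ?expR_ge0// expR1_le4.
rewrite ler_pdivrMr// => {}h.
by rewrite exprMn exprVn ler_pdivrMr ?exprn_gt0// mulrC.
Qed.

Context (d : nat) (d2 : (2 <= d)%N) (p : nat -> {poly R}).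
Hypothesis size_p : forall l, size (p l) = l.+1.
Hypothesis lead_p : forall l, 0 < lead_coef (p l).
Hypothesis orth_p : forall k l, Lam d (p k * p l) = (k == l)%:R.
Local Notation K := (Kone d p).

Lemma Kone_ge0 m : 0 <= K m.
Proof.
by apply: sumr_ge0 => i _; rewrite mulr_ge0 ?sqr_ge0// ltW// Lam1_gt0.
Qed.

Lemma natr_ge2 : 2 <= d%:R :> R. Proof. by rewrite (ler_nat R 2). Qed.

Lemma Kone_gt0 m : (0 < m)%N -> 0 < K m.
Proof.
have dR2 := natr_ge2.
case: m => // m _; have := KoneE d2 size_p lead_p orth_p m.
have f0 : 0 < d`!%:R :> R by rewrite ltr0n fact_gt0.
have : 0 < (2 * m%:R + d%:R) * rising m d.-1 :> R.
  have m0 : 0 <= m%:R :> R by [].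
  by rewrite mulr_gt0 ?rising_gt0//; lra.
by move=> h E; rewrite -(pmulr_lgt0 _ f0) E.
Qed.

Lemma rising_ub m n : rising m n <= (m + n)%:R ^+ n :> R.
Proof.
rewrite /rising -[X in _ ^+ X]card_ord -prodr_const; apply: ler_prod => i _.
by rewrite ler0n ler_nat leq_add2l ltn_ord.
Qed.

Lemma Kone_ub m : K m <= 2 * (4 * (m%:R + d%:R) / d%:R) ^+ d.
Proof.
have dR2 := natr_ge2.
case: m => [|m].
  by rewrite /Kone big_ord0 mulr_ge0// exprn_ge0// divr_ge0// mulr_ge0// add0r.
have E := KoneE d2 size_p lead_p orth_p m.
have f0 : 0 < d`!%:R :> R by rewrite ltr0n fact_gt0.
rewrite -(ler_pM2r f0) E.
have m0 : 0 <= m%:R :> R by [].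
set x : R := m.+1%:R + d%:R; have xE : x = m%:R + 1 + d%:R by rewrite /x natr1.
apply: le_trans (_ : 2 * x * x ^+ d.-1 <= _).
  apply: ler_pM; [by lra|exact/ltW/rising_gt0|by lra|].
  apply: le_trans (rising_ub _ _) _; apply: lerXn2r; rewrite ?nnegrE//; first lra.
  by rewrite natrD xE; have : d.-1%:R <= d%:R :> R; [rewrite ler_nat leq_pred|lra].
have dp : (0 < d)%N by exact: leq_trans d2.
rewrite -mulrA -exprS prednK// -(mulrA 2) ler_pM2l//.
have := fact_lower d => FL.
have -> : 4 * x / d%:R = x / (d%:R / 4) by field; rewrite gt_eqF//; lra.
have x0 : 0 < x by lra.
rewrite exprMn exprVn -(mulrA (x ^+ d)) ler_pMr ?exprn_gt0//.
by rewrite mulrC ler_pdivlMr ?mul1r// exprn_gt0// divr_gt0//; lra.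
Qed.

(** Each of the d linear factors in [KoneE] grows by at most the ratio of the degrees. *)
Lemma Kone_ratio m n : (0 < m <= n)%N -> K n <= (n%:R / m%:R) ^+ d * K m.
Proof.
have dR2 := natr_ge2.
case: m => // m /andP[_]; case: n => // n mn.
have Em := KoneE d2 size_p lead_p orth_p m; have En := KoneE d2 size_p lead_p orth_p n.
have f0 : 0 < d`!%:R :> R by rewrite ltr0n fact_gt0.
rewrite -(ler_pM2r f0) En -mulrA Em.
have m0 : 0 <= m%:R :> R by [].
have mnR : m%:R <= n%:R :> R by rewrite ler_nat.
rewrite -[X in _ ^+ X]prednK ?(leq_trans _ d2)// exprS.
set q : R := n.+1%:R / m.+1%:R.
have qE : q * (m%:R + 1) = n%:R + 1 by rewrite /q !natr1 divfK// pnatr_eq0.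
have q1 : 1 <= q by rewrite /q ler_pdivlMr ?ltr0n// mul1r ler_nat.
have -> : q * q ^+ d.-1 * ((2 * m%:R + d%:R) * rising m d.-1) =
  (q * (2 * m%:R + d%:R)) * (q ^+ d.-1 * rising m d.-1) by ring.
apply: ler_pM; [by lra|exact/ltW/rising_gt0|by nra|].
rewrite /rising -[X in _ ^+ X]card_ord -prodr_const -big_split /=.
apply: ler_prod => i _; rewrite ler0n /= !natrD -!natr1.
have i0 : 0 <= i%:R :> R by []; nra.
Qed.

(** Degree bounds are strict and real; the ceiling M turns l < a into l < M for natural l. *)
Lemma natceil (a : R) : 0 <= a -> exists M : nat,
  [/\ forall l : nat, (l < M)%N = (l%:R < a), a <= M%:R & M%:R < a + 1].
Proof.
move=> a0; have /andP[t1 t2] := truncn_itv a0.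
have [h|h] := ltP (Num.truncn a)%:R a.
  exists (Num.truncn a).+1; split.
  - move=> l; apply/idP/idP => [|la].
      by rewrite ltnS -(ler_nat R) => /le_lt_trans; apply.
    by rewrite -(ltr_nat R) (lt_trans la).
  - exact: ltW.
  - by rewrite -natr1 ltrD2r.
exists (Num.truncn a); split => //.
- move=> l; rewrite -(ltr_nat R); apply/idP/idP => /lt_le_trans; exact.
- by rewrite (le_lt_trans t1)// ltrDl.
Qed.

Definition Kpoly m : {poly R} := \sum_(l < m) (Lam d 1 * (p l).[1]) *: p l.

Lemma size_Kpoly m : (size (Kpoly m) <= m)%N.
Proof.
apply: (leq_trans (size_sum _ _ _)); apply/bigmax_leqP => i _.
by rewrite (leq_trans (size_scale_leq _ _))// size_p.
Qed.

Lemma Kpoly1 m : (Kpoly m).[1] = K m.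
Proof.
rewrite /Kpoly horner_sum; apply: eq_bigr => i _.
by rewrite hornerZ expr2 mulrA.
Qed.

Lemma Lam_Kpoly m (Q : {poly R}) : (size Q <= m)%N -> Lam d (Kpoly m * Q) = Lam d 1 * Q.[1].
Proof.
move=> sQ; rewrite {2}(orth_expand d2 size_p lead_p orth_p sQ) horner_sum mulr_sumr.
rewrite /Kpoly mulr_suml Lam_sum//; apply: eq_bigr => i _.
by rewrite -scalerAl LamZ// hornerZ mulrC [p i * _]mulrC; ring.
Qed.

End KoneBounds.

Lemma Kker_Kpoly (R : realType) (d : nat) (J : nat -> {poly R}) (a : R) M :
  (2 <= d)%N -> 0 <= a -> (forall l : nat, (l < M)%N = (l%:R < a)) ->
  forall t, Kker d J a t = (Kpoly d J M).[t].
Proof.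
move=> d2 a0 HM t; rewrite /Kker /Kpoly -Lam1_omega// horner_sum mulr_sumr.
have HMt : (M <= (Num.truncn a).+1)%N.
  rewrite leqNgt HM -leNgt; exact/ltW/truncnS_gt.
rewrite [RHS](big_ord_widen _ (fun i : nat => ((Lam d 1 * (J i).[1]) *: J i).[t]) HMt).
apply: eq_big => [i|i _]; first by rewrite HM.
by rewrite hornerZ mulrA.
Qed.

Lemma is_jacobi_Lam (R : realType) (d : nat) (J : nat -> {poly R}) :
  is_jacobi (d%:R / 2 - 1) (d%:R / 2 - 1) J ->
  [/\ forall l, size (J l) = l.+1, forall l, 0 < lead_coef (J l) &
      forall k l, Lam d (J k * J l) = (k == l)%:R].
Proof.
move=> [H1 H2]; split; [by move=> l; have [] := H1 l|by move=> l; have [] := H1 l|].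
move=> k l; have := congr1 fine (H2 k l); rewrite /= => <-.
have -> : [set t : R | -1 <= t <= 1] = I11.
  by apply/seteqP; split => t; rewrite /I11 /= in_itv.
apply: eq_Rintegral => t.
rewrite inE /I11 /= in_itv /= => ht.
by rewrite hornerM gweightE// mulrA.
Qed.

(** * Fejer-type kernels, dyadic sums and fractional powers *)

Section PolySize.
Context {R : nzRingType}.
Implicit Types (p q : {poly R}) (m n : nat).

Lemma size_polyD_le n p q : (size p <= n)%N -> (size q <= n)%N -> (size (p + q)%R <= n)%N.
Proof. by move=> hp hq; rewrite (leq_trans (size_polyD _ _))// geq_max hp. Qed.

Lemma size_polyB_le n p q : (size p <= n)%N -> (size q <= n)%N -> (size (p - q)%R <= n)%N.
Proof. by move=> hp hq; rewrite size_polyD_le// size_polyN. Qed.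

Lemma size_polyZ_le n c p : (size p <= n)%N -> (size (c *: p)%R <= n)%N.
Proof. exact: (leq_trans (size_scale_leq _ _)). Qed.

Lemma size_polyM_le m n p q :
  (size p <= m.+1)%N -> (size q <= n.+1)%N -> (size (p * q)%R <= (m + n).+1)%N.
Proof.
move=> hp hq; rewrite (leq_trans (size_polyMleq _ _))// -subn1 leq_subLR.
by rewrite (leq_trans (leq_add hp hq))// addSn addnS.
Qed.

Lemma size_polyX_le m p k : (size p <= m.+1)%N -> (size (p ^+ k)%R <= (m * k).+1)%N.
Proof.
move=> hp; elim: k => [|k IH]; first by rewrite muln0 expr0 size_poly1.
by rewrite exprS mulnS size_polyM_le.
Qed.

End PolySize.

Section FejerKernel.
Context {R : realType}.
Implicit Types (t u : R) (N : nat).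

(* [cheb N] is [(1 - T_N) / (1 - X)] for the Chebyshev polynomial [T_N]. *)
Fixpoint cheb_pair N : {poly R} * {poly R} :=
  if N is N'.+1 then
    let: (a, b) := cheb_pair N' in (b, 2%:R *: b - a + 2%:R *: (1 - (1 - 'X) * b))
  else (0, 1).

Definition cheb N := (cheb_pair N).1.
Definition chebT N t : R := 1 - (1 - t) * (cheb N).[t].

Lemma cheb_pairE N : cheb_pair N = (cheb N, cheb N.+1).
Proof. by rewrite /cheb /=; case: (cheb_pair N). Qed.

Lemma cheb0 : cheb 0 = 0. Proof. by []. Qed.
Lemma cheb1 : cheb 1 = 1. Proof. by []. Qed.
Lemma chebSS N : cheb N.+2 = 2%:R *: cheb N.+1 - cheb N + 2%:R *: (1 - (1 - 'X) * cheb N.+1).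
Proof. by rewrite {1}/cheb /= cheb_pairE. Qed.

Lemma size_cheb N : (size (cheb N) <= N)%N.
Proof.
suff : (size (cheb N) <= N)%N /\ (size (cheb N.+1) <= N.+1)%N by case.
elim: N => [|N [IH1 IH2]]; first by rewrite cheb0 cheb1 size_poly0 size_poly1.
split=> //; rewrite chebSS.
have hX : (size (1 - 'X : {poly R})%R <= 2)%N by rewrite size_polyB_le ?size_poly1 ?size_polyX.
apply: size_polyD_le; [apply: size_polyB_le; first exact/size_polyZ_le/leqW|].
  by rewrite (leq_trans IH1)// leqW.
apply/size_polyZ_le/size_polyB_le; first by rewrite size_poly1.
exact: (@size_polyM_le _ 1 N).
Qed.

Lemma chebTSS N t : chebT N.+2 t = 2 * t * chebT N.+1 t - chebT N t.
Proof.
rewrite /chebT chebSS !(hornerD, hornerN, hornerM, hornerZ, hornerX, hornerC); ring.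
Qed.

(** With t = cos theta this is a trigonometric identity; here it is a quadratic form preserved by
    the recursion. Completing a square in it gives |T_N| <= 1 for |t| < 1 without angles. *)
Lemma chebT_invariant N t :
  chebT N t ^+ 2 + chebT N.+1 t ^+ 2 - 2 * t * chebT N t * chebT N.+1 t = 1 - t ^+ 2.
Proof.
elim: N => [|N IH]; first by rewrite /chebT cheb0 cheb1 !hornerC; ring.
rewrite chebTSS -IH; ring.
Qed.

Lemma chebT_le1 N t : -1 <= t <= 1 -> chebT N t ^+ 2 <= 1.
Proof.
move=> /andP[t1 t2].
have key : 1 - t ^+ 2 > 0 -> chebT N t ^+ 2 <= 1.
  move=> h; have E := chebT_invariant N t.
  have : (1 - t ^+ 2) * chebT N t ^+ 2 <= (1 - t ^+ 2) * 1.
    have := sqr_ge0 (chebT N.+1 t - t * chebT N t).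
    by rewrite -subr_ge0 => h0; nra.
  by rewrite ler_pM2l.
(* At t = -1 the form degenerates to a square equal to 0, so T changes sign at each step. *)
have [t1'|t1'] := eqVneq t (-1).
  have E k : chebT k.+1 t = t * chebT k t.
    have := chebT_invariant k t; rewrite t1' => E.
    have : (chebT k.+1 (-1) + chebT k (-1)) ^+ 2 = 0 by rewrite -[RHS](subrr ((-1) ^+ 2)); lra.
    by move/eqP; rewrite sqrf_eq0 => /eqP; lra.
  elim: N {key} => [|N IH]; first by rewrite /chebT cheb0 hornerC; lra.
  by rewrite E exprMn t1' sqrrN expr1n mul1r -t1'.
have [t2'|t2'] := eqVneq t 1; first by rewrite /chebT t2'; lra.
apply: key; have a : -1 < t by rewrite lt_neqAle eq_sym t1'.
have b : t < 1 by rewrite lt_neqAle t2'.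
nra.
Qed.

Lemma chebT_itv N t : -1 <= t <= 1 -> -1 <= chebT N t <= 1.
Proof. by move=> /(chebT_le1 N) h; apply/andP; split; nra. Qed.

(** The second difference of [cheb] is 2 T_(k+1). Summing T <= 1 twice gives the upper bound N^2;
    this in turn gives T_k >= 1 - u k^2, and summing that gives the lower bound. *)
Lemma cheb_bounds N t : -1 <= t <= 1 ->
  [/\ 0 <= (cheb N).[t], (cheb N).[t] <= N%:R ^+ 2, (1 - t) * (cheb N).[t] <= 2 &
      N%:R ^+ 2 - 2 * (1 - t) * N%:R ^+ 4 <= (cheb N).[t]].
Proof.
move=> ht; have /andP[t1 t2] := ht.
have T k : -1 <= 1 - (1 - t) * (cheb k).[t] <= 1 by exact: chebT_itv.
have S k : (cheb k.+2).[t] - (cheb k.+1).[t] = (cheb k.+1).[t] - (cheb k).[t] +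
    2 * (1 - (1 - t) * (cheb k.+1).[t]).
  by rewrite chebSS !(hornerD, hornerN, hornerM, hornerZ, hornerX, hornerC); ring.
have up k : (cheb k.+1).[t] - (cheb k).[t] <= 2 * k%:R + 1 /\ (cheb k).[t] <= k%:R ^+ 2.
  elim: k => [|k [IH1 IH2]]; first by rewrite cheb0 cheb1 !hornerC; split; lra.
  by rewrite S -natr1; have /andP[_ h] := T k.+1; split; lra.
have lo k : 2 * k%:R + 1 - 2 * (1 - t) * k%:R ^+ 3 <= (cheb k.+1).[t] - (cheb k).[t] /\
    k%:R ^+ 2 - 2 * (1 - t) * k%:R ^+ 4 <= (cheb k).[t].
  elim: k => [|k [IH1 IH2]]; first by rewrite cheb0 cheb1 !hornerC; split; lra.
  have k0 : 0 <= k%:R :> R by [].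
  have [_ h] := up k.+1.
  have u0 : 0 <= 1 - t by lra.
  have h1 : (1 - t) * (cheb k.+1).[t] <= (1 - t) * k.+1%:R ^+ 2 by rewrite ler_wpM2l.
  rewrite S; rewrite -natr1 in h1 *; split.
    have : (1 - t) * (k%:R ^+ 3 + (k%:R + 1) ^+ 2) <= (1 - t) * (k%:R + 1) ^+ 3.
      by rewrite ler_wpM2l//; nra.
    lra.
  have : (1 - t) * (k%:R ^+ 4 + k%:R ^+ 3) <= (1 - t) * (k%:R + 1) ^+ 4.
    rewrite ler_wpM2l//.
    have -> : (k%:R + 1) ^+ 4 = k%:R ^+ 4 + 4 * k%:R ^+ 3 + 6 * k%:R ^+ 2 + 4 * k%:R + 1 :> R by ring.
    have := exprn_ge0 3 k0; have := exprn_ge0 2 k0; lra.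
  lra.
have [_ h2] := up N; have [_ h4] := lo N; have /andP[h3 h3'] := T N.
split => //; last lra.
have [t1'|t1'] := eqVneq t 1.
  by apply: le_trans h4; rewrite t1' subrr mulr0 mul0r subr0 sqr_ge0.
have u0 : 0 < 1 - t by rewrite subr_gt0 lt_neqAle t1'.
by rewrite -(pmulr_rge0 _ u0); lra.
Qed.

(** With t = cos theta this is (sin(N theta/2) / (N sin(theta/2)))^2, the Fejer kernel scaled to the
    value 1 at t = 1. *)
Definition fejer N : {poly R} := (N%:R ^- 2) *: cheb N.

Lemma size_fejer N : (size (fejer N) <= N)%N.
Proof. by rewrite (leq_trans (size_scale_leq _ _))// size_cheb. Qed.

Lemma fejer_bounds N t : (0 < N)%N -> -1 <= t <= 1 ->
  [/\ 0 <= (fejer N).[t], (fejer N).[t] <= 1, (1 - t) * N%:R ^+ 2 * (fejer N).[t] <= 2 &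
      1 - (fejer N).[t] <= 2 * (1 - t) * N%:R ^+ 2].
Proof.
move=> N0 /(cheb_bounds N)[h1 h2 h3 h4]; rewrite /fejer hornerZ.
have n0 : 0 < N%:R ^+ 2 :> R by rewrite exprn_gt0// ltr0n.
split.
- by rewrite mulr_ge0// invr_ge0 ltW.
- by rewrite mulrC ler_pdivrMr// mul1r.
- by rewrite -mulrA (mulrA (N%:R ^+ 2)) divff ?gt_eqF// mul1r.
- rewrite -(ler_pM2l n0) mulrBr mulr1 mulrA divff ?gt_eqF// mul1r.
  have E : N%:R ^+ 4 = N%:R ^+ 2 * N%:R ^+ 2 :> R by rewrite -exprD.
  by rewrite E in h4; lra.
Qed.

Lemma fejer1 N : (0 < N)%N -> (fejer N).[1] = 1.
Proof.
by move=> N0; have [] := fejer_bounds N0 (_ : -1 <= 1 <= 1); rewrite ?subrr ?mulr0 ?mul0r; lra.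
Qed.


(* A sum of squares of polynomials comparable to [u^r], [u = 1 - t], above the scale [4^-I]. *)
Definition dyadic_weight (r : R) i : R := (4 ^+ i) `^ (- r).
Definition dyadic (r : R) (e I : nat) t : R :=
  \sum_(i < I.+1) dyadic_weight r i * (1 - (fejer (2 ^ i)).[t]) ^+ e.

Lemma natr_pow2_sqr i : (2 ^ i)%:R ^+ 2 = 4 ^+ i :> R.
Proof. by rewrite natrX -exprM mulnC exprM -natrX. Qed.

Lemma dyadic_weight_ge0 r i : 0 <= dyadic_weight r i. Proof. exact: powR_ge0. Qed.

(** A single term suffices. At the least i with 4 <= u 4^i the Fejer factor is at most 1/2, and u
    4^i <= 16 makes the i-th weight comparable to u^r. If even u 4^I < 4, the added bottom weight
    dominates. *)
Lemma dyadic_lower (r : R) (e I : nat) t : 0 < r -> -1 <= t <= 1 ->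
  (1 - t) `^ r <= 16 `^ r * 2 ^+ e * (dyadic r e I t + dyadic_weight r I).
Proof.
move=> r0 ht; have /andP[t1 t2] := ht.
have u0 : 0 <= 1 - t by lra.
have term i : 0 <= dyadic_weight r i * (1 - (fejer (2 ^ i)).[t]) ^+ e.
  rewrite mulr_ge0 ?dyadic_weight_ge0// exprn_ge0// subr_ge0.
  by have [] := @fejer_bounds (2 ^ i) t (expn_gt0 _ _) ht.
have D0 : 0 <= dyadic r e I t by apply: sumr_ge0 => i _; exact: term.
have e1 : 1 <= 2 ^+ e :> R by rewrite exprn_ege1// ler1n.
have r16 : 0 < (16 : R) `^ r by rewrite powR_gt0.
have key i : (1 - t) * 4 ^+ i <= 16 -> (1 - t) `^ r <= 16 `^ r * dyadic_weight r i.
  move=> h; rewrite /dyadic_weight powRN ler_pdivlMr ?powR_gt0 ?exprn_gt0//.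
  rewrite -powRM// ?exprn_ge0//; apply: ge0_ler_powR => //; rewrite ?nnegrE ?mulr_ge0 ?exprn_ge0//.
  exact: ltW.
have [h|h] := ltP ((1 - t) * 4 ^+ I) 4.
  apply: le_trans (key I _) _; first lra.
  rewrite -mulrA ler_pM2l//.
  have := dyadic_weight_ge0 r I; nra.
have ex : exists i, 4 <= (1 - t) * 4 ^+ i by exists I.
case: (ex_minnP ex) => i hi imin.
have iI : (i <= I)%N by exact: imin.
have i0 : (0 < i)%N.
  by rewrite lt0n; apply/eqP => i0; move: hi; rewrite i0 expr0; lra.
have hi2 : (1 - t) * 4 ^+ i <= 16.
  have : ~~ (4 <= (1 - t) * 4 ^+ i.-1).
    by apply/negP => /imin; rewrite leqNgt prednK// leqnn.
  by rewrite -ltNge -(prednK i0) exprS; lra.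
apply: le_trans (key i hi2) _.
rewrite -mulrA ler_pM2l//.
have [f0 f1 f2 _] := @fejer_bounds (2 ^ i) t (expn_gt0 _ _) ht.
rewrite natr_pow2_sqr in f2.
have fh : 1 / 2 <= 1 - (fejer (2 ^ i)).[t] by nra.
have : dyadic_weight r i * (1 - (fejer (2 ^ i)).[t]) ^+ e <= dyadic r e I t.
  rewrite /dyadic (bigD1 (Ordinal (iI : (i < I.+1)%N)))//= lerDl.
  by apply: sumr_ge0 => j _; exact: term.
have : (1 / 2) ^+ e <= (1 - (fejer (2 ^ i)).[t]) ^+ e by rewrite lerXn2r// nnegrE; lra.
have w0 := dyadic_weight_ge0 r i; have w0' := dyadic_weight_ge0 r I.
have E : 2 ^+ e * (1 / 2) ^+ e = 1 :> R by rewrite -exprMn mulrA mulr1 divff// expr1n.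
move=> h1 h2.
have h3 : dyadic_weight r i * (1 / 2) ^+ e <= dyadic r e I t.
  by apply: le_trans h2; rewrite ler_wpM2l.
have h4 : 2 ^+ e * (dyadic_weight r i * (1 / 2) ^+ e) <= 2 ^+ e * dyadic r e I t.
  by rewrite ler_wpM2l//; lra.
have h5 : 0 <= 2 ^+ e * dyadic_weight r I by rewrite mulr_ge0//; lra.
rewrite mulrDr; apply: le_trans (_ : _ <= 2 ^+ e * dyadic r e I t) _; last by lra.
by apply: le_trans h4; rewrite mulrCA E mulr1.
Qed.

Lemma dyadic_weightE (r : R) i : dyadic_weight r i = (4 `^ (- r)) ^+ i.
Proof. by rewrite /dyadic_weight -powR_mulrn// -powRrM mulrC powRrM powR_mulrn// powR_ge0. Qed.

Lemma dyadic_scaled_sum (r : R) (e : nat) : 0 < r -> r < e%:R ->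
  exists2 A : R, 0 < A & forall I z, 0 <= z ->
    \sum_(i < I) dyadic_weight r i * Num.min 1 (4 ^+ i * z) ^+ e <= A * z `^ r.
Proof.
move=> r0 re.
pose x : R := 4 `^ (- r).
have x0 : 0 < x by rewrite powR_gt0.
have p4 s : 0 < s -> 1 < (4 : R) `^ s.
  by move=> s0; rewrite -[ltLHS](congr1 (@^~ s) (powR1 R)) gt0_ltr_powR ?nnegrE//; lra.
have x4 : x * 4 `^ r = 1 by rewrite /x powRN mulVf// gt_eqF//; lra.
have x1 : x < 1 by have := p4 _ r0; nra.
have e0 : (0 < e)%N by rewrite -(ltr_nat R); apply: lt_trans re.
have y1 : 1 < x * 4 ^+ e.
  rewrite -powR_mulrn// -powRD; last by apply/implyP => _; rewrite gt_eqF//; lra.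
  by apply: p4; lra.
(* G bounds the geometric sum of the weights. A satisfies A x = G + B, which settles 1/4 < z <= 1,
   where z^r >= x. *)
pose G := (1 - x)^-1; pose B := (x * 4 ^+ e - 1)^-1; pose A := (G + B) / x.
have G0 : 0 < G by rewrite invr_gt0; lra.
have B0 : 0 < B by rewrite invr_gt0; lra.
have EB : B * (x * 4 ^+ e) = 1 + B.
  by rewrite -{2}(mulVf (_ : x * 4 ^+ e - 1 != 0)) -/B ?gt_eqF//; lra.
have EA : A * x = G + B by rewrite /A divfK// gt_eqF.
have AG : G + B <= A by have : 0 < A; [rewrite /A divr_gt0//; lra|nra].
pose g I (z : R) := \sum_(i < I) dyadic_weight r i * Num.min 1 (4 ^+ i * z) ^+ e.
have m01 i (z : R) : 0 <= z -> 0 <= Num.min 1 (4 ^+ i * z) <= 1.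
  by move=> z0; rewrite ge_min lexx le_min ler01 mulr_ge0// exprn_ge0.
have gG I (z : R) : 0 <= z -> g I z <= G.
  move=> z0; apply: (@le_trans _ _ (\sum_(i < I) x ^+ i)).
    apply: ler_sum => i _; rewrite dyadic_weightE -[leRHS]mulr1 ler_wpM2l//.
    by have /andP[h1 h2] := m01 i _ z0; rewrite exprn_ile1.
  have -> : \sum_(i < I) x ^+ i = G * (1 - x ^+ I).
    have := subrX1 x I => E.
    have -> : 1 - x ^+ I = (1 - x) * \sum_(i < I) x ^+ i by rewrite -opprB E -mulNr opprB.
    by rewrite mulrA mulVf ?mul1r// gt_eqF//; lra.
  have := exprn_ge0 I (ltW x0); nra.
(* The subtracted B z^e makes the induction close: passing from z to 4z multiplies it by x 4^e > 1,
   and since B x 4^e = 1 + B the gain pays for the first term z^e. *)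
have claim I (z : R) : 0 < z <= 1 -> g I z <= A * z `^ r - B * z ^+ e.
  elim: I z => [|I IH] z /andP[z0 z1].
    rewrite /g big_ord0 subr_ge0.
    have h : z ^+ e <= z `^ r.
      by rewrite -(powR_mulrn e (ltW z0)) ger_powR ?z0// ltW.
    have := exprn_ge0 e (ltW z0); nra.
  have [z4|z4] := ltP (1 / 4) z.
    apply: le_trans (gG _ _ (ltW z0)) _.
    have h1 : z ^+ e <= 1 by rewrite exprn_ile1// ltW.
    have h2 : x <= z `^ r.
      have : 1 <= (4 * z) `^ r.
        rewrite -[leLHS](congr1 (@^~ r) (powR1 R)).
        by apply: ge0_ler_powR; rewrite ?nnegrE; lra.
      rewrite powRM//; last exact: ltW.
      by have := p4 _ r0; nra.
    nra.
  rewrite /g big_ord_recl /= expr0 mul1r {1}dyadic_weightE expr0 mul1r min_r//.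
  have -> : \sum_(i < I) dyadic_weight r (lift ord0 i) * Num.min 1 (4 ^+ lift ord0 i * z) ^+ e =
      x * g I (4 * z).
    rewrite mulr_sumr; apply: eq_bigr => i _; rewrite lift0 !dyadic_weightE !exprS -/x.
    by rewrite -!mulrA; congr (_ * (_ * (Num.min _ _ ^+ _))); ring.
  have := IH (4 * z); rewrite exprMn powRM ?(ltW z0)// => IHz.
  have {}IHz : g I (4 * z) <= A * (4 `^ r * z `^ r) - B * (4 ^+ e * z ^+ e) by apply: IHz; lra.
  apply: (@le_trans _ _ (z ^+ e + x * (A * (4 `^ r * z `^ r) - B * (4 ^+ e * z ^+ e)))).
    by rewrite lerD2l ler_wpM2l// ltW.
  have -> : x * (A * (4 `^ r * z `^ r) - B * (4 ^+ e * z ^+ e)) =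
    (x * 4 `^ r) * A * z `^ r - (B * (x * 4 ^+ e)) * z ^+ e by ring.
  rewrite x4 EB; lra.
exists A; first by lra.
move=> I z; rewrite -/(g I z) le_eqVlt => /predU1P[<-|z0].
  rewrite /g powR0 ?gt_eqF// mulr0 big1// => i _.
  by rewrite mulr0 min_r// expr0n gtn_eqF// mulr0.
have [z1|z1] := leP z 1.
  have h : g I z <= A * z `^ r - B * z ^+ e by apply: claim; rewrite z0.
  have := exprn_ge0 e (ltW z0); nra.
apply: le_trans (gG _ _ (ltW z0)) _.
have : 1 <= z `^ r by rewrite -[leLHS](congr1 (@^~ r) (powR1 R)); apply: ge0_ler_powR; rewrite ?nnegrE; lra.
nra.
Qed.

Lemma dyadic_upper (r : R) (e : nat) : 0 < r -> r < e%:R ->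
  exists2 A : R, 0 < A & forall I t, -1 <= t <= 1 -> dyadic r e I t <= A * (1 - t) `^ r.
Proof.
move=> r0 re; have [A A0 HA] := dyadic_scaled_sum r0 re.
exists (A * 2 `^ r) => [|I t ht]; first by rewrite mulr_gt0// powR_gt0.
have /andP[t1 t2] := ht.
rewrite -mulrA -powRM//; last by lra.
apply: le_trans (HA I.+1 _ _); last by lra.
apply: ler_sum => i _; rewrite ler_wpM2l ?dyadic_weight_ge0//.
have [f0 f1 _ f3] := @fejer_bounds (2 ^ i) t (expn_gt0 _ _) ht.
apply: lerXn2r; rewrite ?nnegrE ?le_min; [by lra| |].
  by rewrite ler01 mulr_ge0 ?exprn_ge0//; lra.
rewrite natr_pow2_sqr in f3; apply/andP; split; lra.
Qed.

End FejerKernel.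

(** * Taylor polynomials of real powers *)

Section BinomialTaylor.
Context {R : realType}.
Implicit Types (a y v n : R) (J : nat).

(** This is (-1)^j times the binomial coefficient of a over j. Recursing on a - 1 rather than on j
    alone makes the derivative of the Taylor polynomial immediate. *)
Fixpoint binom_coef a j : R := if j is j'.+1 then - (a / j%:R) * binom_coef (a - 1) j' else 1.

(* Taylor polynomial at [0] of [y |-> (1 - y)^a]. *)
Definition binom_taylor a J : {poly R} := \poly_(j < J) binom_coef a j.

Lemma deriv_binom_taylor a J : (binom_taylor a J.+1)^`() = (- a) *: binom_taylor (a - 1) J.
Proof.
apply/polyP => j; rewrite coef_deriv coefZ !coef_poly ltnS.
case: ifP => // _; last by rewrite mul0rn mulr0.
rewrite /= -mulr_natr; field.
by rewrite nat1r pnatr_eq0.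
Qed.

Lemma binom_taylor0 a J : (0 < J)%N -> (binom_taylor a J).[0] = 1.
Proof. by move=> J0; rewrite horner_coef0 coef_poly J0. Qed.

(** Induction on J by the mean value theorem: differentiation lowers a and J together, and J <= a
    keeps the exponents nonnegative. *)
Lemma binom_taylor_error a J y : J%:R <= a -> 0 <= y <= 1 ->
  `|(1 - y) `^ a - (binom_taylor a J).[y]| <= a ^+ J * y ^+ J.
Proof.
elim: J a y => [|J IH] a y Ja /andP[y0 y1].
  rewrite /binom_taylor poly_def big_ord0 horner0 subr0 !expr0 mulr1 ger0_norm ?powR_ge0//.
  rewrite -[leRHS](congr1 (@^~ a) (powR1 R)).
  by apply: ge0_ler_powR; rewrite ?nnegrE//; lra.
have a1 : 1 <= a by apply: le_trans Ja; rewrite ler1n.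
move: y0; rewrite le_eqVlt => /predU1P[<-|y0].
  by rewrite subr0 powR1 binom_taylor0// subrr normr0 expr0n mulr0.
pose f (z : R) := `|1 - z| `^ a - (binom_taylor a J.+1).[z].
pose f' (z : R) : R := - a * ((1 - z) `^ (a - 1) - (binom_taylor (a - 1) J).[z]).
have df z : z \in `]0, y[ -> is_derive z 1 f (f' z).
  rewrite in_itv/= => /andP[z0 zy].
  have h : 0 < 1 - z by lra.
  have E : is_derive z 1 ((fun x => x `^ a) \o (fun s => 1 - s))
     ((a * (1 - z) `^ (a - 1)) * (- 1)).
    apply: is_derive1_comp; first exact: is_derive1_powR.
    by apply: is_derive_eq; ring.
  have E2 := is_derive_poly (binom_taylor a J.+1) z.
  apply: (@near_eq_is_derive _ R R (fun s => (1 - s) `^ a - (binom_taylor a J.+1).[s])).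
    near=> s; rewrite /f ger0_norm//.
    have : s \in `]0, y[ by near: s; apply: near_in_itvoo; rewrite in_itv/= z0.
    by rewrite in_itv/= => /andP[s1 s2]; lra.
  apply: is_derive_eq; rewrite deriv_binom_taylor hornerZ /f'; ring.
have cf : {within `[0, y], continuous f}.
  apply: continuous_subspaceT => z; apply: cvgB; last exact: continuous_horner.
  apply: (@continuous_comp _ _ _ (fun z : R => 1 - z) (fun w => `|w| `^ a)).
    by apply: cvgB; [exact: cvg_cst|exact: cvg_id].
  by apply: continuous_norm_powR; lra.
have [z zy Ez] := MVT y0 df cf.
have f0 : f 0 = 0 by rewrite /f subr0 normr1 powR1 binom_taylor0// subrr.
have -> : (1 - y) `^ a - (binom_taylor a J.+1).[y] = f' z * y.
  have := Ez; rewrite f0 !subr0 => <-; rewrite /f ger0_norm//; lra.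
move: zy; rewrite in_itv/= => /andP[z0 zy].
have Ja1 : J%:R <= a - 1 by move: Ja; rewrite -natr1; lra.
have IHz := IH (a - 1) z Ja1 _.
have -> : a ^+ J.+1 * y ^+ J.+1 = a * (a ^+ J * y ^+ J) * y by rewrite !exprS; ring.
rewrite normrM (ger0_norm (ltW y0)) ler_pM2r// /f' normrM normrN.
rewrite (@ger0_norm _ a); last lra.
rewrite ler_pM2l; last lra.
apply: le_trans (IHz _) _; first by apply/andP; split; lra.
apply: ler_pM; rewrite ?exprn_ge0//; try lra.
- by apply: lerXn2r; rewrite ?nnegrE; lra.
- by apply: lerXn2r; rewrite ?nnegrE; lra.
Unshelve. all: by end_near. Qed.

(* For [n] not an integer, [((1 + t) / 2)^n] is not a polynomial; it is replaced by [n' + J]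
   factors of which the last [J] are expanded to high order at [t = 1]. *)
Definition half_plus : {poly R} := 2^-1 *: (1 + 'X).
Definition half_minus : {poly R} := 2^-1 *: (1 - 'X).

Definition power_poly n J : {poly R} :=
  half_plus ^+ (Num.truncn n - J) *
  (binom_taylor (n - (Num.truncn n - J)%:R) J \Po half_minus).

Lemma half_plusE t : half_plus.[t] = (1 + t) / 2.
Proof. by rewrite /half_plus hornerZ hornerD hornerX hornerC mulrC. Qed.

Lemma half_minusE t : half_minus.[t] = (1 - t) / 2.
Proof. by rewrite /half_minus hornerZ hornerD hornerN hornerX hornerC mulrC. Qed.

Lemma size_power_poly n J : (0 < J)%N -> (J <= Num.truncn n)%N ->
  (size (power_poly n J) <= Num.truncn n)%N.
Proof.
move=> J0 Jn.
have h1 : (size half_plus <= 2)%N.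
  by rewrite size_polyZ_le// size_polyD_le ?size_poly1 ?size_polyX.
have h2 : (size half_minus <= 2)%N.
  by rewrite size_polyZ_le// size_polyB_le ?size_poly1 ?size_polyX.
have h3 : (size (half_plus ^+ (Num.truncn n - J))%R <= (Num.truncn n - J).+1)%N.
  by have := @size_polyX_le _ 1 _ (Num.truncn n - J) h1; rewrite mul1n.
have h4 : (size (binom_taylor (n - (Num.truncn n - J)%:R) J \Po half_minus) <= J.-1.+1)%N.
  rewrite (leq_trans (size_comp_poly_leq _ _))// ltnS.
  have hs : (size (binom_taylor (n - (Num.truncn n - J)%:R) J) <= J)%N by exact: size_poly.
  rewrite -[leqRHS]muln1; apply: leq_mul; rewrite -subn1 leq_subLR.
    by rewrite add1n prednK.
  by rewrite addn1.
apply: leq_trans (size_polyM_le h3 h4) _.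
by rewrite -addnS prednK// subnK.
Qed.

Lemma power_poly1 n J : (0 < J)%N -> (power_poly n J).[1] = 1.
Proof.
move=> J0; rewrite /power_poly hornerM horner_exp horner_comp half_plusE half_minusE.
by rewrite subrr mul0r binom_taylor0// mulr1 (_ : (1 + 1) / 2 = 1) ?expr1n//; lra.
Qed.

(** The expanded exponent a lies between J and J+1, so its Taylor constant does not depend on n. The
    unexpanded power of (1+t)/2 is kept for the decay away from t = 1. *)
Lemma power_poly_error n J t : 0 <= n -> (J <= Num.truncn n)%N -> -1 <= t <= 1 ->
  `|((1 + t) / 2) `^ n - (power_poly n J).[t]| <=
    ((1 + t) / 2) ^+ (Num.truncn n - J) * (J.+1%:R ^+ J * ((1 - t) / 2) ^+ J).
Proof.
move=> n0 Jn /andP[t1 t2].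
rewrite /power_poly hornerM horner_exp horner_comp half_plusE half_minusE.
set v := (1 + t) / 2; set m := (Num.truncn n - J)%N; set a := n - m%:R.
have /andP[n1 n2] := truncn_itv n0.
have mE : m%:R = (Num.truncn n)%:R - J%:R :> R by rewrite /m natrB.
have Ja : J%:R <= a by rewrite /a mE; lra.
have aJ : a <= J.+1%:R by rewrite /a mE; move: n2; rewrite -!natr1; lra.
have v0 : 0 <= v by rewrite /v; lra.
have -> : v `^ n = v ^+ m * (1 - (1 - t) / 2) `^ a.
  have -> : 1 - (1 - t) / 2 = v by rewrite /v; lra.
  (* At v = 0 the law of exponents can fail, as a zero base with zero exponent gives 1; zero
     exponents are separated. *)
  have [vz|vz] := eqVneq v 0; last first.
    by rewrite -powR_mulrn// -powRD ?vz ?implybT// /a addrC subrK.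
  have [nz|nz] := eqVneq n 0.
    have J0 : J = 0%N by move: Jn; rewrite nz truncn0 leqn0 => /eqP.
    by rewrite /a /m J0 nz truncn0 subr0 powRr0 mulr1 expr0.
  have [az|az] := eqVneq a 0.
    have m0 : (0 < m)%N.
      rewrite lt0n; apply/eqP => m0; move: az nz; rewrite /a m0 subr0 => ->; by rewrite eqxx.
    by rewrite vz powR0// expr0n gtn_eqF// mul0r.
  by rewrite vz !powR0// mulr0.
rewrite -mulrBr normrM ger0_norm ?exprn_ge0// ler_wpM2l ?exprn_ge0//.
apply: le_trans (binom_taylor_error Ja _) _; first by apply/andP; split; lra.
rewrite ler_wpM2r ?exprn_ge0//; first lra.
apply: lerXn2r; rewrite ?nnegrE//; apply: le_trans Ja; exact: ler0n.
Qed.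

End BinomialTaylor.

(** * Growth of polynomials bounded at separated nodes *)

Section PolynomialGrowth.
Context {R : realFieldType}.

(** Newton interpolation, one node at a time: A = A(r) + B (X - r) at the last node r, and the
    separation g bounds B by 2M/g at the remaining nodes. *)
Lemma poly_growth s (A : {poly R}) (z : nat -> R) (x g M Z : R) :
  0 < g -> (size A <= s.+1)%N ->
  (forall i j, (i < j <= s)%N -> g <= `|z i - z j|) ->
  (forall i, (i <= s)%N -> `|A.[z i]| <= M) ->
  (forall i, (i <= s)%N -> `|x - z i| <= Z) ->
  `|A.[x]| <= M * (1 + 2 * Z / g) ^+ s.
Proof.
move=> g0; elim: s A M => [|s IH] A M sA Hg HM HZ.
  have -> : A = (A`_0)%:P by apply: size1_polyC.
  by have := HM 0%N isT; rewrite expr0 mulr1 {1}(size1_polyC sA) !hornerC.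
have Z0 : 0 <= Z by apply: le_trans (HZ 0%N isT).
have M0 : 0 <= M by apply: le_trans (HM 0%N isT).
pose r := z s.+1.
have : root (A - (A.[r])%:P) r by rewrite /root !hornerE subrr.
move=> /factor_theorem[B EB].
have EA y : A.[y] = A.[r] + B.[y] * (y - r).
  have := congr1 (fun p : {poly R} => p.[y]) EB.
  rewrite hornerD hornerN hornerC hornerM hornerXsubC => <-; ring.
have sB : (size B <= s.+1)%N.
  have [->|B0] := eqVneq B 0; first by rewrite size_poly0.
  have := size_Mmonic B0 (monicXsubC r); rewrite -EB size_XsubC addn2 /= => h.
  by rewrite -ltnS -h size_polyB_le// (leq_trans (size_polyC_leq1 _)).
have HB i : (i <= s)%N -> `|B.[z i]| <= 2 * M / g.
  move=> is_; have := HM i (leqW is_); have := HM s.+1 (leqnn _); rewrite -/r.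
  have gi : g <= `|z i - r| by apply: Hg; rewrite ltnS is_ leqnn.
  rewrite ler_pdivlMr// => h1 h2; apply: le_trans (_ : `|B.[z i]| * `|z i - r| <= _).
    by rewrite ler_wpM2l.
  rewrite -normrM (_ : _ * _ = A.[z i] - A.[r]); last by rewrite (EA (z i)); ring.
  by rewrite (le_trans (ler_normB _ _))//; lra.
have H : `|B.[x]| <= 2 * M / g * (1 + 2 * Z / g) ^+ s.
  apply: IH => // [i j /andP[ij js]|i is_]; first by apply: Hg; rewrite ij leqW.
  by apply: HZ; exact: leqW.
rewrite EA (le_trans (ler_normD _ _))// normrM.
have h1 := HM s.+1 (leqnn _); have h2 := HZ s.+1 (leqnn _).
have q0 : 0 <= 2 * Z / g by rewrite divr_ge0 ?mulr_ge0// ltW.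
have e1 : 1 <= (1 + 2 * Z / g) ^+ s by rewrite exprn_ege1//; lra.
apply: (@le_trans _ _ (M + 2 * M / g * (1 + 2 * Z / g) ^+ s * Z)).
  by apply: lerD => //; apply: ler_pM.
rewrite exprS.
have -> : M * ((1 + 2 * Z / g) * (1 + 2 * Z / g) ^+ s) =
  M * (1 + 2 * Z / g) ^+ s + 2 * M / g * (1 + 2 * Z / g) ^+ s * Z.
  by field; rewrite gt_eqF.
by rewrite lerD2r ler_peMr.
Qed.

End PolynomialGrowth.

(** * Polynomial functions on the sphere *)

Section SphereFunctions.
Context {R : realType} {d : nat}.
Implicit Types (f g : @pt R d -> R) (x y z : @pt R d) (l m : nat).
Local Notation S := (@sphere R d).

(** Polynomial functions of degree at most l, given by closure rules so that boundedness,
    measurability and invariance follow by induction; [Pi_pfun] and [pfun_Pi] connect them with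
    genuine multivariate polynomials. *)
Inductive pfun : nat -> (@pt R d -> R) -> Prop :=
| pfun_cst c : pfun 0 (fun=> c)
| pfun_coord i : pfun 1 (fun y => tnth y i)
| pfun_add l f g : pfun l f -> pfun l g -> pfun l (fun y => f y + g y)
| pfun_mul l m f g : pfun l f -> pfun m g -> pfun (l + m) (fun y => f y * g y)
| pfun_le l m f : (l <= m)%N -> pfun l f -> pfun m f.

Lemma pfun_eq l f g : pfun l f -> f =1 g -> pfun l g.
Proof. by move=> hf /funext <-. Qed.

Lemma pfun_scale l c f : pfun l f -> pfun l (fun y => c * f y).
Proof. by move=> hf; rewrite -(add0n l); apply: pfun_mul => //; exact: pfun_cst. Qed.

Lemma pfun_cst_le l c : pfun l (fun=> c).
Proof. exact: pfun_le (pfun_cst c). Qed.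

Lemma pfun_opp l f : pfun l f -> pfun l (fun y => - f y).
Proof. by move=> /(pfun_scale (-1)) h; apply: (pfun_eq h) => y; rewrite mulN1r. Qed.

Lemma pfun_sub l f g : pfun l f -> pfun l g -> pfun l (fun y => f y - g y).
Proof. by move=> hf hg; apply: pfun_add => //; exact: pfun_opp. Qed.

Lemma pfun_sum (I : Type) (s : seq I) l (F : I -> @pt R d -> R) :
  (forall i, pfun l (F i)) -> pfun l (fun y => \sum_(i <- s) F i y).
Proof.
move=> h; elim: s => [|i s IH].
  by apply: (pfun_eq (pfun_cst_le l 0)) => y; rewrite big_nil.
apply: (pfun_eq (pfun_add (h i) IH)) => y; by rewrite big_cons.
Qed.

Lemma pfun_exp l f n : pfun l f -> pfun (l * n) (fun y => f y ^+ n).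
Proof.
move=> hf; elim: n => [|n IH].
  by rewrite muln0; apply: (pfun_eq (pfun_cst 1)) => y; rewrite expr0.
by rewrite mulnS; apply: (pfun_eq (pfun_mul hf IH)) => y; rewrite exprS.
Qed.

Lemma pfun_dot x : pfun 1 (dot x).
Proof.
rewrite /dot; apply: pfun_sum => i; apply: pfun_scale; exact: pfun_coord.
Qed.

Lemma pfun_poly l f (Q : {poly R}) m : pfun l f -> (size Q <= m.+1)%N ->
  pfun (l * m) (fun y => Q.[f y]).
Proof.
move=> hf sQ.
apply: (@pfun_eq _ (fun y => \sum_(i <- index_enum 'I_m.+1) Q`_i * f y ^+ i)).
  apply: pfun_sum => i; apply: pfun_scale; apply: pfun_le (pfun_exp i hf).
  by rewrite leq_mul2l -ltnS ltn_ord orbT.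
by move=> y; rewrite (horner_coef_wide _ sQ).
Qed.

Lemma pfun_zonal x (Q : {poly R}) m : (size Q <= m.+1)%N -> pfun m (fun y => Q.[dot x y]).
Proof. by move=> sQ; have := pfun_poly (pfun_dot x) sQ; rewrite mul1n. Qed.

Lemma measurable_pfun l f : pfun l f -> measurable_fun [set: @pt R d] f.
Proof.
elim=> {l f} //.
- by move=> i; exact: measurable_tnth.
- by move=> l f g _ hf _ hg; exact: measurable_funD.
- by move=> l m f g _ hf _ hg; exact: measurable_funM.
Qed.

Lemma dotC x y : dot x y = dot y x.
Proof. by apply: eq_bigr => i _; rewrite mulrC. Qed.

Lemma sphere_coord y i : S y -> -1 <= tnth y i <= 1.
Proof.
rewrite /sphere /= /dot (bigD1 i)//= => h.
have : 0 <= \sum_(j < d.+1 | j != i) tnth y j * tnth y j.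
  by apply: sumr_ge0 => j _; rewrite -expr2 sqr_ge0.
by move=> h0; apply/andP; split; nra.
Qed.

Lemma pfun_bounded l f : pfun l f -> exists M, forall y, S y -> `|f y| <= M.
Proof.
elim=> {l f}.
- by move=> c; exists `|c|.
- by move=> i; exists 1 => y /(sphere_coord i); rewrite ler_norml.
- move=> l f g _ [M hM] _ [N hN]; exists (M + N) => y Sy.
  by rewrite (le_trans (ler_normD _ _))// lerD ?hM ?hN.
- move=> l m f g _ [M hM] _ [N hN]; exists (M * N) => y Sy.
  by rewrite normrM ler_pM ?hM ?hN.
- by [].
Qed.

Lemma cauchy_schwarz_sphere x y : S x -> S y -> -1 <= dot x y <= 1.
Proof.
rewrite /sphere /= => Sx Sy.
have h1 : 0 <= \sum_(i < d.+1) (tnth x i - tnth y i) ^+ 2 by apply: sumr_ge0 => i _; rewrite sqr_ge0.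
have h2 : 0 <= \sum_(i < d.+1) (tnth x i + tnth y i) ^+ 2 by apply: sumr_ge0 => i _; rewrite sqr_ge0.
have E1 : \sum_(i < d.+1) (tnth x i - tnth y i) ^+ 2 = dot x x - 2 * dot x y + dot y y.
  by rewrite /dot mulr_sumr -sumrB -big_split; apply: eq_bigr => i _ /=; ring.
have E2 : \sum_(i < d.+1) (tnth x i + tnth y i) ^+ 2 = dot x x + 2 * dot x y + dot y y.
  by rewrite /dot mulr_sumr -!big_split; apply: eq_bigr => i _ /=; ring.
rewrite E1 Sx Sy in h1; rewrite E2 Sx Sy in h2; lra.
Qed.

Lemma dist_sphere x y : S x -> S y -> dist x y ^+ 2 = 2 * (1 - dot x y).
Proof.
rewrite /sphere /= => Sx Sy; rewrite /dist sqr_sqrtr; last first.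
  by apply: sumr_ge0 => i _; rewrite sqr_ge0.
have -> : \sum_(i < d.+1) (tnth x i - tnth y i) ^+ 2 = dot x x - 2 * dot x y + dot y y.
  by rewrite /dot mulr_sumr -sumrB -big_split; apply: eq_bigr => i _ /=; ring.
rewrite Sx Sy; ring.
Qed.

Lemma measurable_sphere : measurable S.
Proof.
have h : pfun 2 (fun y : pt d => dot y y).
  by rewrite /dot; apply: pfun_sum => i; apply: (@pfun_mul 1 1); exact: pfun_coord.
have := measurable_pfun h measurableT (measurable_set1 (1 : R)).
by rewrite setTI; congr measurable; apply/seteqP; split => y.
Qed.

(** A class closed under the algebraic operations and integrable for every measure finite on the
    sphere; it holds the polynomial functions, the powers of zonal functions and the given f
    alike. *)
Definition bmfun f := measurable_fun S f /\ exists M, forall y, S y -> `|f y| <= M.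

Lemma pfun_bmfun l f : pfun l f -> bmfun f.
Proof.
move=> hf; split; last exact: pfun_bounded hf.
exact: measurable_funS (measurable_pfun hf).
Qed.

Lemma bmfunD f g : bmfun f -> bmfun g -> bmfun (fun y => f y + g y).
Proof.
move=> [mf [M hM]] [mg [N hN]]; split; first exact: measurable_funD.
exists (M + N) => y Sy; by rewrite (le_trans (ler_normD _ _))// lerD ?hM ?hN.
Qed.

Lemma bmfunM f g : bmfun f -> bmfun g -> bmfun (fun y => f y * g y).
Proof.
move=> [mf [M hM]] [mg [N hN]]; split; first exact: measurable_funM.
by exists (M * N) => y Sy; rewrite normrM ler_pM ?hM ?hN.
Qed.

Lemma bmfun_cst c : bmfun (fun=> c).
Proof. exact: pfun_bmfun (pfun_cst c). Qed.

Lemma bmfunZ c f : bmfun f -> bmfun (fun y => c * f y).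
Proof. by apply: bmfunM; exact: bmfun_cst. Qed.

Lemma bmfunN f : bmfun f -> bmfun (fun y => - f y).
Proof.
by move=> /(bmfunZ (-1)); rewrite (_ : (fun y => _) = (fun y => - f y))//; apply/funext => y; rewrite mulN1r.
Qed.

Lemma bmfunB f g : bmfun f -> bmfun g -> bmfun (fun y => f y - g y).
Proof. by move=> hf hg; apply: bmfunD => //; exact: bmfunN. Qed.

Lemma bmfun_norm f : bmfun f -> bmfun (fun y => `|f y|).
Proof.
move=> [mf [M hM]]; split; first exact: measurableT_comp.
by exists M => y Sy; rewrite normr_id hM.
Qed.

Lemma bmfun_integrable (nu : {measure set (@pt R d) -> \bar R}) f : (nu S < +oo)%E -> bmfun f ->
  nu.-integrable S (EFin \o f).
Proof.
move=> fin [mf [M hM]]; apply: measurable_bounded_integrable => //.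
  exact: measurable_sphere.
by exists M; split; rewrite ?num_real// => N MN y Sy; exact: le_trans (hM y Sy) (ltW MN).
Qed.

Section Integral.
Variable nu : {measure set (@pt R d) -> \bar R}.
Hypothesis fin : (nu S < +oo)%E.

Definition SE f : R := \int[nu]_(y in S) f y.

Lemma SED f g : bmfun f -> bmfun g -> SE (fun y => f y + g y) = SE f + SE g.
Proof. by move=> hf hg; rewrite /SE RintegralD//; [exact: measurable_sphere|exact: bmfun_integrable..]. Qed.

Lemma SEB f g : bmfun f -> bmfun g -> SE (fun y => f y - g y) = SE f - SE g.
Proof. by move=> hf hg; rewrite /SE RintegralB//; [exact: measurable_sphere|exact: bmfun_integrable..]. Qed.

Lemma SEZ c f : bmfun f -> SE (fun y => c * f y) = c * SE f.
Proof. by move=> hf; rewrite /SE RintegralZl//; [exact: measurable_sphere|exact: bmfun_integrable]. Qed.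

Lemma SE_le f g : bmfun f -> bmfun g -> (forall y, S y -> f y <= g y) -> SE f <= SE g.
Proof.
move=> hf hg h; apply: le_Rintegral => //; [exact: measurable_sphere|exact: bmfun_integrable..].
Qed.

Lemma SE_ge0 f : (forall y, S y -> 0 <= f y) -> 0 <= SE f.
Proof. by move=> h; apply: Rintegral_ge0. Qed.

Lemma SE_norm f : bmfun f -> `|SE f| <= SE (fun y => `|f y|).
Proof. by move=> hf; apply: le_normr_Rintegral; [exact: measurable_sphere|exact: bmfun_integrable]. Qed.

Lemma eq_SE f g : (forall y, S y -> f y = g y) -> SE f = SE g.
Proof. by move=> h; apply: eq_Rintegral => y; rewrite inE => /h. Qed.

Lemma bmfun_sum (I : Type) (s : seq I) (F : I -> @pt R d -> R) : (forall i, bmfun (F i)) ->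
  bmfun (fun y => \sum_(i <- s) F i y).
Proof.
move=> h; elim: s => [|i s IH].
  by rewrite (_ : (fun y => _) = (fun=> 0)); [exact: bmfun_cst|apply/funext => y; rewrite big_nil].
rewrite (_ : (fun y => _) = (fun y => F i y + \sum_(i <- s) F i y)); first exact: bmfunD.
by apply/funext => y; rewrite big_cons.
Qed.

Lemma SE0 : SE (fun=> 0) = 0.
Proof. by rewrite /SE Rintegral_cst ?mul0r//; exact: measurable_sphere. Qed.

Lemma SE_sum (I : Type) (s : seq I) (F : I -> @pt R d -> R) : (forall i, bmfun (F i)) ->
  SE (fun y => \sum_(i <- s) F i y) = \sum_(i <- s) SE (F i).
Proof.
move=> h; elim: s => [|i s IH].
  by rewrite big_nil -[RHS]SE0; apply: eq_SE => y _; rewrite big_nil.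
rewrite big_cons -IH -SED//; last exact: bmfun_sum.
by apply: eq_SE => y _; rewrite big_cons.
Qed.

Lemma integral_SE f : bmfun f -> (\int[nu]_(y in S) (f y)%:E)%E = (SE f)%:E.
Proof.
move=> hf; rewrite /SE /Rintegral fineK//.
by apply: integrable_fin_num; [exact: measurable_sphere|exact: bmfun_integrable].
Qed.

End Integral.

End SphereFunctions.

(** * Reflections and invariance of the sphere measure *)

Section Reflections.
Context {R : realType} {d : nat}.
Implicit Types (f g : @pt R d -> R) (v x y z : @pt R d) (l m : nat).
Local Notation S := (@sphere R d).

(** Householder reflection; dividing by [dot v v] spares the normalization of v and hence a square
    root. *)
Definition refl v y : @pt R d := [tuple tnth y k - 2 / dot v v * dot v y * tnth v k | k < d.+1].

Lemma tnth_refl v y k : tnth (refl v y) k = tnth y k - 2 / dot v v * dot v y * tnth v k.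
Proof. by rewrite tnth_mktuple. Qed.

Definition refl_mx v : 'M[R]_d.+1 :=
  1%:M - (2 / dot v v) *: ((\col_i tnth v i) *m (\row_i tnth v i)).

Lemma refl_mxE v i j : refl_mx v i j = (i == j)%:R - 2 / dot v v * (tnth v i * tnth v j).
Proof. by rewrite !mxE big_ord1 !mxE. Qed.

Lemma refl_rotate v y : refl v y = rotate (refl_mx v) y.
Proof.
apply: eq_from_tnth => k; rewrite tnth_refl /rotate tnth_mktuple.
under eq_bigr do rewrite refl_mxE mulrBl.
rewrite sumrB (bigD1 k)//= eqxx mul1r big1 ?addr0 => [|i ik]; last first.
  by rewrite eq_sym (negPf ik) mul0r.
congr (_ - _); rewrite /dot [in LHS]mulr_sumr mulr_suml; apply: eq_bigr => i _; ring.
Qed.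

Lemma refl_mx_orth v : dot v v != 0 -> (refl_mx v)^T *m refl_mx v = 1%:M.
Proof.
move=> v0; apply/matrixP => i j; rewrite !mxE.
under eq_bigr do rewrite mxE !refl_mxE.
set c := 2 / dot v v.
transitivity (\sum_k ((k == i)%:R * (k == j)%:R - c * ((k == i)%:R * (tnth v k * tnth v j))
   - c * ((k == j)%:R * (tnth v k * tnth v i)) + c ^+ 2 * (tnth v i * tnth v j) * (tnth v k * tnth v k))).
  by apply: eq_bigr => k _; ring.
rewrite big_split sumrB sumrB -!mulr_sumr -/(dot v v) /=.
have D (F : 'I_d.+1 -> R) (m : 'I_d.+1) : \sum_k (k == m)%:R * F k = F m.
  rewrite (bigD1 m)//= eqxx mul1r big1 ?addr0// => k km; by rewrite (negPf km) mul0r.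
by rewrite !D /c; field.
Qed.

Lemma dot_refl v x y : dot v v != 0 -> dot (refl v x) (refl v y) = dot x y.
Proof.
move=> v0; rewrite {1}/dot; under eq_bigr do rewrite !tnth_refl.
transitivity (\sum_i (tnth x i * tnth y i - 2 / dot v v * dot v y * (tnth v i * tnth x i)
  - 2 / dot v v * dot v x * (tnth v i * tnth y i)
  + (2 / dot v v) ^+ 2 * dot v x * dot v y * (tnth v i * tnth v i))).
  by apply: eq_bigr => i _; ring.
rewrite big_split sumrB sumrB -!mulr_sumr -/(dot v v) -/(dot v x) -/(dot v y) -/(dot x y) /=.
by field.
Qed.

Lemma dot_reflr v x y : dot x (refl v y) = dot x y - 2 / dot v v * dot v y * dot v x.
Proof.
rewrite {1}/dot; under eq_bigr do rewrite tnth_refl mulrBr.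
rewrite sumrB; congr (_ - _); rewrite [dot v x]/dot [RHS]mulr_sumr; apply: eq_bigr => i _; ring.
Qed.

Lemma sphere_refl v y : dot v v != 0 -> S (refl v y) <-> S y.
Proof. by move=> v0; rewrite /sphere /= dot_refl. Qed.

Lemma reflK v : dot v v != 0 -> involutive (refl v).
Proof.
move=> v0 y; apply: eq_from_tnth => k; rewrite tnth_refl dot_reflr tnth_refl; by field.
Qed.

Lemma pfun_comp l f (phi : @pt R d -> @pt R d) :
  (forall i, pfun 1 (fun y => tnth (phi y) i)) -> pfun l f -> pfun l (fun y => f (phi y)).
Proof.
move=> hphi; elim=> {l f}.
- by move=> c; exact: pfun_cst.
- by move=> i; exact: hphi.
- by move=> l f g _ hf _ hg; exact: pfun_add.
- by move=> l m f g _ hf _ hg; exact: pfun_mul.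
- by move=> l m f lm _ hf; exact: pfun_le hf.
Qed.

Lemma pfun_refl_coord v i : pfun 1 (fun y => tnth (refl v y) i).
Proof.
apply: (@pfun_eq _ _ _ (fun y => tnth y i - (2 / dot v v * tnth v i) * dot v y)).
  by apply: pfun_sub; [exact: pfun_coord|apply: pfun_scale; exact: pfun_dot].
by move=> y; rewrite tnth_refl; ring.
Qed.

Lemma pfun_refl v l f : pfun l f -> pfun l (fun y => f (refl v y)).
Proof. by apply: pfun_comp => i; exact: pfun_refl_coord. Qed.

Lemma measurable_refl v : measurable_fun [set: @pt R d] (refl v).
Proof.
apply/measurable_fun_tnthP => i.
exact: (measurable_pfun (pfun_refl_coord v i)).
Qed.

Context (mu : {measure set (@pt R d) -> \bar R}).
Hypothesis Hmu : is_sphere_measure mu.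

Lemma mu_sphere : mu S = 1%E. Proof. by case: Hmu. Qed.
Lemma mu_sphere_fin : (mu S < +oo)%E. Proof. by rewrite mu_sphere ltry. Qed.
Local Notation E := (SE mu).

Lemma SE_cst c : E (fun=> c) = c.
Proof. by rewrite /SE Rintegral_cst ?mu_sphere ?mulr1//; exact: measurable_sphere. Qed.

Lemma SE_refl v l f : dot v v != 0 -> pfun l f -> E (fun y => f (refl v y)) = E f.
Proof.
move=> v0 hf; rewrite /SE /Rintegral; congr fine.
have mphi := measurable_refl v.
pose mixin := isMeasurableFun.Build _ _ _ _ _ mphi.
pose phi : {mfun _ >-> _} := HB.pack (refl v) mixin.
have pS : refl v @^-1` S = S by apply/seteqP; split => y /=; rewrite -/(S _) sphere_refl.
have : (\int[pushforward mu phi]_(y in S) (f y)%:E =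
    \int[mu]_(y in refl v @^-1` S) ((EFin \o f) \o refl v) y)%E.
  apply: (integral_pushforward mphi); last exact: measurable_sphere.
    by apply/measurable_EFinP; exact: measurable_pfun hf.
  rewrite pS; apply: (bmfun_integrable mu_sphere_fin (f := fun y => f (refl v y))).
  exact: pfun_bmfun (pfun_refl v hf).
rewrite pS => <-; apply: eq_measure_integral => A mA _.
have [_ _ H] := Hmu; rewrite -[RHS](H _ (refl_mx_orth v0) _ mA) /pushforward.
by congr (mu _); apply/seteqP; split => y; rewrite /preimage /= refl_rotate.
Qed.

End Reflections.

(** * Infinitesimal rotations *)

Section InfinitesimalRotation.
Context {R : realType} {d : nat}.
Implicit Types (f g : @pt R d -> R) (v x y z : @pt R d) (l m : nat) (s : seq 'I_d.+1).
Local Notation S := (@sphere R d).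

Definition basis (i : 'I_d.+1) : @pt R d := [tuple (k == i)%:R | k < d.+1].

Lemma tnth_basis i k : tnth (basis i) k = (k == i)%:R.
Proof. by rewrite tnth_mktuple. Qed.

Lemma dot_basis i y : dot (basis i) y = tnth y i.
Proof.
rewrite /dot (bigD1 i)//= tnth_basis eqxx mul1r big1 ?addr0// => k ki.
by rewrite tnth_basis (negPf ki) mul0r.
Qed.

Section Pair.
Variables (i j : 'I_d.+1).
Hypothesis ij : i != j.

Definition tilt (a : R) : @pt R d := [tuple (k == i)%:R + a * (k == j)%:R | k < d.+1].

Lemma tnth_tilt a k : tnth (tilt a) k = (k == i)%:R + a * (k == j)%:R.
Proof. by rewrite tnth_mktuple. Qed.

Lemma dot_tilt a y : dot (tilt a) y = tnth y i + a * tnth y j.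
Proof.
rewrite -!dot_basis /dot mulr_sumr -big_split; apply: eq_bigr => k _ /=.
by rewrite tnth_tilt !tnth_basis mulrDl mulrA.
Qed.

Lemma dot_tilt2 a : dot (tilt a) (tilt a) = 1 + a ^+ 2.
Proof.
have ji : (j == i) = false by rewrite eq_sym (negPf ij).
by rewrite dot_tilt !tnth_tilt !eqxx (negPf ij) ji /=; ring.
Qed.

Lemma dot_tilt2_gt0 a : 0 < dot (tilt a) (tilt a).
Proof. by rewrite dot_tilt2 ltr_pwDl// sqr_ge0. Qed.

(* A product of two reflections: the rotation of the [(i, j)]-plane by about [2 a]. *)
Definition rot a y : @pt R d := refl (tilt a) (refl (basis i) y).

Lemma dot_basis2 k : dot (basis k) (basis k) = 1.
Proof. by rewrite dot_basis tnth_basis eqxx. Qed.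

Lemma sphere_rot a y : S y -> S (rot a y).
Proof.
move=> Sy; rewrite /rot sphere_refl ?gt_eqF ?dot_tilt2_gt0// sphere_refl//.
by rewrite dot_basis2 oner_neq0.
Qed.

(** Derivative of the k-th coordinate along [rot] at a = 0; the factor 2 reflects the angle of about
    2a. *)
Definition rot_coord (k : 'I_d.+1) y : R := 2 * ((k == j)%:R * tnth y i - (k == i)%:R * tnth y j).

Lemma rot_coordE a y k : tnth (rot a y) k = tnth y k + a * rot_coord k y
  - 2 * a ^+ 2 / (1 + a ^+ 2) * ((k == i)%:R * (tnth y i - a * tnth y j) +
     (k == j)%:R * (a * tnth y i + tnth y j)).
Proof.
rewrite /rot tnth_refl dot_tilt2 dot_tilt !tnth_refl dot_basis2 dot_basis !tnth_basis tnth_tilt.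
have ji : (j == i) = false by rewrite eq_sym (negPf ij).
rewrite !eqxx ji /rot_coord.
have h : 1 + a ^+ 2 != 0 by rewrite gt_eqF// ltr_pwDl// sqr_ge0.
have [->|ki] := eqVneq k i; first by rewrite (negPf ij) /=; field.
have [->|kj] := eqVneq k j; first by rewrite /=; field.
by rewrite /=; field.
Qed.

(** A first-order expansion with quadratic error uniform on the sphere, so that it can be integrated
    directly, without differentiating under the integral. *)
Definition rot_deriv f Lf := exists C, forall y a, S y -> `|a| <= 1 ->
  `|f (rot a y) - f y - a * Lf y| <= C * a ^+ 2.

Lemma rot_deriv_eq f Lf Lf' : (forall y, S y -> Lf y = Lf' y) -> rot_deriv f Lf -> rot_deriv f Lf'.
Proof. by move=> h [C H]; exists C => y a Sy a1; rewrite -h// H. Qed.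

Lemma rot_deriv_coord k : rot_deriv (fun y => tnth y k) (rot_coord k).
Proof.
exists 8 => y a Sy a1; rewrite rot_coordE.
rewrite (_ : _ - _ - _ = - (2 * a ^+ 2 / (1 + a ^+ 2) * ((k == i)%:R * (tnth y i - a * tnth y j) +
     (k == j)%:R * (a * tnth y i + tnth y j)))); last by ring.
have /andP[yi1 yi2] := sphere_coord i Sy; have /andP[yj1 yj2] := sphere_coord j Sy.
move: a1; rewrite ler_norml => /andP[a1 a2].
have a20 := sqr_ge0 a.
have c0 : 0 <= 2 * a ^+ 2 / (1 + a ^+ 2) by apply: divr_ge0; lra.
rewrite normrN normrM (ger0_norm c0).
have h1 : 2 * a ^+ 2 / (1 + a ^+ 2) <= 2 * a ^+ 2.
  rewrite ler_pdivrMr; last by lra.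
  nra.
have h2 : `|(k == i)%:R * (tnth y i - a * tnth y j) + (k == j)%:R * (a * tnth y i + tnth y j)| <= 4.
  rewrite ler_norml; case: (k == i); case: (k == j); rewrite ?mul1r ?mul0r ?add0r ?addr0;
  apply/andP; split; nra.
apply: (@le_trans _ _ (2 * a ^+ 2 * 4)); last by lra.
by apply: ler_pM.
Qed.

Lemma rot_deriv_mul f Lf g Lg (M : R) : (forall y, S y -> [/\ `|f y| <= M, `|Lf y| <= M, `|g y| <= M & `|Lg y| <= M]) ->
  rot_deriv f Lf -> rot_deriv g Lg ->
  rot_deriv (fun y => f y * g y) (fun y => Lf y * g y + f y * Lg y).
Proof.
move=> HM [C HC] [C' HC']; exists (M ^+ 2 + C * M + 2 * M * C') => y a Sy a1.
have [fM LfM gM LgM] := HM y Sy; have [_ _ gM' _] := HM _ (sphere_rot a Sy).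
have M0 : 0 <= M by rewrite (le_trans _ fM).
have hc := HC y a Sy a1; have hc' := HC' y a Sy a1.
set A := f (rot a y) - f y - a * Lf y in hc; set B := g (rot a y) - g y - a * Lg y in hc'.
rewrite (_ : _ - _ - _ = a ^+ 2 * (Lf y * Lg y) + A * g (rot a y) + (f y + a * Lf y) * B); last first.
  by rewrite /A /B; ring.
rewrite (le_trans (ler_normD _ _))// (mulrDl _ _ (a ^+ 2)) lerD//.
  rewrite (le_trans (ler_normD _ _))// (mulrDl (M ^+ 2)) lerD//.
    rewrite normrM ger0_norm ?sqr_ge0// mulrC ler_wpM2r ?sqr_ge0// normrM expr2.
    exact: ler_pM.
  by rewrite normrM mulrAC; apply: ler_pM.
rewrite normrM -(mulrA (2 * M)); apply: ler_pM => //.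
rewrite (le_trans (ler_normD _ _))// normrM.
have : `|a| * `|Lf y| <= 1 * M by apply: ler_pM.
lra.
Qed.

Lemma rot_deriv_fixed f : (forall y a, S y -> f (rot a y) = f y) -> rot_deriv f (fun=> 0).
Proof. by move=> h; exists 0 => y a Sy _; rewrite h// subrr mulr0 subr0 normr0 mul0r. Qed.

Context (mu : {measure set (@pt R d) -> \bar R}).
Hypothesis Hmu : is_sphere_measure mu.
Local Notation E := (SE mu).

(** Invariance makes the mean of f along [rot] constant, so the expansion gives a |E Lf| <= C a^2;
    let a tend to 0. *)
Lemma SE_rot_deriv l l' f Lf : pfun l f -> pfun l' Lf -> rot_deriv f Lf -> E Lf = 0.
Proof.
move=> hf hLf [C HC].
have fin := mu_sphere_fin Hmu.
have prot a : pfun l (fun y => f (rot a y)).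
  exact: (pfun_refl (basis i) (pfun_refl (tilt a) hf)).
have Erot a : E (fun y => f (rot a y)) = E f.
  rewrite (SE_refl Hmu (v := basis i) _ (pfun_refl (tilt a) hf)) ?dot_basis2 ?oner_neq0//.
  by rewrite (SE_refl Hmu _ hf)// gt_eqF// dot_tilt2_gt0.
have key a : 0 < a -> a <= 1 -> `|E Lf| <= C * a.
  move=> a0 a1.
  have s1 := pfun_bmfun (prot a); have s2 := pfun_bmfun hf; have s3 := pfun_bmfun hLf.
  have h : a * `|E Lf| <= C * a ^+ 2.
    rewrite -(ger0_norm (ltW a0)) -normrM -normrN (ger0_norm (ltW a0)).
    have -> : - (a * E Lf) = E (fun y => f (rot a y) - f y - a * Lf y).
      by rewrite (SEB fin (bmfunB s1 s2) (bmfunZ a s3)) (SEB fin s1 s2) (SEZ fin a s3) Erot subrr sub0r.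
    have s4 := bmfunB (bmfunB s1 s2) (bmfunZ a s3).
    apply: le_trans (SE_norm fin s4) _.
    rewrite -[leRHS](SE_cst Hmu); apply: SE_le => //.
    - exact: bmfun_norm.
    - exact: bmfun_cst.
    - by move=> y Sy; apply: HC => //; rewrite ger0_norm// ltW.
  by rewrite -(ler_pM2l a0) (le_trans h)// expr2; lra.
apply/eqP; rewrite -normr_le0; apply/ler_addgt0Pr => e e0; rewrite add0r.
pose D := `|C| + 1.
have D0 : 0 < D by rewrite ltr_wpDl.
pose a := Num.min 1 (e / D).
have a0 : 0 < a by rewrite lt_min ltr01 divr_gt0.
apply: le_trans (key a a0 _) _; first by rewrite ge_min lexx.
apply: (@le_trans _ _ (D * (e / D))); last by rewrite mulrC divfK// gt_eqF.
apply: (@le_trans _ _ (D * a)).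
  by rewrite ler_pM2r// (le_trans (ler_norm C))// lerDl.
by rewrite ler_pM2l// ge_min lexx orbT.
Qed.

End Pair.

Definition mon s y : R := \prod_(k <- s) tnth y k.
(** The i-th partial derivative of a monomial listed by its variables. If i is absent [rem] changes
    nothing, but the multiplicity is 0. *)
Definition mon_deriv (i : 'I_d.+1) s y : R := (count_mem i s)%:R * mon (rem i s) y.

Lemma mon_cons k s y : mon (k :: s) y = tnth y k * mon s y.
Proof. by rewrite /mon big_cons. Qed.

Lemma mon_deriv_cons i k s y :
  mon_deriv i (k :: s) y = (k == i)%:R * mon s y + tnth y k * mon_deriv i s y.
Proof.
rewrite /mon_deriv /=; have [->|ki] := eqVneq k i; last first.
  by rewrite mon_cons mul0r add0r mulrCA.
rewrite mul1r natrD mulrDl mul1r; congr (_ + _).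
have [is_|is_] := boolP (i \in s); last by rewrite (count_memPn is_) !mul0r mulr0.
by rewrite mulrCA -mon_cons /mon (perm_big _ (perm_to_rem is_)).
Qed.

Lemma pfun_mon s : pfun (size s) (mon s).
Proof.
elim: s => [|k s IH]; first by apply: (pfun_eq (pfun_cst 1)) => y; rewrite /mon big_nil.
apply: (@pfun_eq _ _ _ (fun y => tnth y k * mon s y)); last by move=> y; rewrite mon_cons.
by rewrite /= -add1n; apply: pfun_mul => //; exact: pfun_coord.
Qed.

Lemma pfun_mon_deriv i s : pfun (size s) (mon_deriv i s).
Proof.
apply: pfun_scale; apply: pfun_le (pfun_mon _).
have [is_|is_] := boolP (i \in s); last by rewrite rem_id.
by rewrite size_rem// leq_pred.
Qed.

Lemma mon_euler s y : \sum_i tnth y i * mon_deriv i s y = (size s)%:R * mon s y.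
Proof.
elim: s => [|k s IH].
  by rewrite mul0r big1// => i _; rewrite /mon_deriv mul0r mulr0.
under eq_bigr do rewrite mon_deriv_cons mulrDr.
rewrite big_split /=; under [X in _ + X]eq_bigr do rewrite mulrCA.
rewrite -mulr_sumr IH (bigD1 k)//= eqxx mul1r big1 => [|i ik]; last first.
  by rewrite eq_sym (negPf ik) mul0r mulr0.
rewrite mon_cons -[(size s).+1%:R]natr1; ring.
Qed.

End InfinitesimalRotation.

(** * Zonal reduction and reproducing kernel *)

Section ZonalReduction.
Context {R : realType} {d : nat}.
Hypothesis d2 : (2 <= d)%N.
Implicit Types (f : @pt R d -> R) (v x y z : @pt R d) (l m : nat) (s : seq 'I_d.+1) (g Q : {poly R}).
Local Notation S := (@sphere R d).
Context (mu : {measure set (@pt R d) -> \bar R}).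
Hypothesis Hmu : is_sphere_measure mu.
Local Notation E := (SE mu).
Let fin := mu_sphere_fin Hmu.

Lemma pfun_axis (i : 'I_d.+1) g : exists l, pfun l (fun y => g.[tnth y i]).
Proof.
exists (1 * size g)%N; apply: pfun_poly; first exact: pfun_coord.
exact: leqnSn.
Qed.

Lemma rot_deriv_mon (i j : 'I_d.+1) s : i != j ->
  rot_deriv i j (mon s) (fun y => 2 * (tnth y i * mon_deriv j s y - tnth y j * mon_deriv i s y)).
Proof.
move=> ij; elim: s => [|k s IH].
  apply: rot_deriv_eq (rot_deriv_fixed (f := mon [::]) _) => [y _|y a _].
    by rewrite /mon_deriv !mul0r !mulr0 subrr mulr0.
  by rewrite /mon !big_nil.
pose Lf y := 2 * (tnth y i * mon_deriv j s y - tnth y j * mon_deriv i s y).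
have pLf : pfun (1 + size s) Lf.
  apply: pfun_scale; apply: pfun_sub; apply: pfun_mul; try exact: pfun_coord; exact: pfun_mon_deriv.
have pc : pfun 1 (@rot_coord R d i j k).
  by apply: pfun_scale; apply: pfun_sub; apply: pfun_scale; exact: pfun_coord.
have [M1 H1] := pfun_bounded (pfun_mon (R := R) s); have [M2 H2] := pfun_bounded pLf.
have [M3 H3] := pfun_bounded pc.
pose M : R := 1 + `|M1| + `|M2| + `|M3|.
have D := rot_deriv_mul (M := M) ij _ (rot_deriv_coord ij k) IH.
apply: (rot_deriv_eq _ (_ : rot_deriv i j (mon (k :: s)) _)); last first.
  have [y Sy|C HC] := D.
    have n1 := normr_ge0 M1; have n2 := normr_ge0 M2; have n3 := normr_ge0 M3.
    split.
    - have := sphere_coord k Sy; rewrite -ler_norml /M; lra.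
    - by apply: le_trans (H3 y Sy) _; apply: le_trans (ler_norm _) _; rewrite /M; lra.
    - by apply: le_trans (H1 y Sy) _; apply: le_trans (ler_norm _) _; rewrite /M; lra.
    - by apply: le_trans (H2 y Sy) _; apply: le_trans (ler_norm _) _; rewrite /M; lra.
  by exists C => y a Sy a1; rewrite !mon_cons; exact: HC.
move=> y _; rewrite !mon_deriv_cons /rot_coord; ring.
Qed.

(* Infinitesimal invariance of [E] under the rotations of the [(i, j)]-plane, tested against a
   function of a third coordinate times a monomial. *)
Lemma SE_rotation (i j o : 'I_d.+1) s g : i != j -> i != o -> j != o ->
  E (fun y => g.[tnth y o] * (tnth y i * mon_deriv j s y - tnth y j * mon_deriv i s y)) = 0.
Proof.
move=> ij io jo.
have [l pg] := pfun_axis o g.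
have fixg : rot_deriv i j (fun y : @pt R d => g.[tnth y o]) (fun=> 0).
  apply: rot_deriv_fixed => y a _; rewrite rot_coordE// /rot_coord.
  rewrite eq_sym (negPf jo) eq_sym (negPf io).
  by congr g.[_]; rewrite !mul0r !addr0 subrr !mulr0 addr0 subr0.
pose Lf (y : @pt R d) := 2 * (tnth y i * mon_deriv j s y - tnth y j * mon_deriv i s y).
have pD : pfun (1 + size s) (fun y : @pt R d => tnth y i * mon_deriv j s y - tnth y j * mon_deriv i s y).
  apply: pfun_sub; apply: pfun_mul; try exact: pfun_coord; exact: pfun_mon_deriv.
have pLf : pfun (1 + size s) Lf by exact: pfun_scale.
have [M1 H1] := pfun_bounded (pfun_mon (R := R) s); have [M2 H2] := pfun_bounded pLf.
have [M3 H3] := pfun_bounded pg.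
pose M : R := 1 + `|M1| + `|M2| + `|M3|.
have n1 := normr_ge0 M1; have n2 := normr_ge0 M2; have n3 := normr_ge0 M3.
have D := rot_deriv_mul (M := M) ij _ fixg (rot_deriv_mon s ij).
have {}D : rot_deriv i j (fun y => g.[tnth y o] * mon s y) (fun y => 2 * (g.[tnth y o] *
    (tnth y i * mon_deriv j s y - tnth y j * mon_deriv i s y))).
  apply: rot_deriv_eq (D _) => [y _|y Sy]; first by ring.
  split.
  - by apply: le_trans (H3 y Sy) _; apply: le_trans (ler_norm _) _; rewrite /M; lra.
  - by rewrite normr0 /M; lra.
  - by apply: le_trans (H1 y Sy) _; apply: le_trans (ler_norm _) _; rewrite /M; lra.
  - by apply: le_trans (H2 y Sy) _; apply: le_trans (ler_norm _) _; rewrite /M; lra.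
have p1 := pfun_mul pg (pfun_mon s); have p2 := pfun_mul pg pD.
have := SE_rot_deriv ij Hmu p1 (pfun_scale 2 p2) D.
rewrite (SEZ fin 2 (pfun_bmfun p2)) => /eqP.
by rewrite mulf_eq0 pnatr_eq0 /= => /eqP.
Qed.

Local Notation o := (ord0 : 'I_d.+1).

Lemma sphere_norm y : S y -> \sum_i tnth y i ^+ 2 = 1.
Proof. by rewrite /sphere /= => <-; apply: eq_bigr => i _; rewrite expr2. Qed.

Lemma mon_deriv_notin i s y : i \notin s -> mon_deriv i s y = 0.
Proof. by move=> is_; rewrite /mon_deriv (count_memPn is_) mul0r. Qed.

(** The rotation identity in the (i, j)-plane is applied to y_j times the monomial s and summed over
    all j other than i and the axis. Euler's identity and |y| = 1 collapse the sum: two factors y_i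
    are traded for 1 - t^2. *)
Lemma SE_lower (i : 'I_d.+1) s g : i != o -> o \notin s ->
  (d.-1 + size s)%:R * E (fun y => g.[tnth y o] * mon (i :: s) y) =
  E (fun y => (g * (1 - 'X^2)).[tnth y o] * mon_deriv i s y).
Proof.
move=> io os; have [l pg] := pfun_axis o g.
pose F (j : 'I_d.+1) (y : @pt R d) := g.[tnth y o] *
  (tnth y i * mon_deriv j (j :: s) y - tnth y j * mon_deriv i (j :: s) y).
pose G (j : 'I_d.+1) := if (j != i) && (j != o) then F j else (fun=> 0).
have pF j : pfun (l + (1 + (size s).+1)) (F j).
  apply: pfun_mul => //; apply: pfun_sub; apply: pfun_mul; try exact: pfun_coord;
  exact: (pfun_mon_deriv _ (_ :: _)).
have pG j : bmfun (G j).
  by rewrite /G; case: ifP => _; [exact: pfun_bmfun (pF j)|exact: bmfun_cst].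
have EG j : E (G j) = 0.
  rewrite /G; case: ifPn => [/andP[ji jo]|_]; last exact: SE0.
  by apply: SE_rotation => //; rewrite eq_sym.
have : E (fun y => \sum_j G j y) = 0.
  by rewrite (SE_sum fin)// big1.
have pm : pfun (l + (size s).+1) (fun y => g.[tnth y o] * mon (i :: s) y).
  by apply: pfun_mul => //; exact: (pfun_mon (_ :: _)).
have [l' pg'] := pfun_axis o (g * (1 - 'X^2)).
have pm' : pfun (l' + size s) (fun y => (g * (1 - 'X^2)).[tnth y o] * mon_deriv i s y).
  by apply: pfun_mul => //; exact: pfun_mon_deriv.
rewrite -(SEZ fin _ (pfun_bmfun pm)) => E0; apply/eqP; rewrite -subr_eq0.
rewrite -(SEB fin (pfun_bmfun (pfun_scale _ pm)) (pfun_bmfun pm')) -[X in _ == X]E0; apply/eqP.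
apply: eq_SE => y Sy.
have Gy j : G j y = if (j != i) && (j != o) then g.[tnth y o] *
    (tnth y i * mon s y + tnth y i * (tnth y j * mon_deriv j s y) - tnth y j ^+ 2 * mon_deriv i s y) else 0.
  rewrite /G; case: ifP => // /andP[ji jo]; rewrite /F !mon_deriv_cons eqxx (negPf ji) /=.
  by congr (_ * _); ring.
under eq_bigr do rewrite Gy.
rewrite -big_mkcond /= -mulr_sumr.
rewrite sumrB big_split /= sumr_const -mulr_sumr -mulr_suml.
have split2 (H : 'I_d.+1 -> R) : \sum_(j | (j != i) && (j != o)) H j = \sum_j H j - H i - H o.
  rewrite [in RHS](bigD1 i)//= [X in _ = _ + X - _ - _](bigD1 o)//=; last by rewrite eq_sym.
  by rewrite (eq_bigl (fun j => (j != i) && (j != o)))//; ring.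
rewrite !split2 mon_euler (mon_deriv_notin _ os) sphere_norm// mulr0 subr0.
have -> : #|[pred j : 'I_d.+1 | (j != i) && (j != o)]| = d.-1.
  rewrite (eq_card (B := predC (pred2 i o))) => [|j]; last by rewrite !inE negb_or.
  have := cardC (pred2 i o); rewrite card2 io card_ord add2n.
  by move=> /(congr1 (fun n => n.-2)).
rewrite mon_cons !(hornerM, hornerD, hornerN, hornerX, hornerC) natrD.
rewrite -[tnth y i * mon s y *+ _]mulr_natr.
by move: (mon_deriv i s y) => D; ring.
Qed.

Lemma zonal_mon s : o \notin s -> exists P : {poly R},
  [/\ (size P <= (size s).+1)%N, P.[1] = (s == [::])%:R &
      forall g, E (fun y => g.[tnth y o] * mon s y) = E (fun y => (g * P).[tnth y o])].
Proof.
have [n] := ubnP (size s); elim: n s => // n IH [|i s] /= sn os.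
  exists 1; split; rewrite ?size_poly1 ?hornerC// => g.
  by apply: eq_SE => y _; rewrite mulr1 /mon big_nil mulr1.
move: os; rewrite inE negb_or => /andP[oi os].
have io : i != o by rewrite eq_sym.
have c0 : (d.-1 + size s)%:R != 0 :> R.
  by rewrite pnatr_eq0 addn_eq0 negb_and -lt0n -ltnS prednK ?d2// (ltnW d2).
have [is_|is_] := boolP (i \in s); last first.
  exists 0; split; rewrite ?size_poly0 ?horner0// => g.
  apply: (mulfI c0); rewrite SE_lower//; transitivity (0 : R).
    by rewrite -[RHS](SE0 mu); apply: eq_SE => y _; rewrite mon_deriv_notin// mulr0.
  rewrite -[LHS](mulr0 (d.-1 + size s)%:R) -[X in _ * X = _](SE0 mu).
  by congr (_ * _); apply: eq_SE => y _; rewrite mulr0 horner0.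
have srem : size (rem i s) = (size s).-1 by rewrite size_rem.
have ss : (0 < size s)%N by case: (s) is_.
have [||P [sP P1 HP]] := IH (rem i s).
- by rewrite srem prednK//; exact: ltnW.
- by apply: contra os; exact: mem_rem.
exists (((count_mem i s)%:R / (d.-1 + size s)%:R) *: ((1 - 'X^2) * P)); split.
- have h3 : (size (1 - 'X^2 : {poly R})%R <= 2.+1)%N.
    by rewrite size_polyB_le ?size_poly1 ?size_polyXn.
  apply: size_polyZ_le; apply: leq_trans (size_polyM_le h3 sP) _.
  by rewrite srem add2n !ltnS; case: (size s) ss.
- by rewrite hornerZ hornerM hornerD hornerN hornerXn hornerC expr1n subrr mul0r mulr0.
- move=> g; apply: (mulfI c0); rewrite SE_lower//.
  pose c : R := (count_mem i s)%:R.
  have -> : E (fun y => (g * (1 - 'X^2)).[tnth y o] * mon_deriv i s y) =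
      c * E (fun y => (g * (1 - 'X^2)).[tnth y o] * mon (rem i s) y).
    have [l' pg'] := pfun_axis o (g * (1 - 'X^2)).
    rewrite -(SEZ fin _ (pfun_bmfun (pfun_mul pg' (pfun_mon _)))).
    by apply: eq_SE => y _; rewrite /mon_deriv mulrCA.
  rewrite HP.
  have [l1 p1] := pfun_axis o (g * (1 - 'X^2) * P).
  have [l2 p2] := pfun_axis o (g * ((c / (d.-1 + size s)%:R) *: ((1 - 'X^2) * P))).
  rewrite -(SEZ fin _ (pfun_bmfun p1)) -(SEZ fin _ (pfun_bmfun p2)).
  apply: eq_SE => y _; rewrite !(hornerM, hornerZ).
  have alg (K a b w e : R) : K != 0 -> a * (b * w * e) = K * (b * (a / K * (w * e))).
    by move=> K0; field.
  exact: alg.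
Qed.

Lemma mon_basis s : mon s (basis o) = ([seq k <- s | predC1 o k] == [::])%:R :> R.
Proof.
elim: s => [|k s IH]; first by rewrite /mon big_nil.
rewrite mon_cons tnth_basis IH /=.
by have [->|ko] := eqVneq k o; rewrite ?mul1r ?mul0r.
Qed.

Lemma zonal_mon_gen s : exists P : {poly R},
  [/\ (size P <= (size s).+1)%N, P.[1] = mon s (basis o) &
      forall g, E (fun y => g.[tnth y o] * mon s y) = E (fun y => (g * P).[tnth y o])].
Proof.
pose t := [seq k <- s | predC1 o k]; pose c := count_mem o s.
have ot : o \notin t by rewrite mem_filter /= ?eqxx.
have st : (c + size t)%N = size s by rewrite size_filter; exact: count_predC.
have [P [sP P1 HP]] := zonal_mon ot.
exists ('X^c * P); split.
- have h : (size ('X^c : {poly R}) <= c.+1)%N by rewrite size_polyXn.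
  by apply: leq_trans (size_polyM_le h sP) _; rewrite st.
- by rewrite hornerM hornerXn expr1n mul1r P1 mon_basis.
- move=> g; rewrite mulrA -HP; apply: eq_SE => y _.
  rewrite hornerM hornerXn -mulrA; congr (_ * _).
  have -> : mon s y = tnth y o ^+ c * mon t y.
    rewrite /mon /t big_filter (bigID (pred1 o))/=; congr (_ * _).
    rewrite (eq_bigr (fun=> tnth y o)); last by move=> k /eqP->.
    by rewrite big_const_seq iter_mulr mulr1.
  by [].
Qed.

Lemma pfun_span l f : pfun l f -> exists L : seq (R * seq 'I_d.+1),
  all (fun p => size p.2 <= l)%N L /\ forall y, f y = \sum_(p <- L) p.1 * mon p.2 y.
Proof.
elim=> {l f}.
- by move=> c; exists [:: (c, [::])]; split=> // y; rewrite big_seq1 /mon big_nil mulr1.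
- by move=> i; exists [:: (1, [:: i])]; split=> // y; rewrite big_seq1 mon_cons /mon big_nil mulr1 mul1r.
- move=> l f g _ [L1 [a1 H1]] _ [L2 [a2 H2]]; exists (L1 ++ L2); rewrite all_cat a1 a2; split=> // y.
  by rewrite big_cat /= H1 H2.
- move=> l m f g _ [L1 [a1 H1]] _ [L2 [a2 H2]].
  exists [seq (p.1 * q.1, p.2 ++ q.2) | p <- L1, q <- L2]; split.
    apply/allP => _ /allpairsP[[p q] /= [pL qL ->]] /=.
    by rewrite size_cat leq_add// ?(allP a1 _ pL)// (allP a2 _ qL).
  move=> y; rewrite H1 H2 big_allpairs_dep /= mulr_suml; apply: eq_bigr => p _.
  rewrite mulr_sumr; apply: eq_bigr => q _; rewrite /mon big_cat /=; ring.
- move=> l m f lm _ [L [aL HL]]; exists L; split=> //.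
  by apply: sub_all aL => p /leq_trans; apply.
Qed.

(** P is the average of f over the parallels around the axis. Its value at t = 1 is the value of f
    at the pole, which reduces point evaluation on the sphere to evaluation at 1. *)
Lemma zonal_average_basis l f : pfun l f -> exists P : {poly R},
  [/\ (size P <= l.+1)%N, P.[1] = f (basis o) &
      forall g, E (fun y => g.[tnth y o] * f y) = E (fun y => (g * P).[tnth y o])].
Proof.
move=> /pfun_span[L [aL HL]].
have : exists P : {poly R}, [/\ (size P <= l.+1)%N, P.[1] = \sum_(p <- L) p.1 * mon p.2 (basis o) &
   forall g, E (fun y => g.[tnth y o] * \sum_(p <- L) p.1 * mon p.2 y) = E (fun y => (g * P).[tnth y o])].
  elim: L aL {HL} => [_|p L IH /= /andP[pl /IH[P [sP P1 HP]]]].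
    exists 0; split; rewrite ?size_poly0 ?horner0 ?big_nil// => g.
    by apply: eq_SE => y _; rewrite big_nil !mulr0 horner0.
  have [Q [sQ Q1 HQ]] := zonal_mon_gen p.2.
  exists (p.1 *: Q + P); split.
  - by rewrite size_polyD_le// size_polyZ_le// (leq_trans sQ).
  - by rewrite hornerD hornerZ big_cons Q1 P1.
  - move=> g; have [l1 p1] := pfun_axis o g.
    have pq : pfun (l1 + size p.2) (fun y => g.[tnth y o] * mon p.2 y) by apply: pfun_mul => //; exact: pfun_mon.
    have bs : bmfun (fun y => g.[tnth y o] * \sum_(p <- L) p.1 * mon p.2 y).
      apply: bmfunM; first exact: pfun_bmfun p1.
      by apply: bmfun_sum => q; apply: bmfunZ; exact: pfun_bmfun (pfun_mon _).
    have -> : E (fun y => g.[tnth y o] * \sum_(q <- p :: L) q.1 * mon q.2 y) =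
        p.1 * E (fun y => g.[tnth y o] * mon p.2 y) + E (fun y => g.[tnth y o] * \sum_(p <- L) p.1 * mon p.2 y).
      rewrite -(SEZ fin _ (pfun_bmfun pq)) -(SED fin (pfun_bmfun (pfun_scale _ pq)) bs).
      by apply: eq_SE => y _; rewrite big_cons; ring.
    have [l2 p2] := pfun_axis o (g * Q); have [l3 p3] := pfun_axis o (g * P).
    rewrite HP HQ -(SEZ fin _ (pfun_bmfun p2)) -(SED fin (pfun_bmfun (pfun_scale _ p2)) (pfun_bmfun p3)).
    by apply: eq_SE => y _; rewrite !(hornerM, hornerD, hornerZ); ring.
move=> [P [sP P1 HP]]; exists P; split=> //; first by rewrite HL.
by move=> g; rewrite -HP; apply: eq_SE => y _; rewrite HL.
Qed.

(** The rotation identities in the planes through the axis, applied to y_j times a power of the axis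
    coordinate and summed over j. This is the recursion that [Lam_deriv] gives for the Gegenbauer
    moments, so the two agree up to normalization. *)
Lemma SE_axis_moment a : d%:R * E (fun y => tnth y o ^+ a.+1) =
  a%:R * E (fun y => (1 - tnth y o ^+ 2) * tnth y o ^+ a.-1).
Proof.
pose s := nseq a o.
have monE y : mon s y = tnth y o ^+ a by rewrite /mon big_nseq iter_mulr mulr1.
have DoE y : mon_deriv o s y = a%:R * tnth y o ^+ a.-1.
  rewrite /mon_deriv count_nseq /= ?eqxx mul1n; congr (_ * _).
  case: a @s {monE} => [|a] /=; first by rewrite /mon big_nil.
  by rewrite ?eqxx /mon big_nseq iter_mulr mulr1.
pose F (j : 'I_d.+1) (y : @pt R d) := tnth y o ^+ a.+1 - tnth y j ^+ 2 * (a%:R * tnth y o ^+ a.-1).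
have po n : pfun (1 * n) (fun y : @pt R d => tnth y o ^+ n) by apply: pfun_exp; exact: pfun_coord.
have pF j : bmfun (F j).
  apply: bmfunB; first exact: pfun_bmfun (po _).
  apply: bmfunM; first by apply: (pfun_bmfun (pfun_exp 2 (pfun_coord j))).
  by apply: bmfunZ; exact: pfun_bmfun (po _).
have EF j : j != o -> E (F j) = 0.
  move=> jo; have oj : o != j by rewrite eq_sym.
  have pm := pfun_mon (R := R) (j :: s).
  have pD : pfun (1 + size (j :: s)) (fun y : @pt R d => 2 * (tnth y o * mon_deriv j (j :: s) y - tnth y j * mon_deriv o (j :: s) y)).
    apply: pfun_scale; apply: pfun_sub; apply: pfun_mul; try exact: pfun_coord;
    exact: (pfun_mon_deriv _ (_ :: _)).
  have := SE_rot_deriv oj Hmu pm pD (rot_deriv_mon _ oj).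
  have -> : (fun y : @pt R d => 2 * (tnth y o * mon_deriv j (j :: s) y - tnth y j * mon_deriv o (j :: s) y)) =
      (fun y => 2 * F j y).
    apply/funext => y; rewrite !mon_deriv_cons eqxx (negPf jo) DoE monE.
    rewrite mon_deriv_notin; first by rewrite /F exprS /=; ring.
    by rewrite mem_nseq negb_and jo orbT.
  rewrite (SEZ fin 2 (pF j)) => /eqP.
  by rewrite mulf_eq0 pnatr_eq0 /= => /eqP.
pose G (j : 'I_d.+1) := if j != o then F j else (fun=> 0).
have pG j : bmfun (G j) by rewrite /G; case: ifP => _ //; exact: bmfun_cst.
have : E (fun y => \sum_j G j y) = 0.
  rewrite (SE_sum fin)// big1// => j _; rewrite /G.
  by case: ifPn => [jo|_]; [exact: EF|exact: SE0].
have b1 := pfun_bmfun (po a.+1).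
have b2 : bmfun (fun y : @pt R d => (1 - tnth y o ^+ 2) * tnth y o ^+ a.-1).
  apply: bmfunM; last exact: pfun_bmfun (po _).
  by apply: bmfunB; [exact: bmfun_cst|exact: pfun_bmfun (po _)].
rewrite -(SEZ fin _ b1) -(SEZ fin _ b2) => E0; apply/eqP; rewrite -subr_eq0.
rewrite -(SEB fin (bmfunZ _ b1) (bmfunZ _ b2)) -[X in _ == X]E0; apply/eqP.
apply: eq_SE => y Sy.
have Gy j : G j y = if j != o then F j y else 0 by rewrite /G; case: ifP.
under eq_bigr do rewrite Gy; rewrite -big_mkcond /= /F sumrB sumr_const -mulr_suml.
have -> : \sum_(j | j != o) tnth y j ^+ 2 = 1 - tnth y o ^+ 2.
  by rewrite -(sphere_norm Sy) [X in _ = X - _](bigD1 o)//= [_ + \sum_(_ | _) _]addrC addrK.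
have -> : #|(fun j : 'I_d.+1 => j != o)| = d.
  rewrite (eq_card (B := predC (pred1 o))) => [|j]; last by [].
  have := cardC (pred1 o); rewrite card1 card_ord => /eqP.
  by rewrite add1n eqSS => /eqP.
by rewrite -mulr_natr; ring.
Qed.

Lemma SE_axis_Xn a : E (fun y => tnth y o ^+ a) * Lam d 1 = Lam d ('X^a).
Proof.
have d0 : d%:R != 0 :> R by rewrite pnatr_eq0 -lt0n (ltnW d2).
have po n : bmfun (fun y : @pt R d => tnth y o ^+ n).
  exact: (pfun_bmfun (pfun_exp n (pfun_coord o))).
elim/ltn_ind: a => [[|[|a]]] IH.
- by rewrite (SE_cst Hmu) mul1r expr0.
- apply: (mulfI d0); rewrite mulrA (SE_axis_moment 0) !mul0r.
  by have := @Lam_deriv R d 1%:P d2; rewrite derivC mulr0 Lam0// mulr1 expr1.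
have h := SE_axis_moment a.+1.
have E1 : E (fun y => (1 - tnth y o ^+ 2) * tnth y o ^+ a) =
    E (fun y => tnth y o ^+ a) - E (fun y => tnth y o ^+ a.+2).
  rewrite -(SEB fin (po _) (po _)); apply: eq_SE => y _.
  by rewrite mulrBl mul1r -exprD.
rewrite /= E1 in h.
have h2 : a.+1%:R * (Lam d 'X^a - Lam d 'X^(a.+2)) = d%:R * Lam d 'X^(a.+2) :> R.
  have := @Lam_deriv R d ('X^(a.+1)) d2; rewrite derivXn /= -exprS => <-.
  rewrite -LamB// -LamZ//; congr (Lam d _).
  by rewrite scaler_nat mulrnAr mulrBl mul1r -exprD add2n.
have IHa := IH a (leqnSn a.+1).
have nz : d%:R + a.+1%:R != 0 :> R by rewrite -natrD pnatr_eq0 addnS.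
apply: (mulfI nz).
have -> : (d%:R + a.+1%:R) * (E (fun y => tnth y o ^+ a.+2) * Lam d 1) =
   (d%:R * E (fun y => tnth y o ^+ a.+2) + a.+1%:R * E (fun y => tnth y o ^+ a.+2)) * Lam d 1 by ring.
rewrite h [RHS]mulrDl -h2 -IHa; ring.
Qed.

Lemma SE_axis Q : E (fun y => Q.[tnth y o]) = Lam d Q / Lam d 1.
Proof.
have L1 := Lam1_gt0 (R := R) d2.
have po n : bmfun (fun y : @pt R d => tnth y o ^+ n).
  exact: (pfun_bmfun (pfun_exp n (pfun_coord o))).
apply: (mulIf (lt0r_neq0 L1)); rewrite divfK ?gt_eqF//.
rewrite -[Q in RHS]coefK poly_def Lam_sum//.
have -> : E (fun y => Q.[tnth y o]) = E (fun y => \sum_(i <- index_enum 'I_(size Q)) Q`_i * tnth y o ^+ i).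
  by apply: eq_SE => y _; rewrite horner_coef.
rewrite (SE_sum fin) => [|i]; last exact: bmfunZ.
rewrite mulr_suml; apply: eq_bigr => i _.
by rewrite (SEZ fin _ (po _)) LamZ// -SE_axis_Xn mulrA.
Qed.

Lemma zonal_average x l f : S x -> pfun l f -> exists P : {poly R},
  [/\ (size P <= l.+1)%N, P.[1] = f x &
      forall g, E (fun y => g.[dot x y] * f y) = Lam d (g * P) / Lam d 1].
Proof.
move=> Sx hf.
have [xe|xe] := eqVneq x (basis o).
  have [P [sP P1 HP]] := zonal_average_basis hf; exists P; split=> //; first by rewrite xe.
  by move=> g; rewrite -SE_axis -HP; apply: eq_SE => y _; rewrite xe dot_basis.
(* The reflection along x minus the pole exchanges these two points and transports the result from
   the first axis to x. *)
pose v : @pt R d := [tuple tnth x k - tnth (basis o) k | k < d.+1].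
have vE y : dot v y = dot x y - tnth y o.
  rewrite -(dot_basis o) /dot -sumrB; apply: eq_bigr => k _; rewrite tnth_mktuple; ring.
have vv : dot v v = 2 * (1 - tnth x o).
  by rewrite vE [dot x v]dotC vE Sx tnth_mktuple tnth_basis eqxx /=; ring.
have v0 : dot v v != 0.
  apply: contra xe; rewrite vv mulf_eq0 pnatr_eq0 /= subr_eq0 => /eqP xo.
  apply/eqP/eq_from_tnth => k; rewrite tnth_basis.
  have [->|ko] := eqVneq k o; first by rewrite xo.
  have := sphere_norm Sx; rewrite (bigD1 o)//= -xo expr1n => /eqP.
  rewrite addrC -subr_eq0 addrK psumr_eq0 => [/allP/(_ k)|i _]; last exact: sqr_ge0.
  by rewrite mem_index_enum ko /= sqrf_eq0 => /(_ isT)/eqP.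
have rx : refl v x = basis o.
  apply: eq_from_tnth => k; rewrite tnth_refl.
  have vx : 2 / dot v v * dot v x = 1.
    by rewrite (vE x) Sx mulrAC -vv divff.
  by rewrite vx mul1r tnth_mktuple opprB addrC subrK.
have [P [sP P1 HP]] := zonal_average_basis (pfun_refl v hf); exists P; split=> //.
  by rewrite P1 -rx reflK.
move=> g; rewrite -SE_axis -HP.
have pg : pfun (size g + l) (fun y => g.[dot x y] * f y).
  by apply: pfun_mul => //; apply: pfun_zonal; exact: leqnSn.
rewrite -(SE_refl Hmu v0 pg); apply: eq_SE => y _; congr (g.[_] * _).
by rewrite -(dot_basis o) -rx -[in RHS](dot_refl (refl v x) y v0) reflK.
Qed.

End ZonalReduction.

(** * Reproducing kernel, Nikolskii inequality and dimension *)

Section Reproducing.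
Context {R : realType} {d : nat}.
Hypothesis d2 : (2 <= d)%N.
Context (p : nat -> {poly R}).
Hypothesis size_p : forall l, size (p l) = l.+1.
Hypothesis lead_p : forall l, 0 < lead_coef (p l).
Hypothesis orth_p : forall k l, Lam d (p k * p l) = (k == l)%:R.
Context (mu : {measure set (@pt R d) -> \bar R}).
Hypothesis Hmu : is_sphere_measure mu.
Implicit Types (f : @pt R d -> R) (x y z : @pt R d) (l m : nat) (Q : {poly R}).
Local Notation S := (@sphere R d).
Local Notation E := (SE mu).
Local Notation K := (Kone d p).
Local Notation Kp := (Kpoly d p).
Let fin := mu_sphere_fin Hmu.

Lemma reproducing x l m f : S x -> pfun l f -> (l < m)%N ->
  E (fun y => (Kp m).[dot x y] * f y) = f x.
Proof.
move=> Sx hf lm; have [P [sP <- ->]] := zonal_average d2 Hmu Sx hf.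
rewrite (Lam_Kpoly d2 size_p lead_p orth_p) ?(leq_trans sP)//.
by rewrite mulrAC divff ?mul1r// gt_eqF// Lam1_gt0.
Qed.

Lemma SE_zonal x Q : S x -> E (fun y => Q.[dot x y]) = Lam d Q / Lam d 1.
Proof.
move=> Sx; have [P [sP P1 HP]] := zonal_average d2 Hmu Sx (pfun_cst 1).
have PE : P = 1 by move: P1; rewrite (size1_polyC sP) hornerC => ->.
by have := HP Q; rewrite PE mulr1 => <-; apply: eq_SE => y _; rewrite mulr1.
Qed.

Lemma bmfun_zonal x Q : bmfun (fun y => Q.[dot x y]).
Proof. exact: pfun_bmfun (pfun_zonal x (leqnSn _)). Qed.

Lemma SE_Kpoly_sq x m : S x -> E (fun y => (Kp m).[dot x y] ^+ 2) = K m.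
Proof.
move=> Sx; transitivity (E (fun y => (Kp m ^+ 2).[dot x y])).
  by apply: eq_SE => y _; rewrite horner_exp.
rewrite SE_zonal// expr2 (Lam_Kpoly d2 size_p lead_p orth_p) ?size_Kpoly// Kpoly1.
by rewrite mulrAC divff ?mul1r// gt_eqF// Lam1_gt0.
Qed.

(** Expanding the mean square of K(z, .) - f gives K - 2c + c >= 0. It serves for f the reproducing
    kernel at z of a subspace, where both hypotheses hold with c = f(z). *)
Lemma bessel z m f c : S z -> bmfun f -> E (fun y => (Kp m).[dot z y] * f y) = c ->
  E (fun y => f y ^+ 2) = c -> c <= K m.
Proof.
move=> Sz bf E1 E2.
have bK := bmfun_zonal z (Kp m).
have bK2 : bmfun (fun y => (Kp m).[dot z y] ^+ 2) by apply: bmfunM.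
have bf2 : bmfun (fun y => f y ^+ 2) by apply: bmfunM.
have bKf : bmfun (fun y => (Kp m).[dot z y] * f y) by apply: bmfunM.
have : 0 <= E (fun y => ((Kp m).[dot z y] - f y) ^+ 2) by apply: SE_ge0 => y _; exact: sqr_ge0.
have -> : E (fun y => ((Kp m).[dot z y] - f y) ^+ 2) =
    E (fun y => (Kp m).[dot z y] ^+ 2 - 2 * ((Kp m).[dot z y] * f y) + f y ^+ 2).
  by apply: eq_SE => y _; ring.
rewrite (SED fin (bmfunB bK2 (bmfunZ 2 bKf)) bf2) (SEB fin bK2 (bmfunZ 2 bKf)) (SEZ fin 2 bKf).
by rewrite E1 E2 SE_Kpoly_sq// => h; lra.
Qed.

Lemma nikolskii z l m f : S z -> pfun l f -> (l < m)%N ->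
  f z ^+ 2 <= K m * E (fun y => f y ^+ 2).
Proof.
move=> Sz hf lm.
have K0 : 0 < K m by apply: Kone_gt0 => //; exact: leq_trans lm.
have bf := pfun_bmfun hf.
have bK := bmfun_zonal z (Kp m).
have bK2 : bmfun (fun y => (Kp m).[dot z y] ^+ 2) by apply: bmfunM.
have bf2 : bmfun (fun y => f y ^+ 2) by apply: bmfunM.
have bKf : bmfun (fun y => (Kp m).[dot z y] * f y) by apply: bmfunM.
pose c := f z / K m.
have : 0 <= E (fun y => (f y - c * (Kp m).[dot z y]) ^+ 2) by apply: SE_ge0 => y _; exact: sqr_ge0.
have -> : E (fun y => (f y - c * (Kp m).[dot z y]) ^+ 2) =
    E (fun y => f y ^+ 2 - (2 * c) * ((Kp m).[dot z y] * f y) + (c ^+ 2) * (Kp m).[dot z y] ^+ 2).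
  by apply: eq_SE => y _; ring.
rewrite (SED fin (bmfunB bf2 (bmfunZ _ bKf)) (bmfunZ _ bK2)) (SEB fin bf2 (bmfunZ _ bKf)).
rewrite !(SEZ fin) // SE_Kpoly_sq// (reproducing Sz hf lm).
have -> : E (fun y => f y ^+ 2) - 2 * c * f z + c ^+ 2 * K m = E (fun y => f y ^+ 2) - f z ^+ 2 / K m.
  by rewrite /c; field; rewrite gt_eqF.
by rewrite subr_ge0 ler_pdivrMr// mulrC.
Qed.

Section GramMatrix.
Context (D M : nat) (b : 'I_D -> @pt R d -> R).
Hypothesis pb : forall i, exists2 l, pfun l (b i) & (l < M)%N.
Hypothesis free_b : forall c : 'I_D -> R,
  (forall x, S x -> \sum_(i < D) c i * b i x = 0) -> forall i, c i = 0.

Let F (u : 'rV[R]_D) y := \sum_i u 0 i * b i y.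
Let G : 'M[R]_D := \matrix_(i, j) E (fun y => b i y * b j y).

Let bb i : bmfun (b i).
Proof. by have [l hl _] := pb i; exact: pfun_bmfun hl. Qed.

Let bF u : bmfun (F u).
Proof. by apply: bmfun_sum => i; exact: bmfunZ. Qed.

Let pF u : (0 < M)%N -> pfun M.-1 (F u).
Proof.
move=> M0; apply: pfun_sum => i; apply: pfun_scale.
by have [l hl lM] := pb i; apply: pfun_le hl; rewrite -ltnS prednK.
Qed.

Let FG u w : E (fun y => F u y * F w y) = (u *m G *m w^T) 0 0.
Proof.
have -> : E (fun y => F u y * F w y) =
    E (fun y => \sum_i \sum_j (u 0 i * w 0 j) * (b i y * b j y)).
  apply: eq_SE => y _; rewrite /F mulr_suml; apply: eq_bigr => i _.
  rewrite mulr_sumr; apply: eq_bigr => j _; ring.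
have bij i j : bmfun (fun y => b i y * b j y) by apply: bmfunM; exact: bb.
rewrite (SE_sum fin) => [|i]; last by apply: bmfun_sum => j; exact: bmfunZ.
rewrite mxE [RHS](eq_bigr (fun i => \sum_j u 0 j * w 0 i * G j i)); last first.
  by move=> i _; rewrite !mxE mulr_suml; apply: eq_bigr => j _; rewrite ?mxE; ring.
rewrite [RHS]exchange_big; apply: eq_bigr => i _.
rewrite (SE_sum fin) => [|j]; last exact: bmfunZ.
by apply: eq_bigr => j _; rewrite (SEZ fin _ (bij i j)) mxE.
Qed.

(** A null vector of the Gram matrix gives a function of zero mean square, which vanishes at every
    point of the sphere by the Nikolskii inequality; freeness then applies. *)
Let unitG : G \in unitmx.
Proof.
rewrite -row_free_unit -kermx_eq0; apply/eqP/row_matrixP => i; rewrite row0.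
set u := row i _.
have uG : u *m G = 0 by rewrite /u -row_mul mulmx_ker row0.
apply/rowP => j; rewrite [RHS]mxE.
have [l _ lM] := pb j; have M0 : (0 < M)%N by exact: leq_trans lM.
apply: (free_b (c := fun j => u 0 j)) => x Sx; apply/eqP.
rewrite -sqrf_eq0 eq_le sqr_ge0 andbT.
apply: le_trans (nikolskii (m := M) Sx (pF u M0) _) _; first by rewrite prednK.
rewrite (_ : E _ = 0) ?mulr0//.
transitivity (E (fun y => F u y * F u y)); first by apply: eq_SE => y _; rewrite expr2.
by rewrite FG uG mul0mx mxE.
Qed.

(* The diagonal [B x] of the reproducing kernel of the span of [b] has mean [D]. *)
Lemma gram_dim : D%:R <= K M.
Proof.
pose H := invmx G; pose bx x : 'rV[R]_D := \row_i b i x.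
have FE u x : F u x = (u *m (bx x)^T) 0 0.
  by rewrite mxE; apply: eq_bigr => i _; rewrite !mxE.
pose B x := \sum_i \sum_j H i j * (b i x * b j x).
have BE x : B x = F (bx x *m H) x.
  rewrite /B /F exchange_big; apply: eq_bigr => j _; rewrite mxE mulr_suml.
  by apply: eq_bigr => i _; rewrite mxE; ring.
(* For fixed x, [F (bx x *m H)] is the reproducing kernel of the span at x, so B x is both its value
   at x and its mean square. *)
have B_le x : S x -> B x <= K M.
  move=> Sx; rewrite BE; apply: (bessel Sx (bF (bx x *m H))).
    have [M0|M0] := posnP M; last by rewrite (reproducing Sx (pF _ M0)) ?prednK.
    have F0 y : F (bx x *m H) y = 0.
      by rewrite /F big1// => i _; have [l _] := pb i; rewrite M0.
    by rewrite F0 -[RHS](SE0 mu); apply: eq_SE => y _; rewrite F0 mulr0.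
  transitivity (E (fun y => F (bx x *m H) y * F (bx x *m H) y)).
    by apply: eq_SE => y _; rewrite expr2.
  rewrite FG -[bx x *m H *m G]mulmxA mulVmx// mulmx1 FE -[X in X *m _](trmxK (bx x)) -trmx_mul.
  by rewrite mxE.
have bij i j : bmfun (fun y => b i y * b j y) by apply: bmfunM; exact: bb.
have bB : bmfun B by do 2![apply: bmfun_sum => ?]; exact: bmfunZ.
have -> : D%:R = E B.
  rewrite -[D in LHS]card_ord -sumr_const (SE_sum fin) => [|i]; last first.
    by apply: bmfun_sum => ?; exact: bmfunZ.
  apply: eq_bigr => i _; rewrite (SE_sum fin) => [|j]; last exact: bmfunZ.
  have := congr1 (fun A : 'M[R]_D => A i i) (mulVmx unitG); rewrite !mxE eqxx => Hi; apply: etrans (esym Hi) _.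
  apply: eq_bigr => j _; rewrite (SEZ fin _ (bij i j)) mxE; congr (_ * _).
  by apply: eq_SE => y _; rewrite mulrC.
by rewrite -(SE_cst Hmu (K M)); apply: SE_le => //; exact: bmfun_cst.
Qed.

End GramMatrix.
End Reproducing.

(** * The spaces [Pi] as polynomial functions *)

Section PiPolynomialFunctions.
Context {R : realType} {d : nat}.
Implicit Types (f P : @pt R d -> R) (l : nat) (m : R).
Import (canonicals) mpoly.

Lemma pfun_prod (I : finType) (F : I -> @pt R d -> R) (e : I -> nat) :
  (forall i, pfun (e i) (F i)) -> pfun (\sum_i e i) (fun y => \prod_i F i y).
Proof.
move=> h; have H (s : seq I) : pfun (\sum_(i <- s) e i) (fun y => \prod_(i <- s) F i y).
  elim: s => [|i s IH].
    by rewrite big_nil; apply: (pfun_eq (pfun_cst 1)) => y; rewrite big_nil.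
  by rewrite big_cons; apply: (pfun_eq (pfun_mul (h i) IH)) => y; rewrite big_cons.
exact: H.
Qed.

Lemma Pi_pfun m P : 0 < m -> Pi d m P -> exists2 l, pfun l P & l%:R < m.
Proof.
move=> m0 [q [aq ->]].
have [M [HM _ _]] := natceil (ltW m0).
have M0 : (0 < M)%N by rewrite HM.
exists M.-1; last by rewrite -HM prednK.
apply: (@pfun_eq _ _ _ (fun y => \sum_(k <- mpoly.msupp q)
    mpoly.mcoeff k q * \prod_i tnth y i ^+ mpoly.fun_of_multinom k i)); last first.
  by move=> y; rewrite /poly_fun mpoly.mevalE.
elim: (mpoly.msupp q) aq => [|k s IH] /=.
  by move=> _; apply: (pfun_eq (pfun_cst_le _ 0)) => y; rewrite big_nil.
move=> /andP[km /IH h].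
have pk : pfun M.-1 (fun y => mpoly.mcoeff k q * \prod_i tnth y i ^+ mpoly.fun_of_multinom k i).
  apply: pfun_scale; apply: (@pfun_le _ _ (mpoly.mdeg k)).
    by rewrite -ltnS prednK// HM.
  rewrite mpoly.mdegE; apply: pfun_prod => i.
  by rewrite -[X in pfun X _]mul1n; apply: pfun_exp; exact: pfun_coord.
by apply: (pfun_eq (pfun_add pk h)) => y; rewrite big_cons.
Qed.

Lemma pfun_mpoly l f : pfun l f -> exists q : mpoly.mpoly d.+1 R,
  all (fun k => mpoly.mdeg k <= l)%N (mpoly.msupp q) /\ f = poly_fun q.
Proof.
elim=> {l f}.
- move=> c; exists (mpoly.mpolyC d.+1 c); split.
    by rewrite mpoly.msuppC; case: ifP => //= _; rewrite mpoly.mdeg0.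
  by apply/funext => y; rewrite /poly_fun mpoly.mevalC.
- move=> i; exists (mpoly.mpolyX R (mpoly.mnm1 i)); split.
    by rewrite mpoly.msuppX /= mpoly.mdeg1.
  by apply/funext => y; rewrite /poly_fun mpoly.mevalXU.
- move=> l f g _ [q1 [a1 ->]] _ [q2 [a2 ->]]; exists (q1 + q2); split.
    apply/allP => k /mpoly.msuppD_le; rewrite mem_cat => /orP[kq|kq].
      exact: (allP a1).
    exact: (allP a2).
  by apply/funext => y; rewrite /poly_fun mpoly.mevalD.
- move=> l m f g _ [q1 [a1 ->]] _ [q2 [a2 ->]]; exists (q1 * q2); split.
    apply/allP => k /mpoly.msuppM_le/allpairsP[[k1 k2] /= [h1 h2 ->]].
    by rewrite mpoly.mdegD leq_add// ?(allP a1 _ h1)// (allP a2 _ h2).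
  by apply/funext => y; rewrite /poly_fun mpoly.mevalM.
- move=> l m f lm _ [q [aq ->]]; exists q; split=> //.
  by apply: sub_all aq => k /leq_trans; apply.
Qed.

Lemma pfun_Pi m l f : pfun l f -> l%:R < m -> Pi d m f.
Proof.
move=> /pfun_mpoly[q [aq ->]] lm; exists q; split=> //.
by apply: sub_all aq => k kl; apply: le_lt_trans lm; rewrite ler_nat.
Qed.

End PiPolynomialFunctions.

(** * Jacobi weights and extremal polynomials *)

Section JacobiWeight.
Context {R : realType}.
Implicit Types (a b t : R) (Q : {poly R}).
Local Notation leb := (@lebesgue_measure R).

Lemma I11P t : I11 t = (-1 <= t <= 1) :> Prop.
Proof. by rewrite /I11 /= in_itv. Qed.

Lemma poly_bounded Q t : -1 <= t <= 1 -> `|Q.[t]| <= \sum_(i < size Q) `|Q`_i|.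
Proof.
move=> ht; rewrite horner_coef; apply: le_trans (ler_norm_sum _ _ _) _.
apply: ler_sum => i _; rewrite normrM normrX -[leRHS]mulr1 ler_wpM2l//.
by rewrite exprn_ile1// ler_norml.
Qed.

Definition jweight a b t := (1 - t) `^ a * (1 + t) `^ b.

Lemma jweight_ge0 a b t : 0 <= jweight a b t.
Proof. by rewrite mulr_ge0// powR_ge0. Qed.

Lemma measurable_jweight a b : measurable_fun [set: R] (jweight a b).
Proof.
apply: measurable_funM.
  apply: (measurableT_comp (f := fun x : R => x `^ a)) => //.
  by apply: measurable_funB => //; exact: measurable_cst.
apply: (measurableT_comp (f := fun x : R => x `^ b)) => //.
by apply: measurable_funD => //; exact: measurable_cst.
Qed.

(** Normalization of the constant [q 0] already says that the weight has a finite integral. This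
    covers b = -1/2, which occurs for d = 3, where the weight is unbounded at -1. *)
Lemma jweight_integrable a b q : is_jacobi a b q ->
  leb.-integrable I11 (EFin \o jweight a b).
Proof.
move=> [H1 H2]; have [sq _] := H1 0%N; have := H2 0%N 0%N; rewrite eqxx.
have -> : [set t : R | -1 <= t <= 1] = I11 by apply/seteqP; split => t; rewrite I11P.
have [c c0 ->] : exists2 c, c != 0 & q 0%N = c%:P.
  by apply/size_poly1P; rewrite sq.
move=> E.
have mE (k : R) : measurable_fun I11 (fun t => k * jweight a b t).
  apply: measurable_funM; first exact: measurable_cst.
  exact: measurable_funS (measurable_jweight a b).
have fi : leb.-integrable I11 (EFin \o (fun t => c ^+ 2 * jweight a b t)).
  apply/integrableP; split; first by apply/measurable_EFinP; exact: mE.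
  apply: (@le_lt_trans _ _ (true%:R)%:E); last exact: ltry.
  rewrite -E le_eqVlt; apply/orP; left; apply/eqP; apply: eq_integral => t _; rewrite /= ger0_norm; last by rewrite mulr_ge0 ?sqr_ge0 ?jweight_ge0.
  by rewrite !hornerC /jweight; congr (_%:E); ring.
have c2 : c ^+ 2 != 0 by rewrite sqrf_eq0.
apply: eq_integrable (integrableZl _ (c ^- 2) fi); try exact: measurable_I11.
by move=> t _; rewrite /= -EFinM mulrA mulVf ?mul1r.
Qed.

Lemma jweight_pred a b t : 0 < a -> -1 <= t <= 1 -> jweight (a - 1) b t * (1 - t) = jweight a b t.
Proof.
move=> a0 ht; rewrite /jweight mulrAC [X in X * _]mulrC mulr_powRB1//.
by case/andP: ht; lra.
Qed.

(** Dividing by 1 - t costs nothing for t < 0, and for t >= 0 the quotient is bounded because a >=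
    1. *)
Lemma jweight_pred_integrable a b : 1 <= a ->
  leb.-integrable I11 (EFin \o jweight a b) ->
  leb.-integrable I11 (EFin \o jweight (a - 1) b).
Proof.
move=> a1 ji; pose c : R := 2 `^ (a - 1) * 2 `^ `|b|.
have c0 : 0 <= c by rewrite mulr_ge0 ?powR_ge0.
have ci : leb.-integrable I11 (EFin \o (fun=> c)).
  by apply: continuous_I11_integrable => t; exact: cvg_cst.
have h (t : R) : -1 <= t <= 1 -> jweight (a - 1) b t <= jweight a b t + c.
  move=> ht; have /andP[t1 t2] := ht.
  have [t0|t0] := ltP t 0.
    apply: ler_wpDr => //; rewrite -(jweight_pred _ (lt_le_trans ltr01 a1) ht).
    by rewrite ler_peMr ?jweight_ge0//; lra.
  apply: ler_wpDl; first exact: jweight_ge0.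
  apply: ler_pM; rewrite ?powR_ge0//.
    by apply: ge0_ler_powR; rewrite ?nnegrE; lra.
  apply: (@le_trans _ _ ((1 + t) `^ `|b|)).
    by apply: ler_powR; [lra|exact: ler_norm].
  by apply: ge0_ler_powR; rewrite ?nnegrE//; lra.
apply: le_integrable (integrableD _ ji ci) => //; try exact: measurable_I11.
- by apply/measurable_EFinP; exact: measurable_funS (measurable_jweight _ b).
- move=> t; rewrite I11P => /h; rewrite /= lee_fin => h'.
  by rewrite !ger0_norm ?addr_ge0 ?jweight_ge0.
Qed.

Definition Jint a b Q : R := \int[leb]_(t in I11) (Q.[t] * jweight a b t).

Context (a b : R).
Hypothesis ji : leb.-integrable I11 (EFin \o jweight a b).

Lemma integrable_Jint Q : leb.-integrable I11 (EFin \o (fun t => Q.[t] * jweight a b t)).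
Proof.
apply: (integrableMr _ _ _ ji); first exact: measurable_I11.
- have cQ : continuous (fun t : R => Q.[t]) by move=> t; exact: continuous_horner.
  by apply: measurable_funS (continuous_measurable_fun cQ).
- exists (\sum_(i < size Q) `|Q`_i|); split; first exact: num_real.
  move=> M hM t; rewrite I11P => ht; exact: le_trans (poly_bounded _ ht) (ltW hM).
Qed.

Lemma JintD Q1 Q2 : Jint a b (Q1 + Q2) = Jint a b Q1 + Jint a b Q2.
Proof.
rewrite /Jint -RintegralD//; try exact: integrable_Jint; last exact: measurable_I11.
by apply: eq_Rintegral => t _; rewrite hornerD mulrDl.
Qed.

Lemma JintZ c Q : Jint a b (c *: Q) = c * Jint a b Q.
Proof.
rewrite /Jint -RintegralZl//; try exact: integrable_Jint; last exact: measurable_I11.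
by apply: eq_Rintegral => t _; rewrite hornerZ -mulrA.
Qed.

Lemma Jint_ge0 Q : (forall t, -1 <= t <= 1 -> 0 <= Q.[t]) -> 0 <= Jint a b Q.
Proof.
move=> Q0; apply: Rintegral_ge0 => t; rewrite I11P => ht.
by rewrite mulr_ge0 ?jweight_ge0 ?Q0.
Qed.

End JacobiWeight.

(** * Comparison of the Jacobi and Gegenbauer weights *)

Section WeightComparison.
Context {R : realType} (d : nat) (r : R).
Hypothesis d3 : (3 <= d)%N.
Hypothesis r0 : 0 < r.
Implicit Types (t h c : R) (A B P Q : {poly R}).
Local Notation leb := (@lebesgue_measure R).
Local Notation a := (d%:R / 2 + r).
Local Notation b := (d%:R / 2 - 2).
Local Notation V := (Jint (a - 1) b).
Hypothesis ji : leb.-integrable I11 (EFin \o jweight (a - 1) b).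

Let d2 : (2 <= d)%N. Proof. exact: ltnW. Qed.
Let dR : 3 <= d%:R :> R. Proof. by rewrite (ler_nat R 3). Qed.

(** Here [jweight (a - 1) b] is w/u for the Jacobi weight w. It lacks one factor 1+t to be u^r times
    the Gegenbauer weight; hence the factors [1 + 'X] in the comparisons. *)
Lemma jweight_gweight t : -1 <= t <= 1 ->
  (1 + t) * jweight (a - 1) b t = (1 - t) `^ r * gweight (d%:R / 2 - 1) t.
Proof.
move=> ht; have /andP[t1 t2] := ht; have d3R := dR; have r0' := r0.
rewrite gweightE// /jweight.
have -> : a - 1 = r + (d%:R / 2 - 1) :> R by ring.
rewrite powRD; last by apply/implyP => /eqP; lra.
have -> : b = d%:R / 2 - 1 - 1 :> R by ring.
by rewrite -(@mulr_powRB1 _ (1 + t) (d%:R / 2 - 1)); [ring|lra|lra].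
Qed.

Lemma horner_1X A t : ((1 + 'X) * A).[t] = (1 + t) * A.[t].
Proof. by rewrite hornerM hornerD hornerX hornerC. Qed.

Lemma jweight_horner A t : -1 <= t <= 1 ->
  ((1 + 'X) * A).[t] * jweight (a - 1) b t = A.[t] * (1 - t) `^ r * gweight (d%:R / 2 - 1) t.
Proof. by move=> ht; rewrite horner_1X -mulrA -jweight_gweight//; ring. Qed.

Lemma Jint_le_Lam A B c :
  (forall t, -1 <= t <= 1 -> A.[t] * (1 - t) `^ r <= c * B.[t]) ->
  V ((1 + 'X) * A) <= c * Lam d B.
Proof.
move=> h; rewrite -LamZ//; apply: le_Rintegral; first exact: measurable_I11.
- exact: integrable_Jint.
- exact: integrable_Lam.
- move=> t; rewrite I11P => ht.
  by rewrite jweight_horner// ler_wpM2r ?gweight_ge0// hornerZ h.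
Qed.

Lemma Lam_le_Jint A B c :
  (forall t, -1 <= t <= 1 -> A.[t] <= c * (B.[t] * (1 - t) `^ r)) ->
  Lam d A <= c * V ((1 + 'X) * B).
Proof.
move=> h; rewrite -JintZ// scalerAr; apply: le_Rintegral; first exact: measurable_I11.
- exact: integrable_Lam.
- exact: integrable_Jint.
- move=> t; rewrite I11P => ht.
  by rewrite jweight_horner// ler_wpM2r ?gweight_ge0// hornerZ -mulrA h.
Qed.

(* Near [t = 1] the weight [(1 - t^2)^(d/2-1)] is at most [(2h)^(d/2-1)], elsewhere [1 <= h^(-r) (1-t)^r]. *)
Lemma Lam_sqr_split P h M : 0 < h <= 1 -> (forall t, -1 <= t <= 1 -> P.[t] ^+ 2 <= M) ->
  Lam d (P ^+ 2) <= h `^ (- r) * V ((1 + 'X) * P ^+ 2) + M * (2 * h) `^ (d%:R / 2 - 1) * h.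
Proof.
move=> /andP[h0 h1] HM; have d3R := dR.
pose e : R := d%:R / 2 - 1; pose I := [set` `[1 - h, 1]] : set R.
have mI : measurable I by exact: measurable_itv.
have M0 : 0 <= M by apply: le_trans (sqr_ge0 _) (HM 1 _); lra.
pose f t := (h `^ (- r) *: ((1 + 'X) * P ^+ 2)).[t] * jweight (a - 1) b t.
pose g t := M * (2 * h) `^ e * \1_I t.
have fi : leb.-integrable I11 (EFin \o f) by exact: integrable_Jint.
have I11fin : (leb (I11 : set R) < +oo)%E.
  by rewrite /I11 lebesgue_measure_itv /= lte_fin gtrN ?ltr01// -EFinB ltry.
have lebI : leb I = h%:E.
  by rewrite /I lebesgue_measure_itv /= lte_fin gtrBl h0 -EFinB; congr EFin; ring.
have gi0 : leb.-integrable I11 (EFin \o (\1_I : R -> R)).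
  apply: measurable_bounded_integrable; first exact: measurable_I11.
  - exact: I11fin.
  - exact: measurable_indic.
  - exists 1; split=> // x x1 t _; rewrite /= indicE ger0_norm ?ler0n//.
    by apply: le_trans (ltW x1); rewrite lern1 leq_b1.
have gi : leb.-integrable I11 (EFin \o g).
  apply: eq_integrable (integrableZl _ (M * (2 * h) `^ e) gi0); try exact: measurable_I11.
  by move=> t _; rewrite /g /= EFinM.
have Eg : \int[leb]_(t in I11) g t = M * (2 * h) `^ e * h.
  rewrite /g RintegralZl//; last exact: measurable_I11.
  congr (_ * _); rewrite /Rintegral integral_indic//; last exact: measurable_I11.
  have -> : I `&` I11 = I.
    apply/setIidPl => t; rewrite I11P /I /= in_itv /=; lra.
  by rewrite [X in fine X]lebI.
rewrite -/e -Eg -JintZ// -RintegralD//; last exact: measurable_I11.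
apply: le_Rintegral; first exact: measurable_I11.
- exact: integrable_Lam.
- by apply: eq_integrable (integrableD _ fi gi); try exact: measurable_I11.
move=> t; rewrite I11P => ht; rewrite /f /g hornerZ -mulrA jweight_horner// indicE.
have /andP[t1 t2] := ht; have w0 := gweight_ge0 e t.
have [th|th] := leP (1 - h) t.
  rewrite mem_set; last by rewrite /I /= in_itv /= th.
  rewrite mulr1; apply: ler_wpDl.
    by rewrite !mulr_ge0 ?powR_ge0// horner_exp sqr_ge0.
  rewrite horner_exp; apply: ler_pM; rewrite ?sqr_ge0 ?HM//.
  rewrite gweightE// -powRM; [|lra|lra].
  by apply: ge0_ler_powR; rewrite ?nnegrE /e; [lra|nra|lra|nra].
rewrite memNset; last by rewrite /I /= in_itv /= => /andP[]; lra.
rewrite mulr0 addr0 [X in _ <= _ * (X * _)]mulrC -mulrA mulrCA mulrA; apply: ler_peMl.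
  by rewrite mulr_ge0// horner_exp sqr_ge0.
have h2 : h `^ r <= (1 - t) `^ r.
  by apply: ge0_ler_powR; rewrite ?nnegrE; have r0' := r0; lra.
by rewrite powRN ler_pdivlMr ?mul1r// powR_gt0.
Qed.

End WeightComparison.

(** A crude bound: the Remez step can absorb any fixed d-th power. *)
Lemma Lam1_ge (R : realType) d : (2 <= d)%N -> 2^-1 ^+ d <= Lam d 1 :> R.
Proof.
elim/ltn_ind: d => [[|[|[|[|d]]]]]//= IH _.
- by rewrite Lam2_1; lra.
- by rewrite Lam3_1; have := pi_ge2 R; lra.
have h := IH d.+2 (leqnSn _) isT.
rewrite Lam1_recursion// 2!exprS mulrA; apply: ler_pM => //; rewrite ?exprn_ge0//; try lra.
by rewrite ler_pdivlMr ?ltr0n// -(natr1 d.+2) -(natr1 d.+1) -(natr1 d); have := ler0n R d; lra.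
Qed.

(** * Extremal property of Jacobi polynomials at 1 *)

Section JacobiExtremal.
Context {R : realType} (a b : R) (q : nat -> {poly R}).
Hypothesis a1 : 1 <= a.
Hypothesis Hq : is_jacobi a b q.
Implicit Types (t : R) (Q : {poly R}) (k l : nat).
Local Notation V := (Jint (a - 1) b).
Let ji := jweight_pred_integrable a1 (jweight_integrable Hq).
Let size_q l : size (q l) = l.+1. Proof. by have [] := Hq.1 l. Qed.
Let lead_q l : 0 < lead_coef (q l). Proof. by have [] := Hq.1 l. Qed.

Lemma Jint0 : V 0 = 0.
Proof. by rewrite -(scale0r (0 : {poly R})) (JintZ ji) mul0r. Qed.

Lemma Jint_orthonormal k l : V ((1 - 'X) * (q k * q l)) = (k == l)%:R.
Proof.
have := congr1 fine (Hq.2 k l); rewrite /= => <-.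
have -> : [set t : R | -1 <= t <= 1] = I11 by apply/seteqP; split => t; rewrite I11P.
rewrite /Jint /Rintegral; congr fine; apply: eq_integral => t; rewrite inE I11P => ht.
rewrite !hornerM hornerD hornerN hornerX hornerC; congr EFin.
transitivity ((q k).[t] * (q l).[t] * (jweight (a - 1) b t * (1 - t))); first by ring.
by rewrite jweight_pred ?(lt_le_trans ltr01)// /jweight; ring.
Qed.

Lemma Jint_orth_lower k Q : (size Q <= k)%N -> V ((1 - 'X) * (q k * Q)) = 0.
Proof.
move=> /(orth_span size_q lead_q)[c ->].
rewrite !mulr_sumr (big_morph _ (JintD ji) Jint0) big1// => j _.
by rewrite -!scalerAr (JintZ ji) Jint_orthonormal gtn_eqF ?mulr0.
Qed.

(** If q_k = (X-1) h, then V(q_k^2) = 0 by orthogonality to h, so V((1+X) q_k^2) = 2 V(q_k^2) -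
    V((1-X) q_k^2) = -1, although its integrand is nonnegative. *)
Lemma jacobi_at1_neq0 k : (q k).[1] != 0.
Proof.
apply/negP => /factor_theorem[h Eh].
have h0 : h != 0.
  by apply/negP => /eqP h0; have := size_q k; rewrite Eh h0 mul0r size_poly0.
have sh : (size h <= k)%N.
  by have := size_q k; rewrite Eh size_Mmonic ?monicXsubC// size_XsubC addn2 => -[->].
have V0 : V (q k * q k) = 0.
  have -> : q k * q k = (-1) *: ((1 - 'X) * (q k * h)).
    by rewrite Eh scaleN1r; ring.
  by rewrite (JintZ ji) Jint_orth_lower// mulr0.
have : 0 <= V (2 *: (q k * q k) + (-1) *: ((1 - 'X) * (q k * q k))).
  apply: Jint_ge0 => t ht.
  rewrite !(hornerD, hornerN, hornerM, hornerZ, hornerX, hornerC).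
  by have /andP[t1 t2] := ht; have := sqr_ge0 (q k).[t]; nra.
rewrite (JintD ji) !(JintZ ji) V0 Jint_orthonormal eqxx /=; lra.
Qed.

Definition jacobi_normalized k : {poly R} := (q k).[1]^-1 *: q k.

(** Pythagoras: Q - P is divisible by X - 1, so its product with P under w/u becomes an
    orthogonality relation of q_k under w. *)
Lemma jacobi_extremal k Q : (size Q <= k.+1)%N -> Q.[1] = 1 ->
  V (jacobi_normalized k ^+ 2) <= V (Q ^+ 2).
Proof.
move=> sQ Q1; set P := jacobi_normalized k.
have /factor_theorem[h Eh] : root (Q - P) 1.
  rewrite /root hornerD hornerN Q1 /P hornerZ mulVf ?subrr//; exact: jacobi_at1_neq0.
have sh : (size h <= k)%N.
  have [->|h0] := eqVneq h 0; first by rewrite size_poly0.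
  have : (size (Q - P)%R <= k.+1)%N by rewrite size_polyB_le// size_polyZ_le// size_q.
  by rewrite Eh size_Mmonic ?monicXsubC// size_XsubC addn2.
have -> : Q ^+ 2 = P ^+ 2 + (-2 * (q k).[1]^-1) *: ((1 - 'X) * (q k * h)) + (Q - P) ^+ 2.
  have -> : (-2 * (q k).[1]^-1) *: ((1 - 'X) * (q k * h)) = 2 *: (P * (Q - P)).
    rewrite Eh /P /jacobi_normalized -!mul_polyC polyCM polyCN; ring.
  rewrite scaler_nat; ring.
rewrite !(JintD ji) (JintZ ji) Jint_orth_lower// mulr0 addr0 lerDl.
by apply: Jint_ge0 => t _; rewrite horner_exp sqr_ge0.
Qed.

End JacobiExtremal.

Section ZonalNikolskii.
Context {R : realType} {d : nat}.
Hypothesis d2 : (2 <= d)%N.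
Context (p : nat -> {poly R}).
Hypothesis size_p : forall l, size (p l) = l.+1.
Hypothesis lead_p : forall l, 0 < lead_coef (p l).
Hypothesis orth_p : forall k l, Lam d (p k * p l) = (k == l)%:R.
Context (mu : {measure set (@pt R d) -> \bar R}).
Hypothesis Hmu : is_sphere_measure mu.

Lemma sphere_latitude (t : R) : -1 <= t <= 1 ->
  exists2 z : @pt R d, sphere d z & dot (basis ord0) z = t.
Proof.
move=> ht.
exists [tuple if i == ord0 then t else if i == ord_max then Num.sqrt (1 - t ^+ 2) else 0 | i < d.+1];
  last by rewrite dot_basis tnth_mktuple.
have m0 : ord_max != ord0 :> 'I_d.+1 by rewrite -val_eqE /= -lt0n; exact: ltnW.
rewrite /sphere /= /dot (bigD1 ord0)//= (bigD1 ord_max)//= !tnth_mktuple eqxx (negPf m0) eqxx.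
rewrite big1 => [|i /andP[i0 im]]; last by rewrite tnth_mktuple (negPf i0) (negPf im) mul0r.
by rewrite -[_ * Num.sqrt _]expr2 sqr_sqrtr; [ring|nra].
Qed.

Lemma zonal_nikolskii (Q : {poly R}) m t : (0 < m)%N -> (size Q <= m)%N -> -1 <= t <= 1 ->
  Q.[t] ^+ 2 <= Kone d p m * (Lam d (Q ^+ 2) / Lam d 1).
Proof.
move=> m0 sQ /sphere_latitude[z Sz <-].
have Sb : sphere d (basis ord0 : @pt R d) by rewrite /sphere /= dot_basis tnth_basis eqxx.
have pQ : pfun m.-1 (fun y : @pt R d => Q.[dot (basis ord0) y]) by apply: pfun_zonal; rewrite prednK.
apply: le_trans (nikolskii (m := m) d2 size_p lead_p orth_p Hmu Sz pQ _) _; first by rewrite prednK.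
rewrite -(SE_zonal d2 Hmu _ Sb) ler_wpM2l//; first exact: Kone_ge0.
by rewrite le_eqVlt; apply/orP; left; apply/eqP/eq_SE => y _; rewrite horner_exp.
Qed.

End ZonalNikolskii.

(** * Weighted mean squares of the normalized Jacobi polynomial *)

Section JacobiBound.
Context {R : realType} (r : R).
Hypothesis r0 : 0 < r.
Context (i0 : nat).
Hypothesis i0_gt0 : (0 < i0)%N.
Hypothesis r_lt : r < (2 * i0)%:R.

Definition dyadic_poly e I : {poly R} :=
  \sum_(i < I.+1) dyadic_weight r i *: (1 - fejer (2 ^ i)) ^+ e.

Lemma dyadic_polyE e I t : (dyadic_poly e I).[t] = dyadic r e I t.
Proof.
rewrite /dyadic_poly horner_sum; apply: eq_bigr => i _.
by rewrite hornerZ horner_exp hornerD hornerN hornerC.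
Qed.

(** As the Fejer factor F lies in [0, 1] and 2 i0 > r, the left side is at most (F u)^r, while F u
    <= 2/N^2. *)
Lemma fejer_power_bound N t : (0 < N)%N -> -1 <= t <= 1 ->
  (fejer N).[t] ^+ (2 * i0) * (1 - t) `^ r <= (2 / N%:R ^+ 2) `^ r.
Proof.
move=> N0 ht; have [F0 F1 F2 _] := fejer_bounds N0 ht.
have N2 : 0 < N%:R ^+ 2 :> R by rewrite exprn_gt0// ltr0n.
have /andP[t1 t2] := ht.
have u0 : 0 <= 1 - t by lra.
apply: (@le_trans _ _ ((fejer N).[t] `^ r * (1 - t) `^ r)).
  apply: ler_wpM2r; first exact: powR_ge0.
  have [F00|Fn] := eqVneq (fejer N).[t] 0; first by rewrite F00 expr0n muln_eq0 (gtn_eqF i0_gt0) powR0// gt_eqF.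
  have Fp : 0 < (fejer N).[t] by rewrite lt_def Fn.
  rewrite -powR_mulrn//; apply: ger_powR; first by rewrite Fp.
  exact: (ltW r_lt).
rewrite -powRM//; apply: ge0_ler_powR; rewrite ?nnegrE.
- exact: ltW.
- exact: mulr_ge0.
- by rewrite divr_ge0// ltW.
- by rewrite ler_pdivlMr//; apply: le_trans F2; rewrite le_eqVlt; apply/orP; left; apply/eqP; ring.
Qed.


Context (d : nat).
Hypothesis d3 : (3 <= d)%N.
Context (mu : {measure set (@pt R d) -> \bar R}).
Hypothesis Hmu : is_sphere_measure mu.
Context (J1 J2 : nat -> {poly R}).
Hypothesis HJ1 : is_jacobi (d%:R / 2 - 1) (d%:R / 2 - 1) J1.
Hypothesis HJ2 : is_jacobi (d%:R / 2 + r) (d%:R / 2 - 2) J2.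
Context (n : R) (k : nat).
Hypothesis dn : d%:R <= n.
Hypothesis dnk : d%:R * n = k%:R.
Local Notation a := (d%:R / 2 + r).
Local Notation b := (d%:R / 2 - 2).
Local Notation V := (Jint (a - 1) b).
Local Notation K := (Kone d J1).
Local Notation Pt := (jacobi_normalized J2 k).
Local Notation m := (k - Num.truncn n)%N.

Let d2 : (2 <= d)%N. Proof. exact: ltnW. Qed.
Let dR : 3 <= d%:R :> R. Proof. by rewrite (ler_nat R 3). Qed.
Let a1 : 1 <= a. Proof. by have := r0; have := dR; lra. Qed.
Let ji := jweight_pred_integrable a1 (jweight_integrable HJ2).
Let size1 := let: And3 h _ _ := is_jacobi_Lam HJ1 in h.
Let lead1 := let: And3 _ h _ := is_jacobi_Lam HJ1 in h.
Let orth1 := let: And3 _ _ h := is_jacobi_Lam HJ1 in h.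

(** The competitor uses a kernel of degree below m = k - floor n, leaving a degree of about n for
    the damping factor. *)
Lemma kernel_degree_bounds : [/\ (0 < m)%N, (d%:R - 1) * n <= m%:R & (m <= k)%N].
Proof.
have n3 : 3 <= n by apply: le_trans dn.
have h : (Num.truncn n)%:R <= n by rewrite truncn_le//; lra.
have tk : (Num.truncn n <= k)%N by rewrite -(ler_nat R) -dnk; have := dR; nra.
have hm : (d%:R - 1) * n <= m%:R by rewrite natrB// -dnk; lra.
split=> //; last exact: leq_subr.
by rewrite -(ltr_nat R); apply: lt_le_trans hm; have := dR; nra.
Qed.

Lemma jacobi_normalized_bound I : (i0 * 2 ^ I)%:R <= n ->
  V (Pt ^+ 2) <= (2 / (2 ^ I)%:R ^+ 2) `^ r * (Lam d 1 / K m).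
Proof.
move=> hI; have [m0 mn mk] := kernel_degree_bounds.
have K0 := Kone_gt0 d2 size1 lead1 orth1 m0.
pose F := fejer (R := R) (2 ^ I).
(* The normalized kernel gives the small mean square 1/K(1) and the Fejer power absorbs u^r. The
   extra [half_plus], also 1 at t = 1, supplies the factor 1+t that turns V into [Lam]. *)
pose Q1 := (K m)^-1 *: (Kpoly d J1 m * F ^+ i0).
have N0 : (0 < 2 ^ I)%N by rewrite expn_gt0.
have n3 : 3 <= n by apply: le_trans dn.
have sQ1 : (size (half_plus * Q1)%R <= k.+1)%N.
  have s1 : (size (half_plus (R := R)) <= 1.+1)%N.
    by rewrite size_polyZ_le// size_polyD_le ?size_poly1// size_polyX.
  have s2 : (size (Kpoly d J1 m) <= m.-1.+1)%N by rewrite prednK// size_Kpoly.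
  have s3 : (size F <= (2 ^ I).-1.+1)%N by rewrite prednK// size_fejer.
  apply: leq_trans (size_polyM_le s1 (size_polyZ_le _ (size_polyM_le s2 (size_polyX_le i0 s3)))) _.
  have hi : (i0 * 2 ^ I <= Num.truncn n)%N by rewrite truncn_ge_nat//; lra.
  have i0p := i0_gt0.
  have hI1 : (i0 * (2 ^ I).-1 + i0 = i0 * 2 ^ I)%N by rewrite addnC -mulnS prednK.
  rewrite [((2 ^ I).-1 * i0)%N]mulnC; move: hi hI1 m0 mk i0p.
  move: (i0 * (2 ^ I).-1)%N (i0 * 2 ^ I)%N => x z; clear; lia.
have Q11 : (half_plus * Q1).[1] = 1.
  rewrite hornerM half_plusE /Q1 hornerZ hornerM horner_exp Kpoly1 fejer1// expr1n mulr1.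
  rewrite mulVf ?gt_eqF//; lra.
apply: le_trans (jacobi_extremal a1 HJ2 sQ1 Q11) _.
have -> : (half_plus * Q1) ^+ 2 = (1 + 'X) * (4^-1 *: ((1 + 'X) * Q1 ^+ 2)).
  have -> : 4^-1 = 2^-1 * 2^-1 :> R by field.
  move: Q1 {sQ1 Q11} => Q1; rewrite /half_plus -!mul_polyC polyCM; ring.
have -> : (2 / (2 ^ I)%:R ^+ 2) `^ r * (Lam d 1 / K m) =
    ((2 / (2 ^ I)%:R ^+ 2) `^ r * (K m) ^- 2) * Lam d (Kpoly d J1 m ^+ 2).
  rewrite expr2 (Lam_Kpoly d2 size1 lead1 orth1) ?size_Kpoly// Kpoly1.
  by field; rewrite gt_eqF.
apply: Jint_le_Lam => // t ht; have /andP[t1 t2] := ht.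
have := fejer_power_bound N0 ht; rewrite -/F exprM => hF.
have -> : (4^-1 *: ((1 + 'X) * Q1 ^+ 2)).[t] * (1 - t) `^ r =
    (1 + t) / 4 * (K m ^- 2 * (Kpoly d J1 m).[t] ^+ 2 * ((F.[t] ^+ 2) ^+ i0 * (1 - t) `^ r)).
  rewrite /Q1 !(hornerZ, hornerM, horner_exp, hornerD, hornerX, hornerC) -exprM mulnC exprM.
  by field; rewrite gt_eqF.
rewrite horner_exp; apply: (@le_trans _ _ (K m ^- 2 * (Kpoly d J1 m).[t] ^+ 2 *
  ((F.[t] ^+ 2) ^+ i0 * (1 - t) `^ r))).
  apply: ler_piMl; last lra.
  apply: mulr_ge0; first by apply: mulr_ge0; rewrite ?invr_ge0 sqr_ge0.
  by apply: mulr_ge0; [apply: exprn_ge0; exact: sqr_ge0|exact: powR_ge0].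
rewrite -[leRHS]mulrA [leRHS]mulrC; apply: ler_wpM2l => //.
by apply: mulr_ge0; rewrite ?invr_ge0 sqr_ge0.
Qed.

Lemma jacobi_normalized_remez :
  Lam d (Pt ^+ 2) <= 2 * ((32 * n) ^+ 2) `^ r * V ((1 + 'X) * Pt ^+ 2).
Proof.
have n3 : 3 <= n by apply: le_trans dn.
(* With this height the cap u <= h carries at most half of [Lam d (Pt ^+ 2)]. *)
pose h := ((32 * n) ^+ 2)^-1.
have h0 : 0 < h by rewrite invr_gt0; nra.
have L1 := Lam1_gt0 (R := R) d2.
have LP : 0 <= Lam d (Pt ^+ 2) by apply: Lam_ge0 => t _; rewrite horner_exp sqr_ge0.
have sP : (size Pt <= k.+1)%N by rewrite size_polyZ_le//; have [->] := HJ2.1 k.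
pose M := K k.+1 * (Lam d (Pt ^+ 2) / Lam d 1).
have HM t : -1 <= t <= 1 -> Pt.[t] ^+ 2 <= M.
  exact: (zonal_nikolskii d2 size1 lead1 orth1 Hmu).
have h1 : 0 < h <= 1 by rewrite h0 invf_le1; nra.
(* K(1) <= 2 (8n)^d, 1/Lam 1 <= 2^d and the cap factor (2h)^(d/2)/2 multiply to ((16n)^2 2h)^(d/2) =
   2^(-d/2). *)
have key : K k.+1 / Lam d 1 * (2 * h) `^ (d%:R / 2 - 1) * h <= 2^-1.
  have hK : K k.+1 <= 2 * (8 * n) ^+ d.
    apply: le_trans (Kone_ub d2 size1 lead1 orth1 _) _.
    apply: ler_wpM2l => //; apply: lerXn2r; rewrite ?nnegrE.
    - by rewrite divr_ge0// mulr_ge0// addr_ge0.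
    - by rewrite mulr_ge0//; lra.
    - have d3R := dR; have d0 : 0 < d%:R :> R by lra.
      by rewrite ler_pdivrMr// -[k.+1]addn1 natrD -dnk; nra.
  have hL : (Lam d 1)^-1 <= 2 ^+ d :> R.
    by rewrite -[2 ^+ d]invrK lef_pV2 ?posrE ?invr_gt0 ?exprn_gt0// -exprVn Lam1_ge.
  have hh : (2 * h) `^ (d%:R / 2 - 1) * h = 2^-1 * (2 * h) `^ (d%:R / 2).
    rewrite -(@mulr_powRB1 _ (2 * h) (d%:R / 2)); [by field|lra|by have := dR; lra].
  have h16 : (16 * n) ^+ d = ((16 * n) ^+ 2) `^ (d%:R / 2).
    rewrite -!powR_mulrn; [|lra..].
    by rewrite -powRrM; congr (_ `^ _); field.
  rewrite -mulrA hh.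
  apply: (@le_trans _ _ ((2 * (8 * n) ^+ d) * 2 ^+ d * (2^-1 * (2 * h) `^ (d%:R / 2)))).
    apply: ler_wpM2r; first by rewrite mulr_ge0 ?powR_ge0.
    by apply: ler_pM => //; [exact: Kone_ge0|rewrite invr_ge0 ltW].
  have -> : (2 * (8 * n) ^+ d) * 2 ^+ d * (2^-1 * (2 * h) `^ (d%:R / 2)) =
     (16 * n) ^+ d * (2 * h) `^ (d%:R / 2).
    have -> : 16 * n = 8 * n * 2 by ring.
    by rewrite (exprMn _ (8 * n) 2); field.
  rewrite h16 -powRM ?sqr_ge0//; last lra.
  have -> : (16 * n) ^+ 2 * (2 * h) = 2^-1 by rewrite /h; field; lra.
  rewrite -[leRHS]powRr1//; apply: ger_powR; first by rewrite invr_gt0 ltr0n invf_le1 ?ler1n.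
  by have := dR; lra.
have := Lam_sqr_split d3 r0 ji h1 HM.
have -> : h `^ (- r) = ((32 * n) ^+ 2) `^ r.
  rewrite /h -powR_inv1; last by nra.
  by rewrite -powRrM mulN1r opprK.
have : M * (2 * h) `^ (d%:R / 2 - 1) * h <= 2^-1 * Lam d (Pt ^+ 2).
  have -> : M * (2 * h) `^ (d%:R / 2 - 1) * h =
     K k.+1 / Lam d 1 * (2 * h) `^ (d%:R / 2 - 1) * h * Lam d (Pt ^+ 2) by rewrite /M; ring.
  by rewrite ler_wpM2r.
move=> h3 h4; lra.
Qed.

(** The degrees satisfy N/m <= 1 + 6/d, and the d-th power of this is at most e^6, uniformly in
    d. *)
Lemma Kone_inv_ratio N : (k <= N)%N -> N%:R < (d%:R + 2) * n + 1 -> (K m)^-1 <= expR 6 / K N.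
Proof.
move=> kN hN; have [m0 mn mk] := kernel_degree_bounds; have d3R := dR.
have n3 : 3 <= n by apply: le_trans dn.
have mN : (m <= N)%N by apply: leq_trans kN.
have Km := Kone_gt0 d2 size1 lead1 orth1 m0.
have KN := Kone_gt0 d2 size1 lead1 orth1 (leq_trans m0 mN).
rewrite ler_pdivlMr// mulrC ler_pdivrMr//.
have hr : (0 < m <= N)%N by rewrite m0.
apply: le_trans (Kone_ratio d2 size1 lead1 orth1 hr) _.
apply: ler_wpM2r; first exact: ltW.
have mp : 0 < m%:R :> R by rewrite ltr0n.
have dp : 0 < d%:R :> R by lra.
have h : N%:R / m%:R <= expR (6 / d%:R) :> R.
  apply: le_trans (expR_ge1Dx _); rewrite ler_pdivrMr//.
  have E : 1 + 6 / d%:R = (d%:R + 6) / d%:R :> R by field; rewrite gt_eqF.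
  apply: (@le_trans _ _ ((1 + 6 / d%:R) * ((d%:R - 1) * n))).
    rewrite E mulrAC ler_pdivlMr//; nra.
  by apply: ler_wpM2l => //; rewrite E divr_ge0; lra.
have -> : 6 = d%:R * (6 / d%:R) :> R by rewrite mulrC divfK// gt_eqF.
rewrite expRM_natl; apply: lerXn2r => //; rewrite nnegrE ?expR_ge0//.
Qed.

Lemma jacobi_normalized_dyadic A N I : 0 < A ->
  (forall I t, -1 <= t <= 1 -> dyadic r (2 * i0) I t <= A * (1 - t) `^ r) ->
  (k <= N)%N -> N%:R < (d%:R + 2) * n + 1 ->
  (i0 * 2 ^ I)%:R <= n -> n < (i0 * 2 ^ I.+1)%:R ->
  Lam d (Pt ^+ 2 * dyadic_poly (2 * i0) I) + dyadic_weight r I * Lam d (Pt ^+ 2) <=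
  (A + 2 * ((64 * i0%:R) ^+ 2) `^ r) * (2 * (8 * i0%:R ^+ 2) `^ r * expR 6) *
    n `^ (- (2 * r)) * (Lam d 1 / K N).
Proof.
move=> A0 HA kN hN hI Ih; have n3 : 3 <= n by apply: le_trans dn.
have r0' := r0.
pose Y := V ((1 + 'X) * Pt ^+ 2).
have P2 t : 0 <= (Pt ^+ 2).[t] by rewrite horner_exp sqr_ge0.
have Y0 : 0 <= Y.
  by apply: Jint_ge0 => t /andP[t1 t2]; rewrite hornerM hornerD hornerX hornerC mulr_ge0//; lra.
have s0 : 0 < 4 ^+ I :> R by rewrite exprn_gt0.
have i00 : 0 < i0%:R :> R by rewrite ltr0n i0_gt0.
have n2 : n ^+ 2 <= 4 * i0%:R ^+ 2 * 4 ^+ I.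
  rewrite -natr_pow2_sqr; move: Ih; rewrite natrM expnS natrM => Ih.
  have -> : 4 * i0%:R ^+ 2 * (2 ^ I)%:R ^+ 2 = (i0%:R * (2 * (2 ^ I)%:R)) ^+ 2 :> R by ring.
  by apply: lerXn2r; rewrite ?nnegrE ?mulr_ge0//; lra.
have h1 : Lam d (Pt ^+ 2 * dyadic_poly (2 * i0) I) <= A * Y.
  apply: Lam_le_Jint => // t ht; rewrite hornerM dyadic_polyE mulrCA.
  by apply: ler_wpM2l => //; exact: HA.
have h2 := jacobi_normalized_remez; rewrite -/Y in h2.
(* The choice of I gives n <= 2 i0 2^I, hence (32n)^2/4^I <= (64 i0)^2; likewise 2/4^I <= 8 i0^2/n^2
   in [h6]. *)
have h3 : dyadic_weight r I * ((32 * n) ^+ 2) `^ r <= ((64 * i0%:R) ^+ 2) `^ r.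
  rewrite /dyadic_weight -[- r]mulN1r powRrM powR_inv1 ?(ltW s0)//.
  rewrite -powRM ?invr_ge0 ?(ltW s0)//; last exact: sqr_ge0.
  apply: ge0_ler_powR; rewrite ?nnegrE ?(ltW r0)//.
  - by apply: mulr_ge0; [rewrite invr_ge0 (ltW s0)|exact: sqr_ge0].
  - rewrite mulrC ler_pdivrMr//; lra.
have h4 : Y <= 2 * V (Pt ^+ 2).
  have -> : Y = V (2 *: Pt ^+ 2 + (-1) *: ((1 - 'X) * Pt ^+ 2)).
    by rewrite /Y; congr (V _); rewrite scaleN1r scaler_nat; ring.
  rewrite (JintD ji) !(JintZ ji).
  have : 0 <= V ((1 - 'X) * Pt ^+ 2).
    apply: Jint_ge0 => t /andP[t1 t2].
    by rewrite hornerM hornerD hornerN hornerX hornerC mulr_ge0//; lra.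
  lra.
have h5 := jacobi_normalized_bound hI.
have L1 := Lam1_gt0 (R := R) d2.
have h6 : (2 / (2 ^ I)%:R ^+ 2) `^ r <= (8 * i0%:R ^+ 2) `^ r * n `^ (- (2 * r)).
  have -> : n `^ (- (2 * r)) = (n ^- 2) `^ r.
    by rewrite -powR_invn; [rewrite -powRrM; congr (_ `^ _); ring|lra].
  have nn : 0 < n ^+ 2 by rewrite exprn_gt0//; lra.
  have i2 : 0 <= 8 * i0%:R ^+ 2 :> R by rewrite mulr_ge0// sqr_ge0.
  rewrite -powRM ?invr_ge0 ?(ltW nn)//; apply: ge0_ler_powR; rewrite ?nnegrE.
  - exact: (ltW r0).
  - by apply: mulr_ge0; rewrite ?invr_ge0// sqr_ge0.
  - by apply: mulr_ge0; rewrite ?invr_ge0// (ltW nn).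
  - rewrite natr_pow2_sqr ler_pdivrMr// mulrAC ler_pdivlMr//; lra.
have h7 := Kone_inv_ratio kN hN.
pose q := (8 * i0%:R ^+ 2) `^ r * n `^ (- (2 * r)) * (Lam d 1 * (expR 6 / K N)).
have h8 : Y <= 2 * q.
  apply: le_trans h4 _; apply: ler_wpM2l => //; apply: le_trans h5 _.
  have [m0 _ _] := kernel_degree_bounds.
  have Km := Kone_gt0 d2 size1 lead1 orth1 m0.
  apply: ler_pM => //; first by apply: mulr_ge0; rewrite ?invr_ge0 ?(ltW L1) ?(ltW Km).
  by apply: ler_wpM2l => //; exact: (ltW L1).
have w0 := dyadic_weight_ge0 r I.
have h9 : dyadic_weight r I * Lam d (Pt ^+ 2) <= 2 * ((64 * i0%:R) ^+ 2) `^ r * Y.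
  apply: (@le_trans _ _ (dyadic_weight r I * (2 * ((32 * n) ^+ 2) `^ r * Y))).
    exact: ler_wpM2l.
  have -> : dyadic_weight r I * (2 * ((32 * n) ^+ 2) `^ r * Y) =
     2 * (dyadic_weight r I * ((32 * n) ^+ 2) `^ r) * Y by ring.
  by apply: ler_wpM2r => //; apply: ler_wpM2l.
apply: (@le_trans _ _ ((A + 2 * ((64 * i0%:R) ^+ 2) `^ r) * Y)); first lra.
have -> : (A + 2 * ((64 * i0%:R) ^+ 2) `^ r) * (2 * (8 * i0%:R ^+ 2) `^ r * expR 6) *
    n `^ (- (2 * r)) * (Lam d 1 / K N) = (A + 2 * ((64 * i0%:R) ^+ 2) `^ r) * (2 * q).
  by rewrite /q; ring.
apply: ler_wpM2l => //.
by rewrite addr_ge0 ?(ltW A0)// mulr_ge0// powR_ge0.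
Qed.

End JacobiBound.

(** * Marcinkiewicz-Zygmund measures *)

Section ChargeIntegral.
Context {R : realType} {d : nat} {nu : {charge set (@pt R d) -> \bar R}} {P N : set (@pt R d)}.
Context (nuPN : hahn_decomposition nu P N).
Implicit Types (f g h : @pt R d -> R) (C : set (@pt R d)).
Local Notation S := (@sphere R d).
Local Notation vp := (jordan_pos nuPN).
Local Notation vn := (jordan_neg nuPN).

(** The total variation as a sum of two measures, over which integrals split. *)
Definition cvar : {measure set (@pt R d) -> \bar R} := measure_add vp vn.

Lemma jordan_pos_sphere_fin : (vp S < +oo)%E.
Proof. by rewrite ltey_eq fin_num_measure//; exact: measurable_sphere. Qed.

Lemma jordan_neg_sphere_fin : (vn S < +oo)%E.
Proof. by rewrite ltey_eq fin_num_measure//; exact: measurable_sphere. Qed.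

Lemma cvarE A : cvar A = charge_variation nuPN A.
Proof. by rewrite -[LHS]/(measure_add vp vn A) measure_addE. Qed.

Lemma cvar_sphere_fin : (cvar S < +oo)%E.
Proof.
by rewrite cvarE /charge_variation /= lte_add_pinfty ?jordan_pos_sphere_fin ?jordan_neg_sphere_fin.
Qed.

Lemma integral_cvar C (F : @pt R d -> \bar R) :
  (\int[charge_variation nuPN]_(y in C) F y = \int[cvar]_(y in C) F y)%E.
Proof. by apply: eq_measure_integral => A mA _; rewrite cvarE. Qed.

Lemma SE_cvar f : bmfun f -> SE cvar f = SE vp f + SE vn f.
Proof.
move=> bf; rewrite /SE /Rintegral integral_measure_add.
- rewrite fineD//; apply: integrable_fin_num.
  + exact: measurable_sphere.
  + exact: bmfun_integrable jordan_pos_sphere_fin bf.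
  + exact: measurable_sphere.
  + exact: bmfun_integrable jordan_neg_sphere_fin bf.
- exact: measurable_sphere.
- exact: bmfun_integrable jordan_pos_sphere_fin bf.
- exact: bmfun_integrable jordan_neg_sphere_fin bf.
Qed.

Definition charge_int g := SE vp g - SE vn g.

Lemma sint_charge_int g : bmfun g -> sint nuPN S g = (charge_int g)%:E.
Proof.
move=> bg; rewrite /sint (integral_SE jordan_pos_sphere_fin bg).
by rewrite (integral_SE jordan_neg_sphere_fin bg) EFinB.
Qed.

Lemma charge_intB f g : bmfun f -> bmfun g ->
  charge_int (fun y => f y - g y) = charge_int f - charge_int g.
Proof.
move=> bf bg; rewrite /charge_int (SEB jordan_pos_sphere_fin bf bg).
by rewrite (SEB jordan_neg_sphere_fin bf bg); ring.
Qed.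

Lemma charge_int_le g h : bmfun g -> bmfun h -> (forall y, S y -> `|g y| <= h y) ->
  `|charge_int g| <= SE cvar h.
Proof.
move=> bg bh gh; rewrite SE_cvar//; apply: le_trans (ler_normB _ _) _; apply: lerD.
  apply: le_trans (SE_norm jordan_pos_sphere_fin bg) _.
  exact: (SE_le jordan_pos_sphere_fin (bmfun_norm bg) bh gh).
apply: le_trans (SE_norm jordan_neg_sphere_fin bg) _.
exact: (SE_le jordan_neg_sphere_fin (bmfun_norm bg) bh gh).
Qed.

Lemma bmfun_indic C : measurable C -> bmfun (\1_C : @pt R d -> R).
Proof.
move=> mC; split; first exact: measurable_indic.
by exists 1 => y _; rewrite indicE ger0_norm ?ler0n// lern1 leq_b1.
Qed.

Lemma sint_restrict C g : measurable C -> C `<=` S ->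
  sint nuPN C g = sint nuPN S (fun y => g y * \1_C y).
Proof.
move=> mC CS; have h (m : {measure set (@pt R d) -> \bar R}) :
    (\int[m]_(y in C) (g y)%:E = \int[m]_(y in S) (g y * \1_C y)%:E)%E.
  have {1}-> : C = S `&` C by rewrite setIC; apply/esym/setIidPl.
  rewrite integral_mkcondr; apply: eq_integral => y _; rewrite patchE indicE.
  by case: ifP => _; rewrite ?mulr1 ?mulr0.
by rewrite /sint !h.
Qed.

Context (mu : {measure set (@pt R d) -> \bar R}).
Hypothesis Hmu : is_sphere_measure mu.

Lemma mzq_bound_pfun m c l f : mzq_bound m nuPN mu c -> pfun l f -> l%:R < m / 2 ->
  SE cvar (fun y => f y ^+ 2) <= c * SE mu (fun y => f y ^+ 2).
Proof.
move=> H pf lm; have := H _ (pfun_Pi pf lm).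
have bf2 : bmfun (fun y => f y ^+ 2) by apply: pfun_bmfun (pfun_exp 2 pf).
have E y : ((`|f y| ^+ 2)%:E = (f y ^+ 2)%:E)%E by rewrite real_normK// num_real.
under eq_integral do rewrite E; under [X in (_ <= _ * X)%E]eq_integral do rewrite E.
rewrite integral_cvar (integral_SE cvar_sphere_fin bf2) (integral_SE (mu_sphere_fin Hmu) bf2).
by rewrite -EFinM lee_fin.
Qed.

Lemma mzq_exact m f l : (forall Q, Pi d m Q ->
     (sint nuPN S Q = \int[mu]_(y in S) (Q y)%:E)%E) -> pfun l f -> l%:R < m ->
  charge_int f = SE mu f.
Proof.
move=> H pf lm; have := H _ (pfun_Pi pf lm); have bf := pfun_bmfun pf.
by rewrite sint_charge_int// (integral_SE (mu_sphere_fin Hmu) bf) => -[].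
Qed.

End ChargeIntegral.

Lemma dyadic_scale (R : realType) (i0 : nat) (n : R) : (0 < i0)%N -> i0%:R <= n ->
  exists I, (i0 * 2 ^ I)%:R <= n /\ n < (i0 * 2 ^ I.+1)%:R.
Proof.
move=> i0p hn; have ip : 0 < i0%:R :> R by rewrite ltr0n.
pose M := Num.truncn (n / i0%:R).
have nM : 0 <= n / i0%:R by rewrite divr_ge0// (le_trans _ hn).
have M0 : (0 < M)%N by rewrite truncn_gt0 ler_pdivlMr// mul1r.
have /andP[h1 h2] := trunc_log_bounds (isT : (1 < 2)%N) M0.
exists (trunc_log 2 M); split.
  have : (2 ^ trunc_log 2 M)%:R <= n / i0%:R.
    by apply: le_trans (_ : M%:R <= _); [rewrite ler_nat|rewrite truncn_le].
  by rewrite ler_pdivlMr// natrM mulrC.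
have : n / i0%:R < (2 ^ (trunc_log 2 M).+1)%:R.
  by apply: lt_le_trans (truncnS_gt _) _; rewrite ler_nat.
by rewrite ltr_pdivrMr// natrM mulrC.
Qed.

Lemma bmfun_powR (R : realType) (d : nat) (f : @pt R d -> R) (a : R) : 0 <= a -> bmfun f ->
  (forall y, sphere d y -> 0 <= f y) -> bmfun (fun y => f y `^ a).
Proof.
move=> a0 [mf [M HM]] f0; split.
  by apply: (measurableT_comp (f := fun u : R => u `^ a)).
exists (M `^ a) => y Sy; have := HM y Sy; rewrite !ger0_norm ?powR_ge0 ?f0// => fM.
by apply: ge0_ler_powR; rewrite ?nnegrE ?f0// (le_trans _ fM) ?f0.
Qed.

(** * Integral of the kernel against the total variation *)

Section KernelVariation.
Context {R : realType} (r : R).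
Hypothesis r0 : 0 < r.
Context (i0 : nat).
Hypothesis i0_gt0 : (0 < i0)%N.
Hypothesis r_lt : r < (2 * i0)%:R.
Context (d : nat).
Hypothesis d3 : (3 <= d)%N.
Context (mu : {measure set (@pt R d) -> \bar R}).
Hypothesis Hmu : is_sphere_measure mu.
Context (J1 J2 : nat -> {poly R}).
Hypothesis HJ1 : is_jacobi (d%:R / 2 - 1) (d%:R / 2 - 1) J1.
Hypothesis HJ2 : is_jacobi (d%:R / 2 + r) (d%:R / 2 - 2) J2.
Context (n : R) (k : nat).
Hypothesis dn : d%:R <= n.
Hypothesis dnk : d%:R * n = k%:R.
Context {nu : {charge set (@pt R d) -> \bar R}} {P N : set (@pt R d)}.
Context (nuPN : hahn_decomposition nu P N).
Context (x : @pt R d).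
Hypothesis Sx : sphere d x.
Context (c : R).
Hypothesis c0 : 0 <= c.
Hypothesis Hc : mzq_bound (2 * (d%:R + 2) * n) nuPN mu c.
Context (M : nat).
Hypothesis HM : forall l : nat, (l < M)%N = (l%:R < (d%:R + 2) * n).
Hypothesis Mn : M%:R < (d%:R + 2) * n + 1.
Local Notation K := (Kone d J1).
Local Notation Kp := (Kpoly d J1 M).
Local Notation Pt := (jacobi_normalized J2 k).
Local Notation S := (@sphere R d).
Local Notation var := (cvar nuPN).

Let d2 : (2 <= d)%N. Proof. exact: ltnW. Qed.
Let dR : 3 <= d%:R :> R. Proof. by rewrite (ler_nat R 3). Qed.
Let n3 : 3 <= n. Proof. exact: le_trans dR dn. Qed.
Let size1 := let: And3 h _ _ := is_jacobi_Lam HJ1 in h.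
Let lead1 := let: And3 _ h _ := is_jacobi_Lam HJ1 in h.
Let orth1 := let: And3 _ _ h := is_jacobi_Lam HJ1 in h.

Lemma variation_zonal_sqr (Q : {poly R}) l : (size Q <= l.+1)%N -> l%:R < (d%:R + 2) * n ->
  SE var (fun y => (Q ^+ 2).[dot x y]) <= c * (Lam d (Q ^+ 2) / Lam d 1).
Proof.
move=> sQ ln.
have := mzq_bound_pfun Hmu Hc (pfun_zonal x sQ) (_ : l%:R < 2 * (d%:R + 2) * n / 2).
have -> : 2 * (d%:R + 2) * n / 2 = (d%:R + 2) * n by field.
move=> /(_ ln); rewrite -(SE_zonal d2 Hmu _ Sx).
have E (m : {measure set (@pt R d) -> \bar R}) :
   SE m (fun y => Q.[dot x y] ^+ 2) = SE m (fun y => (Q ^+ 2).[dot x y]).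
  by apply: eq_SE => y _; rewrite horner_exp.
by rewrite !E.
Qed.

Lemma size_jacobi_normalized : (size Pt <= k.+1)%N.
Proof. by rewrite size_polyZ_le//; have [->] := HJ2.1 k. Qed.

Lemma degree_M : (k <= M)%N.
Proof. by apply: ltnW; rewrite HM -dnk; have := dR; have := n3; nra. Qed.

(** Each summand is a positive multiple of the square of a polynomial of degree at most dn + n <
    (d+2)n, so the Marcinkiewicz-Zygmund inequality applies termwise. *)
Lemma variation_dyadic I : (i0 * 2 ^ I)%:R <= n ->
  SE var (fun y => (Pt ^+ 2).[dot x y] * (dyadic r (2 * i0) I (dot x y) + dyadic_weight r I)) <=
  c * ((Lam d (Pt ^+ 2 * dyadic_poly r (2 * i0) I) + dyadic_weight r I * Lam d (Pt ^+ 2)) / Lam d 1).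
Proof.
move=> hI; have sP := size_jacobi_normalized.
have kn : k%:R < (d%:R + 2) * n by rewrite -dnk; have := n3; nra.
pose F (i : nat) := (Pt * (1 - fejer (2 ^ i)) ^+ i0) ^+ 2.
have FE i t : (F i).[t] = Pt.[t] ^+ 2 * (1 - (fejer (2 ^ i)).[t]) ^+ (2 * i0).
  by rewrite /F horner_exp hornerM exprMn horner_exp -exprM [(i0 * 2)%N]mulnC hornerD hornerN hornerC.
have bz Q : bmfun (fun y : @pt R d => Q.[dot x y]) := bmfun_zonal x Q.
have -> : SE var (fun y => (Pt ^+ 2).[dot x y] * (dyadic r (2 * i0) I (dot x y) + dyadic_weight r I)) =
    SE var (fun y => \sum_(i <- index_enum 'I_I.+1) dyadic_weight r i * (F i).[dot x y] +
       dyadic_weight r I * (Pt ^+ 2).[dot x y]).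
  apply: eq_SE => y _; rewrite mulrDr [X in _ + X]mulrC; congr (_ + _).
  rewrite /dyadic mulr_sumr; apply: eq_bigr => i _.
  by rewrite FE horner_exp; ring.
have fin := cvar_sphere_fin nuPN.
have bF (i : 'I_I.+1) : bmfun (fun y : @pt R d => dyadic_weight r i * (F i).[dot x y]).
  exact: bmfunZ.
rewrite (SED fin (bmfun_sum _ bF)) ?(SE_sum fin)//; last exact: bmfunZ.
rewrite (SEZ fin)// mulrDl mulrDr; apply: lerD; last first.
  rewrite -mulrA [leRHS]mulrCA; apply: ler_wpM2l; first exact: dyadic_weight_ge0.
  exact: variation_zonal_sqr sP kn.
have -> : Pt ^+ 2 * dyadic_poly r (2 * i0) I = \sum_(i < I.+1) dyadic_weight r i *: F i.
  rewrite /dyadic_poly mulr_sumr; apply: eq_bigr => i _.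
  by rewrite /F exprMn -exprM [(i0 * 2)%N]mulnC scalerAr.
rewrite Lam_sum// mulr_suml mulr_sumr; apply: ler_sum => i _.
rewrite (SEZ fin)// LamZ// -mulrA [leRHS]mulrCA.
apply: ler_wpM2l; first exact: dyadic_weight_ge0.
have s1 : (size (1 - fejer (2 ^ i) : {poly R})%R <= (2 ^ i).-1.+1)%N.
  rewrite size_polyB_le ?size_poly1//.
  by rewrite prednK ?expn_gt0// size_fejer.
apply: variation_zonal_sqr (size_polyM_le sP (size_polyX_le i0 s1)) _.
apply: le_lt_trans (_ : (k + i0 * 2 ^ I)%:R < _).
  rewrite ler_nat leq_add2l mulnC leq_mul2l (leq_trans (leq_pred _)) ?orbT//.
  by rewrite leq_exp2l// -ltnS.
by rewrite natrD -dnk; have := n3; nra.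
Qed.

Lemma kernel_variation A I : 0 < A ->
  (forall I t, -1 <= t <= 1 -> dyadic r (2 * i0) I t <= A * (1 - t) `^ r) ->
  (i0 * 2 ^ I)%:R <= n -> n < (i0 * 2 ^ I.+1)%:R ->
  SE var (fun y => `|Kp.[dot x y] * Pt.[dot x y]| * (1 - dot x y) `^ (r / 2)) <=
  (1 + 16 `^ r * 2 ^+ (2 * i0) * ((A + 2 * ((64 * i0%:R) ^+ 2) `^ r) *
     (2 * (8 * i0%:R ^+ 2) `^ r * expR 6))) * n `^ (- r) * c.
Proof.
move=> A0 HA hI Ih; have n0 : 0 < n by have := n3; lra.
set B := 16 `^ r * 2 ^+ (2 * i0); set C := (A + _) * _.
have M0 : (0 < M)%N by rewrite HM; have := dR; have := n3; nra.
have K0 := Kone_gt0 d2 size1 lead1 orth1 M0.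
have L1 := Lam1_gt0 (R := R) d2.
(* The AM-GM parameter balances the mean squares of the two factors, of order K(1) and
   n^(-2r)/K(1). *)
pose s := n `^ (- r) / K M.
have np : 0 < n `^ (- r) by rewrite powR_gt0.
have s0 : 0 < s by rewrite divr_gt0.
have B0 : 0 <= B by rewrite mulr_ge0 ?powR_ge0// exprn_ge0.
have fin := cvar_sphere_fin nuPN.
pose G y := (Pt ^+ 2).[dot x y] * (dyadic r (2 * i0) I (dot x y) + dyadic_weight r I).
have bz Q : bmfun (fun y : @pt R d => Q.[dot x y]) := bmfun_zonal x Q.
have bG : bmfun G.
  apply: bmfunM => //; apply: bmfunD; last exact: bmfun_cst.
  have := bz (dyadic_poly r (2 * i0) I); congr bmfun; apply/funext => y.
  by rewrite dyadic_polyE.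
have bu : bmfun (fun y : @pt R d => (1 - dot x y) `^ (r / 2)).
  apply: bmfun_powR; first by have := r0; lra.
    exact: pfun_bmfun (pfun_sub (pfun_cst_le 1 1) (pfun_dot x)).
  by move=> y Sy; have /andP[t1 t2] := cauchy_schwarz_sphere Sx Sy; lra.
have bKP : bmfun (fun y : @pt R d => `|Kp.[dot x y] * Pt.[dot x y]|).
  by apply: bmfun_norm; apply: bmfunM.
have pw y : S y -> `|Kp.[dot x y] * Pt.[dot x y]| * (1 - dot x y) `^ (r / 2) <=
    2^-1 * s * (Kp ^+ 2).[dot x y] + 2^-1 * s^-1 * B * G y.
  move=> Sy; have ht := cauchy_schwarz_sphere Sx Sy; have /andP[t1 t2] := ht.
  rewrite /G !horner_exp; move: (dot x y) ht t1 t2 => t ht t1 t2.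
  have hd := dyadic_lower (2 * i0) I r0 ht; rewrite -/B in hd.
  set w := (1 - t) `^ (r / 2); have w0 : 0 <= w by exact: powR_ge0.
  have w2 : w ^+ 2 = (1 - t) `^ r.
    by rewrite /w -powR_mulrn ?powR_ge0// -powRrM; congr (_ `^ _); field.
  rewrite -w2 in hd.
  rewrite normrM -[Kp.[t] ^+ 2]real_normK ?num_real// -[Pt.[t] ^+ 2]real_normK ?num_real//.
  set a := `|Kp.[t]|; set b := `|Pt.[t]|; have b0 : 0 <= b ^+ 2 by exact: sqr_ge0.
  set D := dyadic r (2 * i0) I t + dyadic_weight r I in hd *.
  apply: (@le_trans _ _ (2^-1 * s * a ^+ 2 + 2^-1 * s^-1 * (b ^+ 2 * w ^+ 2))).
    rewrite -subr_ge0.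
    have -> : 2^-1 * s * a ^+ 2 + 2^-1 * s^-1 * (b ^+ 2 * w ^+ 2) - a * b * w =
       2^-1 * s^-1 * (s * a - b * w) ^+ 2 by field; rewrite gt_eqF.
    by rewrite mulr_ge0 ?sqr_ge0// mulr_ge0 ?invr_ge0 ?(ltW s0).
  rewrite lerD2l -[leRHS]mulrA; apply: ler_wpM2l; first by rewrite mulr_ge0 ?invr_ge0 ?(ltW s0).
  by rewrite [leRHS]mulrCA; apply: ler_wpM2l.
apply: (@le_trans _ _ (2^-1 * s * SE var (fun y => (Kp ^+ 2).[dot x y]) + 2^-1 * s^-1 * B * SE var G)).
  rewrite -!(SEZ fin)// -(SED fin); [|exact: bmfunZ..].
  exact: (SE_le fin (bmfunM bKP bu) (bmfunD (bmfunZ _ (bz _)) (bmfunZ _ bG)) pw).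
have hK : SE var (fun y => (Kp ^+ 2).[dot x y]) <= c * K M.
  have sK : (size Kp <= M.-1.+1)%N by rewrite prednK// size_Kpoly.
  apply: le_trans (variation_zonal_sqr sK _) _; first by rewrite -HM prednK.
  rewrite expr2 (Lam_Kpoly d2 size1 lead1 orth1) ?size_Kpoly// Kpoly1.
  by rewrite [Lam d 1 * _]mulrC mulfK ?gt_eqF.
have hG : SE var G <= c * (C * n `^ (- (2 * r)) / K M).
  apply: le_trans (variation_dyadic hI) _; apply: ler_wpM2l => //.
  rewrite ler_pdivrMr//.
  have := jacobi_normalized_dyadic r0 i0_gt0 r_lt d3 Hmu HJ1 HJ2 dn dnk A0 HA degree_M Mn hI Ih.
  by rewrite -/C => /le_trans; apply; rewrite le_eqVlt; apply/orP; left; apply/eqP; ring.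
have sV : s * s^-1 = 1 by rewrite divff// gt_eqF.
apply: (@le_trans _ _ (2^-1 * s * (c * K M) + 2^-1 * s^-1 * B * (c * (C * n `^ (- (2 * r)) / K M)))).
  apply: lerD; apply: ler_wpM2l => //; first by rewrite mulr_ge0 ?(ltW s0).
  by rewrite !mulr_ge0 ?invr_ge0 ?(ltW s0).
have C0 : 0 <= C.
  by rewrite !mulr_ge0 ?addr_ge0 ?mulr_ge0 ?powR_ge0 ?expR_ge0 ?(ltW A0).
have -> : n `^ (- (2 * r)) = n `^ (- r) * n `^ (- r).
  rewrite -powRD; first by congr (_ `^ _); ring.
  by apply/implyP => _; rewrite gt_eqF.
have -> : 2^-1 * s * (c * K M) + 2^-1 * s^-1 * B * (c * (C * (n `^ (- r) * n `^ (- r)) / K M)) =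
   2^-1 * ((1 + B * C) * n `^ (- r) * c).
  by rewrite /s; field; rewrite !gt_eqF.
rewrite ler_piMl ?invf_le1 ?ler1n//.
have BC : 0 <= B * C by exact: mulr_ge0.
apply: mulr_ge0 => //; apply: mulr_ge0; last exact: (ltW np).
exact: addr_ge0.
Qed.

End KernelVariation.

(** * Growth and continuity on the sphere *)

Section SphereCircles.
Context {R : realType} {d : nat}.
Implicit Types (f g : @pt R d -> R) (x y z w : @pt R d) (l m : nat) (t s : R) (A B : {poly R}).
Local Notation S := (@sphere R d).

Definition circ x w t s : @pt R d := [tuple t * tnth x i + s * tnth w i | i < d.+1].

Lemma dot_circ x w t s y : dot y (circ x w t s) = t * dot y x + s * dot y w.
Proof.
rewrite /dot !mulr_sumr -big_split; apply: eq_bigr => i _ /=; rewrite tnth_mktuple; ring.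
Qed.

Lemma sphere_circ x w t s : S x -> S w -> dot x w = 0 -> t ^+ 2 + s ^+ 2 = 1 -> S (circ x w t s).
Proof.
rewrite /sphere /= => Sx Sw xw ts; rewrite dot_circ !(dotC (circ _ _ _ _)) !dot_circ Sx Sw xw (dotC w) xw.
by rewrite !mulr0 addr0 add0r !mulr1 -!expr2.
Qed.

Lemma orth_unit x : (0 < d)%N -> exists2 w, S w & dot x w = 0.
Proof.
move=> d0; have m0 : ord_max != ord0 :> 'I_d.+1 by rewrite -val_eqE /= -lt0n.
pose a := tnth x ord0; pose b := tnth x ord_max.
have two (w : @pt R d) (u v : R) : (forall i, tnth w i = if i == ord0 then u else if i == ord_max then v else 0) ->
    forall z, dot z w = tnth z ord0 * u + tnth z ord_max * v.
  move=> wE z; rewrite /dot (bigD1 ord0)//= (bigD1 ord_max)//= !wE eqxx (negPf m0) eqxx.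
  by rewrite big1 ?addr0// => i /andP[i0 im]; rewrite wE (negPf i0) (negPf im) mulr0.
have [ab0|abn] := eqVneq (a ^+ 2 + b ^+ 2) 0.
  have a0 : a = 0 by have := sqr_ge0 a; have := sqr_ge0 b; move=> h1 h2; nra.
  exists (basis ord0); first by rewrite /sphere /= dot_basis2.
  by rewrite dotC dot_basis.
have abp : 0 < a ^+ 2 + b ^+ 2 by rewrite lt_def abn addr_ge0 ?sqr_ge0.
pose q := Num.sqrt (a ^+ 2 + b ^+ 2).
have q2 : q ^+ 2 = a ^+ 2 + b ^+ 2 by rewrite sqr_sqrtr// ltW.
have q0 : q != 0 by rewrite gt_eqF// sqrtr_gt0.
pose w : @pt R d := [tuple if i == ord0 then - b / q else if i == ord_max then a / q else 0 | i < d.+1].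
have wE := two w _ _ (fun i => tnth_mktuple _ i).
exists w; last by rewrite wE -/a -/b; ring.
rewrite /sphere /= wE !tnth_mktuple eqxx (negPf m0) eqxx.
by apply: (mulIf (expf_neq0 2 q0)); rewrite mul1r [RHS]q2; field.
Qed.

Lemma circ_decomposition x y : (0 < d)%N -> S x -> S y ->
  exists w, [/\ S w, dot x w = 0 & y = circ x w (dot x y) (Num.sqrt (1 - dot x y ^+ 2))].
Proof.
move=> d0 Sx Sy; have ht := cauchy_schwarz_sphere Sx Sy; have /andP[t1 t2] := ht.
have [w0 Sw0 xw0] := orth_unit x d0.
set t := dot x y in ht t1 t2 *; set s := Num.sqrt _.
have s2 : s ^+ 2 = 1 - t ^+ 2 by rewrite sqr_sqrtr//; nra.
pose v : @pt R d := circ y x 1 (- t).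
have vE z : dot z v = dot z y - t * dot z x by rewrite dot_circ mul1r mulNr.
have vv : dot v v = s ^+ 2.
  rewrite vE !(dotC v) !vE (dotC y x) -/t s2.
  by move: Sx Sy; rewrite /sphere /= => -> ->; ring.
(* Here y is x or -x, and any unit vector orthogonal to x serves. *)
have [s0|sn] := eqVneq s 0.
  exists w0; split=> //; apply: eq_from_tnth => i; rewrite tnth_mktuple s0 mul0r addr0.
  have /eqP : dot v v = 0 by rewrite vv s0 expr0n.
  rewrite /dot psumr_eq0 => [/allP/(_ i)|j _]; last by rewrite -expr2 sqr_ge0.
  rewrite mem_index_enum => /(_ isT); rewrite -expr2 sqrf_eq0 tnth_mktuple => /eqP; lra.
pose w : @pt R d := circ v v s^-1 0.
have wE z : dot z w = s^-1 * dot z v by rewrite dot_circ mul0r addr0.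
exists w; split.
- by rewrite /sphere /= wE dotC wE vv; field.
- rewrite wE vE -/t; move: Sx; rewrite /sphere /= => ->; ring.
- by apply: eq_from_tnth => i; rewrite !tnth_mktuple; field.
Qed.

(** Even and odd parts in s; the relation s^2 = 1 - t^2 closes the form under products. The odd part
    B has degree one less, as s itself counts for one. *)
Lemma pfun_circle x w l f : pfun l f -> exists A B, [/\ (size A <= l.+1)%N, (size B <= l)%N &
  forall t s, t ^+ 2 + s ^+ 2 = 1 -> f (circ x w t s) = A.[t] + s * B.[t]].
Proof.
elim=> {l f}.
- move=> c; exists c%:P, 0; split; rewrite ?size_poly0 ?size_polyC ?leq_b1// => t s _.
  by rewrite hornerC horner0 mulr0 addr0.
- move=> i; exists (tnth x i *: 'X), (tnth w i)%:P; split.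
  + by rewrite size_polyZ_le// size_polyX.
  + by rewrite size_polyC leq_b1.
  + by move=> t s _; rewrite tnth_mktuple hornerZ hornerX hornerC; ring.
- move=> l f g _ [A1 [B1 [sA1 sB1 E1]]] _ [A2 [B2 [sA2 sB2 E2]]].
  exists (A1 + A2), (B1 + B2); split; rewrite ?size_polyD_le// => t s ts.
  by rewrite E1// E2// !hornerD; ring.
- move=> l m f g _ [A1 [B1 [sA1 sB1 E1]]] _ [A2 [B2 [sA2 sB2 E2]]].
  exists (A1 * A2 + (1 - 'X^2) * (B1 * B2)), (A1 * B2 + A2 * B1); split.
  + apply: size_polyD_le; first exact: size_polyM_le.
    have [->|B10] := eqVneq B1 0; first by rewrite mul0r mulr0 size_poly0.
    have [->|B20] := eqVneq B2 0; first by rewrite !mulr0 size_poly0.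
    have h3 : (size (1 - 'X^2 : {poly R})%R <= 2.+1)%N by rewrite size_polyB_le ?size_poly1 ?size_polyXn.
    rewrite -size_poly_gt0 in B10; rewrite -size_poly_gt0 in B20.
    have hB : (size (B1 * B2)%R <= (l + m).-2.+1)%N.
      apply: leq_trans (size_polyMleq _ _) _.
      by move: sB1 sB2 B10 B20; move: (size B1) (size B2) => p q; clear; lia.
    apply: leq_trans (size_polyM_le h3 hB) _.
    by move: sB1 sB2 B10 B20; move: (size B1) (size B2) => p q; clear; lia.
  + apply: size_polyD_le.
      have [->|A0] := eqVneq A1 0; first by rewrite mul0r size_poly0.
      have [->|B0] := eqVneq B2 0; first by rewrite mulr0 size_poly0.
      rewrite -size_poly_gt0 in A0; rewrite -size_poly_gt0 in B0.
      apply: leq_trans (size_polyMleq _ _) _.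
      by move: sA1 sB2 A0 B0; move: (size A1) (size B2) => p q; clear; lia.
    have [->|A0] := eqVneq A2 0; first by rewrite mul0r size_poly0.
    have [->|B0] := eqVneq B1 0; first by rewrite mulr0 size_poly0.
    rewrite -size_poly_gt0 in A0; rewrite -size_poly_gt0 in B0.
    apply: leq_trans (size_polyMleq _ _) _.
    by move: sA2 sB1 A0 B0; move: (size A2) (size B1) => p q; clear; lia.
  + move=> t s ts; rewrite E1// E2// !(hornerD, hornerM, hornerN, hornerX, hornerC).
    have -> : 1 - t * t = s * s by rewrite -ts; ring.
    ring.
- move=> l m f lm _ [A [B [sA sB E]]]; exists A, B; split=> //.
  + exact: leq_trans sA _.
  + exact: leq_trans sB _.
Qed.

(* The two halves [A] and [s B] of the restriction of [f] to a great circle through [x] are controlled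
   at equispaced latitudes [t] in [1 - h, 1 - h/2] by the values of [f] at [t x + s w] and [t x - s w]. *)
Lemma circle_growth x w l f h M : S x -> S w -> dot x w = 0 -> pfun l f -> 0 < h <= 1 ->
  (forall y, S y -> 1 - h <= dot x y -> `|f y| <= M) ->
  forall t s, t ^+ 2 + s ^+ 2 = 1 ->
  `|f (circ x w t s)| <= 2 * M * (16 * l.+1%:R / h) ^+ l.
Proof.
move=> Sx Sw xw pf /andP[h0 h1] HM t s ts.
have [A [B [sA sB E]]] := pfun_circle x w pf.
have M0 : 0 <= M.
  by apply: le_trans (normr_ge0 (f x)) (HM x Sx _); move: Sx; rewrite /sphere /= => ->; lra.
pose z (j : nat) : R := 1 - h / 2 - (h / (2 * l.+1%:R)) * j%:R.
have lp : 0 < l.+1%:R :> R by [].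
have g0 : 0 < h / (2 * l.+1%:R) by rewrite divr_gt0// mulr_gt0.
have hz i : (i <= l)%N -> 1 - h <= z i <= 1 - h / 2.
  move=> il.
  have : h / (2 * l.+1%:R) * i%:R <= h / 2.
    rewrite invfM mulrA -mulrA -[leRHS]mulr1; apply: ler_wpM2l; first by rewrite divr_ge0// ltW.
    by rewrite mulrC ler_pdivrMr// mul1r ler_nat ltnW.
  have : 0 <= h / (2 * l.+1%:R) * i%:R by rewrite mulr_ge0// ltW.
  rewrite /z; move: (h / (2 * l.+1%:R) * i%:R) => e h2 h3.
  by apply/andP; split; lra.
have gap i j : (i < j)%N -> h / (2 * l.+1%:R) <= `|z i - z j|.
  move=> ij; have -> : z i - z j = h / (2 * l.+1%:R) * (j - i)%:R by rewrite natrB 1?ltnW// /z; ring.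
  apply: le_trans (ler_norm _); apply: ler_peMr; first exact: (ltW g0).
  by rewrite (ler_nat R 1) subn_gt0.
have bd u v : 1 - h <= u -> u ^+ 2 + v ^+ 2 = 1 -> `|A.[u] + v * B.[u]| <= M.
  move=> hu uv; rewrite -E//; apply: HM; first exact: sphere_circ.
  by rewrite dot_circ xw mulr0 addr0; move: Sx; rewrite /sphere /= => ->; rewrite mulr1.
pose r i : R := Num.sqrt (1 - z i ^+ 2).
have r2 i : (i <= l)%N -> z i ^+ 2 + r i ^+ 2 = 1.
  by move=> /hz/andP[z1 z2]; rewrite sqr_sqrtr; [ring|nra].
have HA i : (i <= l)%N -> `|A.[z i]| <= M.
  move=> il; have /andP[z1 z2] := hz i il.
  have b1 := bd _ _ z1 (r2 i il).
  have b2 : `|A.[z i] + - r i * B.[z i]| <= M by apply: bd => //; rewrite sqrrN r2.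
  by move: b1 b2; rewrite !ler_norml => /andP[? ?] /andP[? ?]; apply/andP; split; lra.
have HB i : (i <= l)%N -> `|B.[z i]| <= 2 * M / h.
  move=> il; have /andP[z1 z2] := hz i il.
  have b1 := bd _ _ z1 (r2 i il).
  have b2 : `|A.[z i] + - r i * B.[z i]| <= M by apply: bd => //; rewrite sqrrN r2.
  (* As 0 <= z i <= 1 - h/2, the square of [r i] is at least h/2, and h <= 1. *)
  have rp : h / 2 <= r i.
    have ri0 : 0 <= r i by exact: sqrtr_ge0.
    have := r2 i il; nra.
  have rB : `|r i * B.[z i]| <= M.
    by move: b1 b2; rewrite !ler_norml => /andP[? ?] /andP[? ?]; apply/andP; split; lra.
  rewrite ler_pdivlMr//; move: rB; rewrite normrM ger0_norm ?sqrtr_ge0// => rB.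
  have := normr_ge0 B.[z i]; nra.
have tb : -1 <= t <= 1 by apply/andP; split; nra.
have sb : `|s| <= 1 by rewrite ler_norml; apply/andP; split; nra.
have HZ i : (i <= l)%N -> `|t - z i| <= 2.
  by move=> /hz/andP[z1 z2]; have /andP[t1 t2] := tb; rewrite ler_norml; apply/andP; split; lra.
have q1 : 1 + 2 * 2 / (h / (2 * l.+1%:R)) <= 16 * l.+1%:R / h.
  have -> : 1 + 2 * 2 / (h / (2 * l.+1%:R)) = (h + 8 * l.+1%:R) / h by field; rewrite !gt_eqF.
  rewrite ler_pM2r ?invr_gt0//; have : 1 <= l.+1%:R :> R by rewrite (ler_nat R 1).
  lra.
have q0 : 0 <= 1 + 2 * 2 / (h / (2 * l.+1%:R)) by rewrite addr_ge0// divr_ge0// ltW.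
have GA : `|A.[t]| <= M * (16 * l.+1%:R / h) ^+ l.
  apply: le_trans (poly_growth g0 sA (z := z) (M := M) (Z := 2) _ HA HZ) _.
    by move=> i j /andP[ij _]; exact: gap.
  by apply: ler_wpM2l => //; apply: lerXn2r; rewrite ?nnegrE// (le_trans q0).
(* Recovering B costs 2/h, which is absorbed by the factor 16(l+1)/h spared by its lower degree. *)
have GB : `|B.[t]| <= M * (16 * l.+1%:R / h) ^+ l.
  case: l sA sB pf @z lp g0 hz gap @r r2 HA HB HZ q1 q0 {GA E bd} => [|l] sA sB pf z lp g0 hz gap r r2 HA HB HZ q1 q0.
    by move: sB; rewrite leqn0 size_poly_eq0 => /eqP->; rewrite horner0 normr0 mulr1.
  apply: le_trans (poly_growth g0 sB (z := z) (M := 2 * M / h) (Z := 2) _ _ _) _.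
  - by move=> i j /andP[ij _]; exact: gap.
  - by move=> i il; apply: HB; exact: leqW.
  - by move=> i il; apply: HZ; exact: leqW.
  rewrite exprS mulrA; apply: ler_pM.
  - by rewrite divr_ge0 ?mulr_ge0// ltW.
  - exact: exprn_ge0.
  - rewrite [leRHS]mulrA ler_pM2r ?invr_gt0// [2 * M]mulrC; apply: ler_wpM2l => //.
    have : 1 <= l.+2%:R :> R by rewrite (ler_nat R 1).
    by move: (l.+2%:R : R) => e; lra.
  - by apply: lerXn2r; rewrite ?nnegrE// (le_trans q0).
rewrite E//; apply: le_trans (ler_normD _ _) _; rewrite normrM.
have : `|s| * `|B.[t]| <= `|B.[t]| by rewrite ler_piMl.
lra.
Qed.

End SphereCircles.

(** * Continuity, measurability and caps *)

Section SphereContinuity.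
Context {R : realType} {d : nat}.
Implicit Types (f : @pt R d -> R) (x y z w : @pt R d).
Local Notation S := (@sphere R d).

(** A countable base of rational balls, by which continuity on the sphere yields measurability for
    the product sigma-algebra. *)
Let rat_ball (p : (d.+1).-tuple rat * nat) : set (@pt R d) :=
  [set z | \sum_i (tnth z i - ratr (tnth p.1 i)) ^+ 2 < p.2.+1%:R ^- 2].

Let measurable_rat_ball p : measurable (rat_ball p).
Proof.
have h : pfun 2 (fun z : @pt R d => \sum_i (tnth z i - ratr (tnth p.1 i)) ^+ 2).
  apply: pfun_sum => i; apply: (@pfun_exp R d 1 _ 2).
  by apply: pfun_sub; [exact: pfun_coord|exact: pfun_cst_le].
have := measurable_pfun h measurableT (measurable_itv `]-oo, (p.2.+1%:R ^- 2 : R)[).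
by rewrite setTI; congr measurable; apply/seteqP; split => z; rewrite /rat_ball /= in_itv.
Qed.

Let rat_ball_dense y eta : 0 < eta -> exists p, rat_ball p y /\
  forall z, rat_ball p z -> dist y z < eta.
Proof.
move=> e0; pose N := Num.truncn (2 * d.+1%:R / eta).
have dp : 0 < d.+1%:R :> R by [].
have Np : 0 < N.+1%:R :> R by [].
have hN : 2 * d.+1%:R * N.+1%:R^-1 < eta.
  by rewrite ltr_pdivrMr// -ltr_pdivrMl// mulrC truncnS_gt.
pose e : R := N.+1%:R^-1; have ep : 0 < e by rewrite invr_gt0.
have [e' e1 Ee'] : exists2 e' : R, 0 < e' & 2 * d.+1%:R * e' = e.
  exists (e / (2 * d.+1%:R)); first by rewrite divr_gt0// mulr_gt0.
  by field; rewrite gt_eqF.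
have : forall i : 'I_d.+1, exists q : rat, `|tnth y i - ratr q| < e'.
  move=> i; have : tnth y i - e' < tnth y i + e' by lra.
  move=> /rat_in_itvoo[q]; rewrite inE /= => /itvP h; exists q.
  have h1 : tnth y i - e' < ratr q by rewrite h.
  have h2 : ratr q < tnth y i + e' by rewrite h.
  by rewrite ltr_norml; apply/andP; split; lra.
move=> /choice[q hq].
have sqr_le (a b : R) : `|a| <= b -> a ^+ 2 <= b ^+ 2.
  by move=> ab; rewrite -[a ^+ 2]real_normK ?num_real//; apply: lerXn2r; rewrite ?nnegrE// (le_trans _ ab).
have sum_cst (a : R) : \sum_(i < d.+1) a = d.+1%:R * a by rewrite sumr_const card_ord mulr_natl.
exists ([tuple q i | i < d.+1], N); split.
  rewrite /rat_ball /= -exprVn -/e; apply: (@le_lt_trans _ _ (\sum_(i < d.+1) e' ^+ 2)).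
    by apply: ler_sum => i _; rewrite tnth_mktuple sqr_le// ltW.
  rewrite sum_cst; have : 1 <= d.+1%:R :> R by rewrite (ler_nat R 1).
  by move: (d.+1%:R : R) Ee' => D Ee' D1; rewrite -Ee'; nra.
move=> z; rewrite /rat_ball /= -exprVn -/e => hz.
have dist_i i : `|tnth y i - tnth z i| <= 2 * e.
  have hy : `|tnth y i - ratr (q i)| <= e.
    apply: le_trans (ltW (hq i)) _; rewrite -Ee'; have : 1 <= d.+1%:R :> R by rewrite (ler_nat R 1).
    by move: (d.+1%:R : R) => D D1; nra.
  have hzi : `|tnth z i - ratr (q i)| <= e.
    rewrite -(@ler_pXn2r _ 2)// ?nnegrE// ?(ltW ep)// real_normK ?num_real//.
    apply: le_trans (ltW hz); rewrite (bigD1 i)//= tnth_mktuple lerDl.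
    by apply: sumr_ge0 => j _; exact: sqr_ge0.
  by move: hy hzi; rewrite !ler_norml => /andP[? ?] /andP[? ?]; apply/andP; split; lra.
apply: le_lt_trans hN; rewrite -/e.
have e2 : 0 <= 2 * d.+1%:R * e by rewrite !mulr_ge0// ltW.
rewrite -(ger0_norm e2) -sqrtr_sqr /dist; apply: ler_wsqrtr.
apply: (@le_trans _ _ (\sum_(i < d.+1) (2 * e) ^+ 2)).
  by apply: ler_sum => i _; exact: sqr_le.
rewrite sum_cst; have : 1 <= d.+1%:R :> R by rewrite (ler_nat R 1).
move: (d.+1%:R : R) => D D1; have -> : (2 * D * e) ^+ 2 = D * (D * (2 * e) ^+ 2) by ring.
by apply: ler_wpM2l; [lra|rewrite ler_peMl ?sqr_ge0].
Qed.

Lemma dist_coord x y i : `|tnth x i - tnth y i| <= dist x y.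
Proof.
rewrite -sqrtr_sqr /dist ler_wsqrtr// (bigD1 i)//= lerDl.
by apply: sumr_ge0 => j _; exact: sqr_ge0.
Qed.

Lemma pfun_lipschitz l f : pfun l f -> exists2 L, 0 <= L & forall x y, S x -> S y -> `|f x - f y| <= L * dist x y.
Proof.
have d0 x y : 0 <= dist x y by exact: sqrtr_ge0.
elim=> {l f}.
- by move=> c; exists 0 => // x y _ _; rewrite subrr normr0 mul0r.
- by move=> i; exists 1 => // x y _ _; rewrite mul1r dist_coord.
- move=> l f g _ [L L0 HL] _ [L' L'0 HL']; exists (L + L') => [|x y Sx Sy]; first exact: addr_ge0.
  have := HL x y Sx Sy; have := HL' x y Sx Sy.
  by rewrite !ler_norml mulrDl => /andP[? ?] /andP[? ?]; apply/andP; split; lra.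
- move=> l m f g pf [L L0 HL] pg [L' L'0 HL'].
  have [M HM] := pfun_bounded pf; have [M' HM'] := pfun_bounded pg.
  exists (`|M| * L' + `|M'| * L) => [|x y Sx Sy]; first by rewrite addr_ge0 ?mulr_ge0.
  have -> : f x * g x - f y * g y = f x * (g x - g y) + g y * (f x - f y) by ring.
  apply: le_trans (ler_normD _ _) _; rewrite !normrM mulrDl -!mulrA.
  apply: lerD; apply: ler_pM => //; rewrite ?HL ?HL'//.
  + exact: le_trans (HM x Sx) (ler_norm _).
  + exact: le_trans (HM' y Sy) (ler_norm _).
- by [].
Qed.

(** A superlevel set is the trace of the union of those rational balls on whose spherical part f
    exceeds c; the family is countable. *)
Lemma cont_on_sphere_measurable f : cont_on_sphere f -> measurable_fun S f.
Proof.
move=> cf mS; apply: (measurability _ (RGenOInfty.measurableE R)) => //.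
move=> /= _ [_ [c ->] <-]; rewrite preimage_itvoy.
pose F p := [set z | rat_ball p z /\ forall u, S u -> rat_ball p u -> c < f u].
have -> : S `&` [set y | c < f y] = S `&` \bigcup_p F p.
  apply/seteqP; split => y [Sy] /=.
    move=> cy; split=> //; have [eta e0 He] := cf y Sy (f y - c) ltac:(lra).
    have [p [py Hp]] := rat_ball_dense y e0; exists p => //; split=> // u Su /Hp/(He u Su).
    by rewrite ltr_norml => /andP[]; lra.
  by move=> [p _ [py Hp]]; split=> //; exact: Hp.
apply: measurableI => //; apply: countable_bigcupT_measurable; first exact: countableP.
move=> p; have [H|H] := pselect (forall u, S u -> rat_ball p u -> c < f u).
  have -> : F p = rat_ball p by apply/seteqP; split=> z //= [].
  exact: measurable_rat_ball.
have -> : F p = set0 by apply/seteqP; split=> z //= [].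
exact: measurable0.
Qed.

Lemma measurable_capS x (e : R) : measurable (capS x e).
Proof.
have [e0|e0] := ltP e 0.
  have -> : capS x e = set0; last exact: measurable0.
  apply/seteqP; split=> y //= [_]; rewrite leNgt => /negP; apply.
  by apply: lt_le_trans e0 _; exact: sqrtr_ge0.
have h : pfun 2 (fun z : @pt R d => \sum_i (tnth x i - tnth z i) ^+ 2).
  apply: pfun_sum => i; apply: (@pfun_exp R d 1 _ 2).
  by apply: pfun_sub; [exact: pfun_cst_le|exact: pfun_coord].
have -> : capS x e = S `&` [set y | \sum_i (tnth x i - tnth y i) ^+ 2 <= e ^+ 2].
  apply/seteqP; split=> y [Sy h']; split=> //=.
    rewrite -[leLHS]sqr_sqrtr; last by apply: sumr_ge0 => i _; exact: sqr_ge0.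
    by apply: lerXn2r; rewrite ?nnegrE ?sqrtr_ge0.
  by rewrite -(ger0_norm e0) -sqrtr_sqr ler_wsqrtr.
apply: measurableI; first exact: measurable_sphere.
have := measurable_pfun h measurableT (measurable_itv `]-oo, (e ^+ 2 : R)]).
by rewrite setTI; congr measurable; apply/seteqP; split => z; rewrite /= in_itv.
Qed.

Lemma capSP x y (e : R) : S x -> S y -> 0 <= e -> capS x e y <-> 2 * (1 - dot x y) <= e ^+ 2.
Proof.
move=> Sx Sy e0; rewrite -(dist_sphere Sx Sy); split=> [[_ h]|h].
  by apply: lerXn2r; rewrite ?nnegrE// /dist sqrtr_ge0.
split=> //; rewrite -(@ler_pXn2r _ 2)// nnegrE /dist ?sqrtr_ge0//.
Qed.

Lemma sphere_point_at x (rho : R) : (0 < d)%N -> S x -> 0 < rho <= 1 ->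
  exists y, [/\ S y, dist x y = rho & y <> x].
Proof.
move=> d0 Sx /andP[rho0 h1]; have [w Sw xw] := orth_unit x d0.
pose t : R := 1 - rho ^+ 2 / 2; pose s : R := Num.sqrt (1 - t ^+ 2).
have tb : 0 <= t <= 1.
  have : rho ^+ 2 <= 1 by rewrite expr_le1// ltW.
  by have := sqr_ge0 rho; rewrite /t; move: (rho ^+ 2) => e' *; apply/andP; split; lra.
have ts : t ^+ 2 + s ^+ 2 = 1.
  by rewrite sqr_sqrtr; [ring|case/andP: tb => ? ?; nra].
have xx : dot x x = 1 by exact: Sx.
have Sy : S (circ x w t s) by exact: sphere_circ.
have dxy : dist x (circ x w t s) = rho.
  apply/eqP; rewrite -(@eqrXn2 _ 2)//; [|exact: sqrtr_ge0|exact: ltW].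
  by rewrite (dist_sphere Sx Sy) dot_circ xw mulr0 addr0 xx mulr1 /t; apply/eqP; field.
exists (circ x w t s); split=> // yx; have := dist_sphere Sx Sx; rewrite -{2}yx dxy.
by rewrite xx subrr mulr0 => /eqP; rewrite sqrf_eq0 gt_eqF.
Qed.

(** The local deviation ignores the centre; continuity of f and g recovers equality there from
    points at small distance rho. *)
Lemma approx_at_center x f g (r L e : R) l : (0 < d)%N -> 0 < r -> 0 < e -> S x ->
  cont_on_sphere f -> pfun l g ->
  (forall y, capS x e y -> y <> x -> `|f y - g y| <= L * dist x y `^ r) -> f x = g x.
Proof.
move=> d0 r0 e0 Sx cf pg H; apply/eqP; rewrite -subr_eq0 -normr_eq0; apply/negP => /negP fg.
pose a := `|f x - g x|; have a0 : 0 < a by rewrite lt_def fg normr_ge0.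
have [eta eta0 Heta] := cf x Sx (a / 4) ltac:(lra).
have [Lg Lg0 HLg] := pfun_lipschitz pg.
(* For rho <= q and rho <= p, both L rho^r and the Lipschitz variation of g are at most a/4; with
   a/4 from the continuity of f the total stays below a. *)
pose q := (a / (4 * (`|L| + 1))) `^ r^-1.
have L1 : 0 < `|L| + 1 by rewrite ltr_wpDl.
have q0 : 0 < q by rewrite powR_gt0// divr_gt0// mulr_gt0.
pose p := a / (4 * (Lg + 1)).
have Lgp : 0 < Lg + 1 by rewrite ltr_wpDl.
have p0 : 0 < p by rewrite divr_gt0// mulr_gt0.
have [rho [rho0 h1 h2 h3 [h4 h5]]] : exists rho : R, [/\ 0 < rho, rho <= 1, rho < eta, rho <= e & rho <= q /\ rho <= p].
  exists (Num.min 1 (Num.min (eta / 2) (Num.min e (Num.min q p)))).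
  by split; rewrite ?lt_min ?ge_min ?gt_min ?lexx ?orbT ?ltr01 ?e0 ?q0 ?p0 ?divr_gt0//;
    rewrite ?gtr_pMr ?invf_lt1 ?ltr1n ?orbT.
have [y [Sy dxy yx]] := sphere_point_at d0 Sx (introT andP (conj rho0 h1)).
have c1 := Heta y Sy; rewrite dxy in c1; have {}c1 := c1 h2.
have c2 := H y _ yx; rewrite /capS /= dxy in c2; have {}c2 := c2 (conj Sy h3).
have c3 := HLg y x Sy Sx.
have dyx : dist y x = rho.
  by rewrite -dxy /dist; congr Num.sqrt; apply: eq_bigr => i _; ring.
rewrite dyx in c3.
have k1 : L * rho `^ r <= a / 4.
  apply: (@le_trans _ _ ((`|L| + 1) * q `^ r)).
    apply: (@le_trans _ _ (`|L| * rho `^ r)); first by rewrite ler_wpM2r ?powR_ge0// ler_norm.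
    apply: ler_pM; rewrite ?powR_ge0 ?lerDl//.
    by apply: ge0_ler_powR; rewrite ?nnegrE// ltW.
  rewrite /q -powRrM mulVf ?gt_eqF// powRr1 ?divr_ge0 ?mulr_ge0 ?(ltW a0) ?(ltW L1)//.
  by rewrite le_eqVlt; apply/orP; left; apply/eqP; field; rewrite gt_eqF.
have k2 : Lg * rho <= a / 4.
  apply: (@le_trans _ _ ((Lg + 1) * p)); first by apply: ler_pM => //; lra.
  by rewrite /p le_eqVlt; apply/orP; left; apply/eqP; field; rewrite gt_eqF.
have : a <= `|f x - f y| + `|f y - g y| + `|g y - g x|.
  rewrite /a; have -> : f x - g x = (f x - f y) + (f y - g y) + (g y - g x) by ring.
  by apply: le_trans (ler_normD _ _) _; rewrite lerD2r ler_normD.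
lra.
Qed.

End SphereContinuity.

(** * Pointwise estimates *)

Section PowerFactor.
Context {R : realType} (r n : R) (i0 : nat).
Hypothesis r0 : 0 < r.
Hypothesis i0_gt0 : (0 < i0)%N.
Hypothesis r_lt : r < (2 * i0)%:R.
Hypothesis i0_le : i0%:R <= r / 2 + 1.
Hypothesis n_ge : 4 * (r + 1) <= n.
Local Notation G := (power_poly n i0).
Local Notation g0 := (i0.+1%:R ^+ i0 : R).
Implicit Types t : R.

Let n4 : 4 <= n. Proof. by have := r0; have := n_ge; lra. Qed.

Lemma truncn_i0 : (i0 <= Num.truncn n)%N.
Proof. by rewrite truncn_ge_nat; have := n_ge; have := i0_le; have := r0; lra. Qed.

Lemma truncn_sub_ge : n / 2 <= (Num.truncn n - i0)%:R.
Proof.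
have h := truncnS_gt n; rewrite -natr1 in h.
by rewrite natrB ?truncn_i0//; have := n_ge; have := i0_le; have := r0; lra.
Qed.

Let g0_ge0 : 0 <= g0. Proof. exact: exprn_ge0. Qed.

Let v01 t : -1 <= t <= 1 -> 0 <= (1 + t) / 2 <= 1.
Proof. by move=> /andP[t1 t2]; apply/andP; split; lra. Qed.

Lemma power_factor_near t : -1 <= t <= 1 ->
  `|((1 + t) / 2) `^ n - G.[t]| <= g0 * (1 - t) `^ (r / 2).
Proof.
move=> ht; have /andP[t1 t2] := ht; have /andP[v0 v1] := v01 ht.
apply: le_trans (power_poly_error _ truncn_i0 ht) _; first by have := n4; lra.
have w0 : 0 <= (1 - t) / 2 by lra.
apply: (@le_trans _ _ (g0 * ((1 - t) / 2) ^+ i0)).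
  by rewrite ler_piMl ?mulr_ge0 ?exprn_ge0// exprn_ile1.
apply: ler_wpM2l => //.
have rr := r0; have rl := r_lt; rewrite natrM in rl.
apply: (@le_trans _ _ (((1 - t) / 2) `^ (r / 2))); last first.
  by apply: ge0_ler_powR; rewrite ?nnegrE; lra.
have [->|wn] := eqVneq ((1 - t) / 2) 0; first by rewrite expr0n gtn_eqF ?powR_ge0.
have wp : 0 < (1 - t) / 2 by rewrite lt_def wn.
rewrite -powR_mulrn//; apply: ger_powR; first by apply/andP; split; lra.
lra.
Qed.

Lemma power_factor_bound t : -1 <= t <= 1 -> `|G.[t]| <= 1 + g0.
Proof.
move=> ht; have /andP[t1 t2] := ht; have /andP[v0 v1] := v01 ht.
have n0 : 0 <= n by have := n4; lra.
have h := power_poly_error n0 truncn_i0 ht.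
have w0 : 0 <= (1 - t) / 2 by lra.
have h1 : ((1 + t) / 2) ^+ (Num.truncn n - i0) * (g0 * ((1 - t) / 2) ^+ i0) <= g0.
  rewrite -[leRHS]mul1r; apply: ler_pM; rewrite ?mulr_ge0 ?exprn_ge0 ?exprn_ile1//.
  by rewrite ler_piMr// exprn_ile1//; lra.
have h2 : ((1 + t) / 2) `^ n <= 1.
  apply: (@le_trans _ _ (1 `^ n)); last by rewrite powR1.
  by apply: ge0_ler_powR; rewrite ?nnegrE.
have h3 := powR_ge0 ((1 + t) / 2) n.
by move: (le_trans h h1); rewrite !ler_norml => /andP[? ?]; apply/andP; split; lra.
Qed.

(** From v <= e^(-u/2), u >= 8 r ln n / n and a remaining exponent at least n/2 comes v^N <=
    n^(-2r). One factor n^(-r) will pay for the growth of P, the other for u^(r/2). *)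
Lemma power_factor_far t : -1 <= t <= 1 -> 8 * r * ln n / n <= 1 - t ->
  ((1 + t) / 2) `^ n <= n `^ (- (2 * r)) /\ `|G.[t]| <= (1 + g0) * n `^ (- (2 * r)).
Proof.
move=> ht far; have /andP[t1 t2] := ht; have /andP[v0 v1] := v01 ht.
have n0 : 0 < n by have := n4; lra.
set v := (1 + t) / 2; set N := (Num.truncn n - i0)%N.
have hN : v ^+ N <= n `^ (- (2 * r)).
  have hv : v <= expR (- ((1 - t) / 2)).
    apply: le_trans (expR_ge1Dx _); rewrite /v; lra.
  apply: (@le_trans _ _ (expR (- ((1 - t) / 2)) ^+ N)).
    by apply: lerXn2r; rewrite ?nnegrE ?expR_ge0.
  rewrite -expRM_natl /powR gt_eqF// ler_expR mulrN mulNr lerN2.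
  have far' : 8 * r * ln n <= (1 - t) * n by move: far; rewrite ler_pdivrMr.
  have hb := truncn_sub_ge; rewrite -/N in hb.
  have u0 : 0 <= (1 - t) / 2 by lra.
  apply: (@le_trans _ _ (n / 2 * ((1 - t) / 2))); first lra.
  exact: ler_wpM2r.
have hvn : v `^ n <= v ^+ N.
  have [->|vn] := eqVneq v 0; first by rewrite powR0 ?gt_eqF// exprn_ge0.
  rewrite -powR_mulrn//; apply: ger_powR; first by rewrite lt_def vn v0 v1.
  apply: le_trans (_ : (Num.truncn n)%:R <= _); first by rewrite ler_nat leq_subr.
  by rewrite truncn_le// ltW.
split; first exact: le_trans hvn hN.
have h := power_poly_error (ltW n0) truncn_i0 ht; rewrite -/v -/N in h.
have w0 : 0 <= (1 - t) / 2 by lra.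
have h1 : v ^+ N * (g0 * ((1 - t) / 2) ^+ i0) <= v ^+ N * g0.
  apply: ler_wpM2l; first exact: exprn_ge0.
  by rewrite ler_piMr// exprn_ile1//; lra.
have h3 := powR_ge0 v n.
have h4 : v ^+ N * g0 <= n `^ (- (2 * r)) * g0 by exact: ler_wpM2r.
by move: (le_trans h h1); rewrite !ler_norml => /andP[? ?]; apply/andP; split; lra.
Qed.

End PowerFactor.

Section Pointwise.
Context {R : realType} (r : R).
Hypothesis r0 : 0 < r.
Context (i0 : nat).
Hypothesis i0_gt0 : (0 < i0)%N.
Hypothesis r_lt : r < (2 * i0)%:R.
Hypothesis i0_le : i0%:R <= r / 2 + 1.
Local Notation g0 := (i0.+1%:R ^+ i0 : R).

(** Together with n^r it bounds (16(l+1)/h)^l from [circle_growth], as l < r and the cap depth h is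
    at least min(8r, 1)/n. *)
Definition growth_const : R := (16 * (r + 1) / Num.min (8 * r) 1) `^ r.
(** Outside the cap u >= 8r/n, so n^(-r) <= n^(-r/2) is at most this constant times u^(r/2). *)
Definition far_const : R := (8 * r) `^ (- (r / 2)).
Definition pointwise_const : R :=
  2 `^ r * (1 + g0) + g0 + (2 * 2 `^ r * growth_const * (1 + g0) * far_const + far_const).

Context (d : nat) (n : R).
Hypothesis d0 : (0 < d)%N.
Hypothesis n_ge : 4 * (r + 1) <= n.
Context (x : @pt R d) (f P : @pt R d -> R) (l : nat) (F L : R).
Local Notation S := (@sphere R d).
Local Notation delta := (Num.sqrt (16 * r * ln n / n)).
Local Notation G := (power_poly n i0).
Hypothesis Sx : S x.
Hypothesis pP : pfun l P.
Hypothesis lr : l%:R < r.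
Hypothesis fF : forall y, S y -> `|f y| <= F.
Hypothesis L0 : 0 <= L.
Hypothesis fP : forall y, capS x delta y -> `|f y - P y| <= L * dist x y `^ r.

Let n4 : 4 <= n. Proof. by have := r0; have := n_ge; lra. Qed.
Let F0 : 0 <= F. Proof. exact: le_trans (normr_ge0 _) (fF Sx). Qed.
Let ln1 : 1 <= ln n.
Proof.
rewrite -ler_expR lnK ?posrE; last by have := n4; lra.
exact: le_trans expR1_le4 n4.
Qed.
Let delta_ge0 : 0 <= 16 * r * ln n / n.
Proof. by have := ln1; have := n4; have := r0 => *; rewrite divr_ge0 ?mulr_ge0//; lra. Qed.

Lemma cap_latitude y : S y -> capS x delta y <-> 1 - dot x y <= 8 * r * ln n / n.
Proof.
move=> Sy; rewrite (capSP Sx Sy (sqrtr_ge0 _)) sqr_sqrtr//.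
have -> : 16 * r * ln n / n = 2 * (8 * r * ln n / n) by ring.
by rewrite ler_pM2l.
Qed.

Lemma dist_powR y : S y -> dist x y `^ r = 2 `^ (r / 2) * (1 - dot x y) `^ (r / 2).
Proof.
move=> Sy; have /andP[_ t2] := cauchy_schwarz_sphere Sx Sy.
rewrite -powRM//; last lra.
by rewrite -(dist_sphere Sx Sy) -powR_mulrn ?sqrtr_ge0// -powRrM; congr (_ `^ _); field.
Qed.

Lemma pointwise_near y : S y -> capS x delta y ->
  `|P y * G.[dot x y] - f y * ((1 + dot x y) / 2) `^ n| <=
  (2 `^ r * (1 + g0) + g0) * (F + L) * (1 - dot x y) `^ (r / 2).
Proof.
move=> Sy cy; have ht := cauchy_schwarz_sphere Sx Sy.
have h1 := power_factor_near r0 i0_gt0 r_lt i0_le n_ge ht.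
have h2 := power_factor_bound r0 i0_le n_ge ht.
have h3 := fP cy; rewrite dist_powR// in h3.
have h4 := fF Sy.
set V := ((1 + dot x y) / 2) `^ n in h1 *; set u := (1 - dot x y) `^ (r / 2) in h1 h3 *.
have u0 : 0 <= u by exact: powR_ge0.
have -> : P y * G.[dot x y] - f y * V = - (f y - P y) * G.[dot x y] - f y * (V - G.[dot x y]) by ring.
apply: le_trans (ler_normB _ _) _; rewrite !normrM normrN.
have p2 : 2 `^ (r / 2) <= 2 `^ r :> R by apply: ler_powR; [lra|have := r0; lra].
have p20 : 0 <= 2 `^ (r / 2) :> R by exact: powR_ge0.
have gg : 0 <= g0 by exact: exprn_ge0.
have F0' := F0.
have k1 : `|f y - P y| * `|G.[dot x y]| <= (L * (2 `^ r * u)) * (1 + g0).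
  apply: ler_pM => //; apply: le_trans h3 _; apply: ler_wpM2l => //.
  exact: ler_wpM2r.
have k2 : `|f y| * `|V - G.[dot x y]| <= F * (g0 * u) by exact: ler_pM.
have k3 : 0 <= F * (2 `^ r * u) * (1 + g0).
  by rewrite !mulr_ge0 ?powR_ge0 ?addr_ge0.
have k4 : 0 <= L * (g0 * u) by rewrite !mulr_ge0.
apply: le_trans (lerD k1 k2) _; lra.
Qed.

Lemma far_decay y : S y -> ~ capS x delta y -> n `^ (- r) <= far_const * (1 - dot x y) `^ (r / 2).
Proof.
move=> Sy /(cap_latitude Sy)/negP; rewrite -ltNge => far.
have np : 0 < n by have := n4; lra.
have r0' := r0; have l1 := ln1.
have h : 8 * r / n <= 1 - dot x y.
  by apply: le_trans (ltW far); rewrite ler_pM2r ?invr_gt0// ler_peMr//; lra.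
rewrite /far_const [X in X * _]powRN.
have c8 : 0 < (8 * r) `^ (r / 2) by rewrite powR_gt0; lra.
rewrite [leRHS]mulrC ler_pdivlMr//.
apply: (@le_trans _ _ ((8 * r / n) `^ (r / 2))); last first.
  apply: ge0_ler_powR; rewrite ?nnegrE//; first lra.
    by rewrite divr_ge0 ?(ltW np)//; lra.
  by apply: le_trans h; rewrite divr_ge0 ?(ltW np)//; lra.
rewrite [leRHS]powRM ?invr_ge0 ?(ltW np)//; last lra.
rewrite [leRHS]mulrC ler_pM2r// -powR_inv1 ?(ltW np)// -powRrM mulN1r.
by apply: ler_powR; have := n4; lra.
Qed.

Lemma growth_outside y : S y -> `|P y| <= 2 * 2 `^ r * growth_const * (F + L) * n `^ r.
Proof.
move=> Sy; have [w [Sw xw yE]] := circ_decomposition d0 Sx Sy.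
have np : 0 < n by have := n4; lra.
have r0' := r0; have l1 := ln1.
(* The depth of the cap, cut at 1 as [circle_growth] demands. *)
pose h : R := Num.min (8 * r * ln n / n) 1.
have m0 : 0 < Num.min (8 * r) 1 by rewrite lt_min ltr01; apply/andP; split; lra.
have hm : Num.min (8 * r) 1 / n <= h.
  rewrite /h le_min; apply/andP; split.
    rewrite ler_pM2r ?invr_gt0//; apply: (@le_trans _ _ (8 * r)); first by rewrite ge_min lexx.
    by rewrite ler_peMr//; lra.
  by rewrite ler_pdivrMr// mul1r; apply: (@le_trans _ _ 1); [rewrite ge_min lexx orbT|have := n4; lra].
have h0 : 0 < h by apply: lt_le_trans hm; rewrite divr_gt0.
have h1 : 0 < h <= 1 by rewrite h0 /h ge_min lexx orbT.
pose M := F + L * 2 `^ r.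
have HM z : S z -> 1 - h <= dot x z -> `|P z| <= M.
  move=> Sz hz; have cz : capS x delta z.
    apply/(cap_latitude Sz); apply: (@le_trans _ _ h); first lra.
    by rewrite /h ge_min lexx.
  have := fP cz; have := fF Sz.
  have : L * dist x z `^ r <= L * 2 `^ r.
    apply: ler_wpM2l => //; have /andP[t1 t2] := cauchy_schwarz_sphere Sx Sz.
    apply: ge0_ler_powR; rewrite ?nnegrE ?sqrtr_ge0//; first lra.
    rewrite -(@ler_pXn2r _ 2)// ?nnegrE ?sqrtr_ge0// (dist_sphere Sx Sz); lra.
  by rewrite /M !ler_norml => ? /andP[? ?] /andP[? ?]; apply/andP; split; lra.
have ts : dot x y ^+ 2 + Num.sqrt (1 - dot x y ^+ 2) ^+ 2 = 1.
  rewrite sqr_sqrtr; first by ring.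
  by have /andP[t1 t2] := cauchy_schwarz_sphere Sx Sy; nra.
rewrite {1}yE; apply: le_trans (circle_growth Sx Sw xw pP h1 HM ts) _.
pose B := 16 * (r + 1) / Num.min (8 * r) 1.
have B0 : 0 <= B by rewrite divr_ge0 ?(ltW m0)//; lra.
have hB : 16 * l.+1%:R / h <= B * n.
  rewrite ler_pdivrMr//; apply: (@le_trans _ _ (B * n * (Num.min (8 * r) 1 / n))).
    have -> : B * n * (Num.min (8 * r) 1 / n) = 16 * (r + 1) by rewrite /B; field; rewrite !gt_eqF.
    by rewrite -natr1; have := lr; lra.
  by apply: ler_wpM2l => //; rewrite mulr_ge0// ltW.
(* A base at least 1 allows the exponent l to be raised to r. *)
have hB1 : 1 <= 16 * l.+1%:R / h.
  rewrite ler_pdivlMr// mul1r; have /andP[_ hh] := h1; apply: (le_trans hh).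
  have : 1 <= l.+1%:R :> R by rewrite (ler_nat R 1).
  lra.
have hE : (16 * l.+1%:R / h) ^+ l <= growth_const * n `^ r.
  rewrite /growth_const -/B -powRM ?(ltW np)// -powR_mulrn; last lra.
  apply: (@le_trans _ _ ((16 * l.+1%:R / h) `^ r)).
    by apply: ler_powR => //; exact: ltW lr.
  by apply: ge0_ler_powR; rewrite ?nnegrE//; lra.
have p2 : 1 <= 2 `^ r :> R by rewrite -[leLHS](powRr0 2); apply: ler_powR; [lra|exact: (ltW r0)].
have ML : 2 * M <= 2 * 2 `^ r * (F + L).
  have F0' := F0; have : F <= F * 2 `^ r by rewrite ler_peMr.
  rewrite /M; lra.
have M0 : 0 <= 2 * M.
  by rewrite mulr_ge0// /M addr_ge0 ?mulr_ge0 ?powR_ge0 ?F0.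
apply: le_trans (ler_pM M0 _ ML hE) _; first by rewrite exprn_ge0// (le_trans _ hB1).
by rewrite le_eqVlt; apply/orP; left; apply/eqP; ring.
Qed.

Lemma pointwise_far y : S y -> ~ capS x delta y ->
  `|P y * G.[dot x y]| <= 2 * 2 `^ r * growth_const * (1 + g0) * far_const * (F + L) * (1 - dot x y) `^ (r / 2) /\
  `|f y * ((1 + dot x y) / 2) `^ n| <= far_const * (F + L) * (1 - dot x y) `^ (r / 2).
Proof.
move=> Sy cy; have ht := cauchy_schwarz_sphere Sx Sy.
have far : 8 * r * ln n / n <= 1 - dot x y.
  by move: cy => /(cap_latitude Sy)/negP; rewrite -ltNge => /ltW.
have [hV hG] := power_factor_far r0 i0_le n_ge ht far.
have hd := far_decay Sy cy; have hP := growth_outside Sy.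
have np : 0 < n by have := n4; lra.
have F0' := F0.
have gg : 0 <= g0 by exact: exprn_ge0.
set u := (1 - dot x y) `^ (r / 2) in hd *.
have nr : n `^ (- (2 * r)) = n `^ (- r) * n `^ (- r).
  rewrite -powRD; first by congr (_ `^ _); ring.
  by apply/implyP => _; rewrite gt_eqF.
have n1 : n `^ r * n `^ (- r) = 1 by rewrite powRN divff// gt_eqF// powR_gt0.
have gc0 : 0 <= growth_const by exact: powR_ge0.
split; rewrite normrM.
  apply: le_trans (ler_pM _ _ hP hG) _ => //.
  have -> : 2 * 2 `^ r * growth_const * (F + L) * n `^ r * ((1 + g0) * n `^ (- (2 * r))) =
    2 * 2 `^ r * growth_const * (1 + g0) * (F + L) * (n `^ r * n `^ (- r)) * n `^ (- r).
    by rewrite nr; ring.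
  rewrite n1 mulr1.
  have -> : 2 * 2 `^ r * growth_const * (1 + g0) * far_const * (F + L) * u =
    2 * 2 `^ r * growth_const * (1 + g0) * (F + L) * (far_const * u) by ring.
  by apply: ler_wpM2l => //; rewrite !mulr_ge0 ?powR_ge0 ?addr_ge0.
apply: (@le_trans _ _ ((F + L) * n `^ (- r))); last first.
  by rewrite [far_const * _]mulrC -mulrA; apply: ler_wpM2l => //; rewrite addr_ge0.
apply: ler_pM => //; first by apply: le_trans (fF Sy) _; rewrite lerDl.
rewrite ger0_norm ?powR_ge0//; apply: le_trans hV _.
by apply: ler_powR; [have := n4; lra|have := r0; lra].
Qed.

Lemma pointwise_const_gt0 : 0 < pointwise_const.
Proof.
have gg : 0 <= g0 by exact: exprn_ge0.
rewrite /pointwise_const; apply: ltr_pwDl; last first.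
  by rewrite addr_ge0 ?mulr_ge0 ?powR_ge0 ?addr_ge0.
by apply: ltr_pwDl => //; rewrite mulr_gt0 ?powR_gt0// ltr_pwDl.
Qed.

(** The second estimate serves the integral over the cap: inside nothing changes, outside only the
    term with P and G remains. *)
Lemma pointwise_bound y : S y ->
  `|P y * G.[dot x y] - f y * ((1 + dot x y) / 2) `^ n| <=
    pointwise_const * (F + L) * (1 - dot x y) `^ (r / 2) /\
  `|P y * G.[dot x y] - f y * ((1 + dot x y) / 2) `^ n * \1_(capS x delta) y| <=
    pointwise_const * (F + L) * (1 - dot x y) `^ (r / 2).
Proof.
move=> Sy; have F0' := F0.
have FL : 0 <= F + L by rewrite addr_ge0.
have gg : 0 <= g0 by exact: exprn_ge0.
have gc0 : 0 <= growth_const by exact: powR_ge0.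
have fc0 : 0 <= far_const by exact: powR_ge0.
have p2 : 0 <= 2 `^ r :> R by exact: powR_ge0.
set u := (1 - dot x y) `^ (r / 2); have u0 : 0 <= u by exact: powR_ge0.
pose a := 2 `^ r * (1 + g0) + g0.
pose b := 2 * 2 `^ r * growth_const * (1 + g0) * far_const.
have a0 : 0 <= a by rewrite addr_ge0 ?mulr_ge0 ?addr_ge0.
have b0 : 0 <= b by rewrite !mulr_ge0 ?addr_ge0.
have FLu : 0 <= (F + L) * u by exact: mulr_ge0.
have E : pointwise_const * (F + L) * u = a * ((F + L) * u) + b * ((F + L) * u) + far_const * ((F + L) * u).
  by rewrite /pointwise_const -/a -/b; ring.
have ha := mulr_ge0 a0 FLu; have hb := mulr_ge0 b0 FLu; have hf := mulr_ge0 fc0 FLu.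
rewrite E; have [cy|cy] := pselect (capS x delta y).
  have h := pointwise_near Sy cy; rewrite -/u -/a -mulrA in h.
  by rewrite indicE mem_set// mulr1; split; apply: (le_trans h); lra.
have [h1 h2] := pointwise_far Sy cy; rewrite -/u -/b -mulrA in h1; rewrite -/u -mulrA in h2.
rewrite indicE memNset// mulr0 subr0; split; last by apply: (le_trans h1); lra.
by apply: le_trans (ler_normB _ _) _; lra.
Qed.

End Pointwise.

(** Arbitrary majorants F, L, c replace the sup norm, the local deviation and the
    Marcinkiewicz-Zygmund norm: the last two are infima, to be approached only at the very end. *)
Lemma error_bound (R : realType) (r : R) : 0 < r -> exists2 C : R, 0 < C &
  forall (d : nat) (x : @pt R d) (f Q : @pt R d -> R) (n : R) (k l : nat)
    (mu : {measure set (@pt R d) -> \bar R}) (J1 J2 : nat -> {poly R})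
    (nu : {charge set (@pt R d) -> \bar R}) (P N : set (@pt R d))
    (nuPN : hahn_decomposition nu P N) (F L c : R),
  (3 <= d)%N -> sphere d x -> is_sphere_measure mu ->
  is_jacobi (d%:R / 2 - 1) (d%:R / 2 - 1) J1 ->
  is_jacobi (d%:R / 2 + r) (d%:R / 2 - 2) J2 ->
  d%:R * n = k%:R -> (d%:R + r + 1) ^+ 2 <= n * d%:R ->
  measurable_fun (sphere d) f -> (forall y, sphere d y -> `|f y| <= F) ->
  pfun l Q -> l%:R < r -> 0 <= L ->
  (forall y, capS x (Num.sqrt (16 * r * ln n / n)) y -> `|f y - Q y| <= L * dist x y `^ r) ->
  f x = Q x ->
  (forall p, Pi d (2 * (d%:R + 2) * n) p ->
     (sint nuPN (sphere d) p = \int[mu]_(y in sphere d) (p y)%:E)%E) ->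
  0 <= c -> mzq_bound (2 * (d%:R + 2) * n) nuPN mu c ->
  let g := fun y => f y * Phi d n k J1 J2 (dot x y) in
  [/\ bmfun g,
      `|f x - charge_int nuPN g| <= C * n `^ (- r) * (F + L) * c &
      `|f x - charge_int nuPN (fun y => g y * \1_(capS x (Num.sqrt (16 * r * ln n / n))) y)| <=
         C * n `^ (- r) * (F + L) * c].
Proof.
move=> r0.
(* The least integer above r/2. *)
have [i0 [i0_gt0 r_lt i0_le]] : exists i0 : nat, [/\ (0 < i0)%N, r < (2 * i0)%:R & i0%:R <= r / 2 + 1].
  exists (Num.truncn (r / 2)).+1; split => //.
    by have h := truncnS_gt (r / 2); rewrite natrM; lra.
  by rewrite -natr1 lerD2r truncn_le; lra.
have [A A0 HA] := dyadic_upper r0 r_lt.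
pose C1 : R := 1 + 16 `^ r * 2 ^+ (2 * i0) * ((A + 2 * ((64 * i0%:R) ^+ 2) `^ r) *
     (2 * (8 * i0%:R ^+ 2) `^ r * expR 6)).
have C10 : 0 < C1.
  by rewrite ltr_pwDl// !mulr_ge0 ?addr_ge0 ?mulr_ge0 ?exprn_ge0 ?powR_ge0 ?expR_ge0 ?(ltW A0).
have C20 := pointwise_const_gt0 r i0.
exists (pointwise_const r i0 * C1); first exact: mulr_gt0.
move=> d x f Q n k l mu J1 J2 nu P N nuPN F L c d3 Sx Hmu HJ1 HJ2 dnk nd mf fF pQ lr L0 fQ fx HX c0 Hc g.
have dR : 3 <= d%:R :> R by rewrite (ler_nat R 3).
have d2 : (2 <= d)%N by exact: ltnW.
have d0 : (0 < d)%N by exact: ltnW.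
have dp : 0 < d%:R :> R by lra.
have dn : d%:R <= n by rewrite -(ler_pM2r dp); nra.
have n_ge : 4 * (r + 1) <= n.
  rewrite -(ler_pM2r dp); apply: le_trans nd.
  have -> : (d%:R + r + 1) ^+ 2 = (d%:R - (r + 1)) ^+ 2 + 4 * (r + 1) * d%:R by ring.
  by rewrite lerDr sqr_ge0.
have np : 0 < n by lra.
have a1 : 1 <= d%:R / 2 + r by lra.
have [size1 lead1 orth1] := is_jacobi_Lam HJ1.
have mn0 : 0 <= (d%:R + 2) * n by rewrite mulr_ge0//; lra.
have [M [HM _ Mn]] := natceil mn0.
have in0 : i0%:R <= n by lra.
have [I [hI Ih]] := dyadic_scale i0_gt0 in0.
set delta := Num.sqrt _ in fQ *.
pose KP := Kpoly d J1 M; pose Pt := jacobi_normalized J2 k; pose G := power_poly n i0.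
pose V (y : @pt R d) := ((1 + dot x y) / 2) `^ n.
have J2n0 := jacobi_at1_neq0 a1 HJ2 k.
have gE : g = fun y => KP.[dot x y] * Pt.[dot x y] * (f y * V y).
  apply/funext => y; rewrite /g /Phi (Kker_Kpoly _ d2 mn0 HM) /Pt /jacobi_normalized hornerZ /V -/KP.
  ring.
have bz T : bmfun (fun y : @pt R d => T.[dot x y]) := bmfun_zonal x T.
have bV : bmfun V.
  apply: bmfun_powR; first exact: ltW.
    have := bz (half_plus (R := R)); congr bmfun; apply/funext => y; exact: half_plusE.
  by move=> y Sy; have /andP[t1 t2] := cauchy_schwarz_sphere Sx Sy; lra.
have bf : bmfun f by split=> //; exists F.
have bg : bmfun g by rewrite gE; do 2?apply: bmfunM => //; exact: bmfunM.
have trn := truncn_i0 r0 i0_le n_ge.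
have tr0 : (0 < Num.truncn n)%N by exact: leq_trans trn.
have trle : (Num.truncn n)%:R <= n by rewrite truncn_le ltW.
have sG : (size G <= (Num.truncn n).-1.+1)%N by rewrite prednK//; exact: size_power_poly.
have sP : (size Pt <= k.+1)%N by rewrite size_polyZ_le//; have [->] := HJ2.1 k.
pose q := fun y => Pt.[dot x y] * (Q y * G.[dot x y]).
have pq : pfun (k + (l + (Num.truncn n).-1)) q.
  by apply: pfun_mul; [exact: pfun_zonal|apply: pfun_mul => //; exact: pfun_zonal].
have tr1 : (Num.truncn n).-1%:R + 1 <= n :> R by rewrite natr1 prednK.
(* The degrees dn, l < r and floor n - 1 add up to less than (d+2)n because r <= n, so the kernel
   reproduces q. *)
have qM : (k + (l + (Num.truncn n).-1) < M)%N.
  by rewrite HM !natrD -dnk; nra.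
have M0 : (0 < M)%N by exact: leq_trans qM.
have sK : (size KP <= M.-1.+1)%N by rewrite prednK//; exact: size_Kpoly.
pose Psi := fun y => KP.[dot x y] * q y.
have pPsi : pfun (M.-1 + (k + (l + (Num.truncn n).-1))) Psi.
  by apply: pfun_mul => //; exact: pfun_zonal.
have xx : dot x x = 1 by exact: Sx.
have qx : q x = f x.
  rewrite /q xx /Pt /jacobi_normalized hornerZ mulVf// mul1r power_poly1// mulr1.
  by rewrite fx.
(* Exactness replaces nu by the sphere measure, as both factors of Psi have degree below (d+2)n. *)
have TPsi : charge_int nuPN Psi = f x.
  rewrite (mzq_exact Hmu HX pPsi); first by rewrite (reproducing d2 size1 lead1 orth1 Hmu Sx pq qM).
  have hM : M.-1%:R < (d%:R + 2) * n by rewrite -HM prednK.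
  have hq : (k + (l + (Num.truncn n).-1))%:R < (d%:R + 2) * n by rewrite -HM.
  have -> : 2 * (d%:R + 2) * n = (d%:R + 2) * n + (d%:R + 2) * n by ring.
  by rewrite natrD; exact: ltrD.
have bPsi := pfun_bmfun pPsi.
pose u := fun y : @pt R d => (1 - dot x y) `^ (r / 2).
pose KPt := fun y : @pt R d => `|KP.[dot x y] * Pt.[dot x y]|.
have bu : bmfun u.
  apply: bmfun_powR; first lra.
    exact: pfun_bmfun (pfun_sub (pfun_cst_le 1 1) (pfun_dot x)).
  by move=> y Sy; have /andP[t1 t2] := cauchy_schwarz_sphere Sx Sy; lra.
have bKPt : bmfun KPt by apply: bmfun_norm; exact: bmfunM.
have F0 : 0 <= F by exact: le_trans (normr_ge0 _) (fF x Sx).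
have pb0 : 0 <= pointwise_const r i0 * (F + L).
  by apply: mulr_ge0; [exact: ltW C20|exact: addr_ge0].
have KV := kernel_variation r0 i0_gt0 r_lt d3 Hmu HJ1 HJ2 dn dnk Sx c0 Hc HM Mn A0 HA hI Ih.
rewrite -/C1 in KV.
have main g' : bmfun g' -> (forall y, sphere d y -> `|Psi y - g' y| <=
    pointwise_const r i0 * (F + L) * (KPt y * u y)) ->
    `|f x - charge_int nuPN g'| <= pointwise_const r i0 * C1 * n `^ (- r) * (F + L) * c.
  move=> bg' H; rewrite -TPsi -charge_intB//.
  have bKu := bmfunM bKPt bu.
  apply: le_trans (charge_int_le nuPN (bmfunB bPsi bg') (bmfunZ _ bKu) H) _.
  rewrite (SEZ (cvar_sphere_fin nuPN) _ bKu).
  apply: le_trans (ler_wpM2l pb0 KV) _.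
  by rewrite le_eqVlt; apply/orP; left; apply/eqP; ring.
have PW y : sphere d y -> _ := pointwise_bound r0 i0_gt0 r_lt i0_le d0 n_ge Sx pQ lr fF L0 fQ (y := y).
have PsiE y : Psi y = KP.[dot x y] * Pt.[dot x y] * (Q y * G.[dot x y]) by rewrite /Psi /q; ring.
have scale y a : `|a| <= pointwise_const r i0 * (F + L) * u y ->
    `|KP.[dot x y] * Pt.[dot x y] * a| <= pointwise_const r i0 * (F + L) * (KPt y * u y).
  by move=> ha; rewrite normrM -/(KPt y) [leRHS]mulrCA; apply: ler_wpM2l => //; exact: normr_ge0.
split=> //.
- apply: main => // y Sy; have [h _] := PW y Sy.
  by rewrite PsiE gE -mulrBr; exact: scale.
- apply: main => [|y Sy].
    by apply: bmfunM => //; apply: bmfun_indic; exact: measurable_capS.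
  have [_ h] := PW y Sy.
  by rewrite PsiE gE -[_ * _ * \1_ _ _]mulrA -mulrBr; exact: scale.
Qed.

(** * Dimension, infima and conclusion *)

Lemma dimPi_gt0 (R : realType) (d : nat) (m : R) (D : nat) (x : @pt R d) :
  sphere d x -> 0 < m -> is_dimPi d m D -> (0 < D)%N.
Proof.
move=> Sx m0 [b [_ _ span]].
have [c Hc] := span _ (pfun_Pi (pfun_cst 1) (m0 : 0%:R < m)).
rewrite lt0n; apply/negP => /eqP D0; have := Hc x Sx.
rewrite big1 => [/eqP|i _]; first by rewrite oner_eq0.
by have := ltn_ord i; rewrite {2}D0.
Qed.

(** The dimension is at most K(1) <= 2 (20n)^d <= (40n)^d, and the power r/d removes the exponential
    dependence on d. *)
Lemma dimPi_powR (R : realType) (r : R) (d : nat) (n : R) (D : nat)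
    (mu : {measure set (@pt R d) -> \bar R}) (J1 : nat -> {poly R}) :
  0 < r -> (3 <= d)%N -> 1 <= n -> is_sphere_measure mu ->
  is_jacobi (d%:R / 2 - 1) (d%:R / 2 - 1) J1 ->
  is_dimPi d (2 * (d%:R + 2) * n) D ->
  D%:R `^ (r / d%:R) <= 40 `^ r * n `^ r.
Proof.
move=> r0 d3 n1 Hmu HJ1 [b [Hb free _]].
have dR : 3 <= d%:R :> R by rewrite (ler_nat R 3).
have d2 : (2 <= d)%N by exact: ltnW.
have dp : 0 < d%:R :> R by lra.
have [size1 lead1 orth1] := is_jacobi_Lam HJ1.
have m0 : 0 < 2 * (d%:R + 2) * n by rewrite mulr_gt0//; lra.
have [M [HM _ Mn]] := natceil (ltW m0).
have pb i : exists2 l, pfun l (b i) & (l < M)%N.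
  by have [l pl lm] := Pi_pfun m0 (Hb i); exists l => //; rewrite HM.
have hD : D%:R <= (40 * n) ^+ d.
  apply: le_trans (gram_dim d2 size1 lead1 orth1 Hmu pb free) _.
  apply: le_trans (Kone_ub d2 size1 lead1 orth1 _) _.
  apply: (@le_trans _ _ (2 * (20 * n) ^+ d)).
    apply: ler_wpM2l => //; apply: lerXn2r; rewrite ?nnegrE.
    - by rewrite divr_ge0// mulr_ge0// addr_ge0.
    - by rewrite mulr_ge0//; lra.
    - by rewrite ler_pdivrMr//; nra.
  have -> : 40 * n = 2 * (20 * n) by ring.
  rewrite (exprMn _ 2); apply: ler_wpM2r; first by rewrite exprn_ge0// mulr_ge0//; lra.
  by rewrite -[leLHS]expr1; apply: ler_weXn2l; [lra|exact: leq_trans d2].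
rewrite -powRM; [|lra|lra].
apply: (@le_trans _ _ (((40 * n) ^+ d) `^ (r / d%:R))).
  by apply: ge0_ler_powR; rewrite ?nnegrE ?divr_ge0 ?exprn_ge0 ?mulr_ge0 ?(ltW r0)//; lra.
rewrite -powR_mulrn; last by rewrite mulr_ge0//; lra.
by rewrite -powRrM [d%:R * _]mulrC divfK ?gt_eqF.
Qed.

Lemma le_of_le_addM (R : realType) (e a b : R) : 0 <= b ->
  (forall eps, 0 < eps -> e <= a + b * eps) -> e <= a.
Proof.
move=> b0 H; apply/ler_addgt0Pr => eps eps0.
have b1 : 0 < b + 1 by lra.
apply: le_trans (H (eps / (b + 1)) (divr_gt0 eps0 b1)) _.
by rewrite lerD2l mulrA ler_pdivrMr// mulrC ler_pM2l//; lra.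
Qed.

(* The bound is tested on near minimizers of both infima. *)
Lemma le_mul_ereal_inf (R : realType) (e a F : R) (A B : set (\bar R)) :
  0 <= a -> 0 <= F -> (forall y, A y -> 0 <= y)%E -> (forall y, B y -> 0 <= y)%E ->
  (ereal_inf A < +oo)%E -> (ereal_inf B < +oo)%E ->
  (forall L c : R, 0 <= L -> 0 <= c -> (exists2 y, A y & (y <= L%:E)%E) ->
     (exists2 y, B y & (y <= c%:E)%E) -> e <= a * (F + L) * c) ->
  (e%:E <= a%:E * (F%:E + ereal_inf A) * ereal_inf B)%E.
Proof.
move=> a0 F0 A0 B0 Ai Bi H.
have iA : (0 <= ereal_inf A)%E by apply: le_ereal_inf_tmp => y; exact: A0.
have iB : (0 <= ereal_inf B)%E by apply: le_ereal_inf_tmp => y; exact: B0.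
have fA : ereal_inf A \is a fin_num by rewrite ge0_fin_numE.
have fB : ereal_inf B \is a fin_num by rewrite ge0_fin_numE.
have nA eps : 0 < eps -> exists2 y, A y & (y <= (fine (ereal_inf A) + eps)%:E)%E.
  move=> /lb_ereal_inf_adherent/(_ fA)[y Ay yl]; exists y => //.
  by rewrite EFinD fineK// ltW.
have nB eps : 0 < eps -> exists2 y, B y & (y <= (fine (ereal_inf B) + eps)%:E)%E.
  move=> /lb_ereal_inf_adherent/(_ fB)[y Ay yl]; exists y => //.
  by rewrite EFinD fineK// ltW.
have l0 : 0 <= fine (ereal_inf A) by exact: fine_ge0.
have c0 : 0 <= fine (ereal_inf B) by exact: fine_ge0.
rewrite -(fineK fA) -(fineK fB) -EFinD -!EFinM lee_fin.
move: (fine (ereal_inf A)) (fine (ereal_inf B)) nA nB l0 c0 => li ci nA nB l0 c0.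
apply: (@le_of_le_addM _ _ _ (a * (F + li))) => [|eps eps0]; first by rewrite mulr_ge0 ?addr_ge0.
apply: (@le_of_le_addM _ _ _ (a * (ci + eps))) => [|eta eta0].
  by rewrite mulr_ge0 ?addr_ge0 ?(ltW eps0).
have := H (li + eta) (ci + eps) _ _ (nA _ eta0) (nB _ eps0).
rewrite !addr_ge0 ?(ltW eps0) ?(ltW eta0)// => /(_ isT isT) h.
by apply: (le_trans h); rewrite le_eqVlt; apply/orP; left; apply/eqP; ring.
Qed.

Theorem theorem5p1 (R : realType) (r : R) (hr : 0 < r) :
  exists C : R, 0 < C /\
  forall (d : nat) (x : pt d) (f : pt d -> R) (delta n : R) (k : nat)
    (mu : {measure set pt d -> \bar R}) (J1 J2 : nat -> {poly R})
    (nu : {charge set pt d -> \bar R}) (P N : set (pt d))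
    (nuPN : hahn_decomposition nu P N) (D : nat),
    (3 <= d)%N ->
    sphere d x ->
    is_sphere_measure mu ->
    is_jacobi (d%:R / 2 - 1) (d%:R / 2 - 1) J1 ->
    is_jacobi (d%:R / 2 + r) (d%:R / 2 - 2) J2 ->
    cont_on_sphere f ->
    0 < delta ->
    (locnorm r x delta f < +oo)%E ->
    d%:R * n = k%:R ->
    (d%:R + r + 1) ^+ 2 <= n * d%:R ->
    charge_variation nuPN (~` sphere d) = 0%E ->
    MZQ d (2 * (d%:R + 2) * n) nuPN mu ->
    is_dimPi d (2 * (d%:R + 2) * n) D ->
    Num.sqrt (16 * r * ln n / n) <= delta ->
    let bound := ((C * powR d%:R (1 / 6) / powR D%:R (r / d%:R))%:E
                  * locnorm r x delta f
                  * mzq_norm (2 * (d%:R + 2) * n) nuPN mu)%E in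
    (`| (f x)%:E - sigma n k J1 J2 nuPN f x | <= bound)%E /\
    (`| (f x)%:E - sint nuPN (capS x (Num.sqrt (16 * r * ln n / n)))
                     (fun y => (Phi d n k J1 J2 (dot x y) * f y)%R) | <= bound)%E.
Proof.
have [C C0 HC] := error_bound hr.
exists (C * 40 `^ r); split; first by rewrite mulr_gt0 ?powR_gt0.
move=> d x f delta n k mu J1 J2 nu P N nuPN D d3 Sx Hmu HJ1 HJ2 cf delta0 floc dnk nd _ [HX [c1 [c10 Hc1]]] HD hdelta.
set m := 2 * (d%:R + 2) * n in HX Hc1 HD *; set dl := Num.sqrt _ in hdelta *.
have dR : 3 <= d%:R :> R by rewrite (ler_nat R 3).
have d0 : (0 < d)%N by exact: leq_trans d3.
have dp : 0 < d%:R :> R by lra.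
have dn : d%:R <= n by rewrite -(ler_pM2r dp); nra.
have np : 0 < n by exact: lt_le_trans dp dn.
have n1 : 1 <= n by apply: le_trans dn; lra.
have dge1 : 1 <= d%:R `^ (1 / 6) :> R.
  by rewrite -[leLHS](powRr0 d%:R); apply: ler_powR; lra.
have mf := cont_on_sphere_measurable cf.
have m0 : 0 < m by rewrite /m mulr_gt0//; lra.
pose A := [set locdev r x delta f Q | Q in Pi d r].
(* A point of the punctured cap: over an empty set the supremum in [locdev] would be -oo. *)
have [y0 [Sy0 xy0 y0x]] : exists y, [/\ sphere d y, dist x y = Num.min delta 1 & y <> x].
  by apply: sphere_point_at => //; rewrite lt_min delta0 ltr01 ge_min lexx orbT.
have A_ge0 y : A y -> (0 <= y)%E.
  move=> [Q _ <-]; apply: le_trans (ereal_sup_ubound _); last first.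
    exists y0 => //; split=> //; split=> //; by rewrite xy0 ge_min lexx.
  by rewrite lee_fin divr_ge0// powR_ge0.
have sup_ge0 : (0 <= supnorm f)%E.
  apply: le_trans (ereal_sup_ubound _); last by exists x.
  by rewrite lee_fin.
have inf_ge0 : (0 <= ereal_inf A)%E by apply: le_ereal_inf_tmp => y; exact: A_ge0.
have [sup_fin inf_fin] : (supnorm f < +oo)%E /\ (ereal_inf A < +oo)%E.
  move: floc; rewrite /locnorm -/A => h; split; apply: le_lt_trans h.
    exact: leeDl.
  exact: leeDr.
have fsup : supnorm f \is a fin_num by rewrite ge0_fin_numE.
pose F := fine (supnorm f).
have FE : supnorm f = F%:E by rewrite fineK.
have F0 : 0 <= F by exact: fine_ge0.
have fF y : sphere d y -> `|f y| <= F.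
  by move=> Sy; rewrite -lee_fin -FE; apply: ereal_sup_ubound; exists y.
pose a := C * 40 `^ r * powR d%:R (1 / 6) / powR D%:R (r / d%:R).
pose B := [set c%:E | c in [set c : R | 0 < c /\ mzq_bound m nuPN mu c]].
(* For D = 0 the divisor would be 0, and the quotient 0 by convention. *)
have D0 : (0 < D)%N := dimPi_gt0 Sx m0 HD.
have Dp : 0 < D%:R `^ (r / d%:R) by rewrite powR_gt0// ltr0n.
have a_ge : C * n `^ (- r) <= a.
  have h2 := dimPi_powR hr d3 n1 Hmu HJ1 HD; rewrite /a ler_pdivlMr//.
  apply: (@le_trans _ _ (C * n `^ (- r) * (40 `^ r * n `^ r))).
    by apply: ler_wpM2l; [rewrite mulr_ge0 ?powR_ge0 ?(ltW C0)|exact: h2].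
  have -> : C * n `^ (- r) * (40 `^ r * n `^ r) = C * 40 `^ r * (n `^ r * n `^ (- r)) by ring.
  rewrite powRN divff ?gt_eqF ?powR_gt0// mulr1 ler_peMr//.
  by rewrite mulr_ge0 ?powR_ge0 ?(ltW C0).
have a0 : 0 <= a by apply: le_trans a_ge; rewrite mulr_ge0 ?powR_ge0 ?(ltW C0).
pose g := fun y => f y * Phi d n k J1 J2 (dot x y).
have key L c : 0 <= L -> 0 <= c -> (exists2 y, A y & (y <= L%:E)%E) ->
    (exists2 y, B y & (y <= c%:E)%E) ->
    [/\ bmfun g, `|f x - charge_int nuPN g| <= a * (F + L) * c &
     `|f x - charge_int nuPN (fun y => g y * \1_(capS x dl) y)| <= a * (F + L) * c].
  move=> L0 c0 [_ [Q HQ <-] QL] [_ [c' [c'0 Hc'] <-]]; rewrite lee_fin => c'c.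
  have [l pQ lr] := Pi_pfun hr HQ.
  have fQ y : capS x delta y -> y <> x -> `|f y - Q y| <= L * dist x y `^ r.
    move=> cy yx; have dxy : 0 < dist x y.
      rewrite lt_def sqrtr_ge0 andbT; apply/negP => /eqP dxy; apply: yx.
      apply: eq_from_tnth => i; apply/eqP; rewrite eq_sym -subr_eq0 -normr_le0 -dxy.
      exact: dist_coord.
    rewrite -ler_pdivrMr ?powR_gt0// -lee_fin; apply: le_trans QL.
    by apply: ereal_sup_ubound; exists y.
  have fx : f x = Q x := approx_at_center d0 hr delta0 Sx cf pQ fQ.
  have fQ' y : capS x dl y -> `|f y - Q y| <= L * dist x y `^ r.
    move=> [Sy hy]; have [->|yx] := pselect (y = x).
      by rewrite fx subrr normr0 mulr_ge0 ?powR_ge0.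
    by apply: fQ => //; split=> //; exact: le_trans hdelta.
  have [bg h1 h2] := HC d x f Q n k l mu J1 J2 nu P N nuPN F L c' d3 Sx Hmu HJ1 HJ2 dnk nd mf fF pQ lr L0
    fQ' fx HX (ltW c'0) Hc'.
  have le1 : C * n `^ (- r) * (F + L) * c' <= a * (F + L) * c.
    apply: ler_pM => //; first by rewrite !mulr_ge0 ?powR_ge0 ?addr_ge0 ?(ltW C0).
      exact: ltW.
    by apply: ler_wpM2r => //; exact: addr_ge0.
  by split=> //; [exact: le_trans h1 le1|exact: le_trans h2 le1].
have B_ge0 y : B y -> (0 <= y)%E by move=> [c [c0 _] <-]; rewrite lee_fin ltW.
have Bfin : (ereal_inf B < +oo)%E.
  by apply: le_lt_trans (ltry c1); apply: ereal_inf_lbound; exists c1.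
(* This property of g involves neither L nor c, so one admissible pair suffices to extract it from
   [key]. *)
have bg : bmfun g.
  pose LL := fine (ereal_inf A) + 1.
  have fA : ereal_inf A \is a fin_num by rewrite ge0_fin_numE.
  have l0 : 0 <= fine (ereal_inf A) by exact: fine_ge0.
  have [] // := key LL c1 _ (ltW c10) _ _; first by rewrite addr_ge0.
    have [y Ay yl] := lb_ereal_inf_adherent ltr01 fA; exists y => //.
    by rewrite /LL EFinD fineK// ltW.
  by exists c1%:E => //; exists c1.
have boundE e : (forall L c : R, 0 <= L -> 0 <= c -> (exists2 y, A y & (y <= L%:E)%E) ->
     (exists2 y, B y & (y <= c%:E)%E) -> e <= a * (F + L) * c) ->
    (e%:E <= a%:E * locnorm r x delta f * mzq_norm m nuPN mu)%E.
  by rewrite /locnorm FE; exact: le_mul_ereal_inf.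
split.
  rewrite /sigma (sint_charge_int nuPN bg) -EFinB; apply: boundE => L c L0 c0 hA hB.
  by have [_ h _] := key L c L0 c0 hA hB.
rewrite sint_restrict; [|exact: measurable_capS|by move=> y []].
have -> : (fun y => Phi d n k J1 J2 (dot x y) * f y * \1_(capS x dl) y) =
    (fun y => g y * \1_(capS x dl) y).
  by apply/funext => y; rewrite [Phi _ _ _ _ _ _ * f y]mulrC.
rewrite (sint_charge_int nuPN (bmfunM bg (bmfun_indic (measurable_capS x dl)))) -EFinB.
apply: boundE => L c L0 c0 hA hB.
by have [_ _ h] := key L c L0 c0 hA hB.
Qed.
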